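(* Let $M$ be a connected smooth manifold without boundary, and let $G$ be a discrete group acting smoothly, properly, and effectively on $M$. Let $q\colon M\to M/G$ be the quotient map. Assume additionally that one of the following conditions holds: (i) every reflection in $G$ is dissecting; (ii) the manifold $M$ is simply connected. Then $q$ admits a continuous section if and only if $G$ is generated by reflections.
   Context: $M/G$ is the orbit space with the quotient topology; a continuous section of $q$ is a continuous map $s\colon M/G\to M$ with $q\circ s=\mathrm{id}_{M/G}$. For $g\in G$, $M^g=\{x\in M\mid gx=x\}$. An element $r\in G$ is called a reflection (over $M$) if some connected component of $M^r$ has codimension one in $M$. (Connected components of $M^g$ are closed submanifolds of $M$.) A reflection $r$ is called dissecting if $M\setminus M^r$ is not connected. *)

(* Defs.v *)
(* The real line is an arbitrary realType R. *)
From HB Require Import structures.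
From mathcomp Require Import all_boot all_order all_algebra.
From mathcomp Require Import all_classical all_reals all_analysis.

Set Implicit Arguments.
Unset Strict Implicit.
Unset Printing Implicit Defensive.

Import Order.TTheory GRing.Theory Num.Theory.
Import numFieldNormedType.Exports.

Local Open Scope classical_set_scope.
Local Open Scope ring_scope.
Local Open Scope quotient_scope.

(* Meaningful when D is open, which is the case at every use below. *)
Fixpoint Ck_on (R : realType) (n : nat) (D : set 'rV[R]_n) (k : nat)
    (f : 'rV[R]_n -> R) : Prop :=
  {in D, continuous f} /\
  if k is k'.+1 then
    forall i : 'I_n, {in D, forall x, derivable f x (delta_mx 0 i)} /\
      Ck_on D k' ('D_(delta_mx 0 i) f)
  else True.

Definition smooth_on (R : realType) (n m : nat) (D : set 'rV[R]_n)
    (f : 'rV[R]_n -> 'rV[R]_m) : Prop :=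
  forall (k : nat) (j : 'I_m), Ck_on D k (fun x => f x 0 j).

(* A homeomorphism from an open subset of M onto an open subset of R^n; the
   values of [coord] outside [dom] and of [param] outside the image of [dom]
   are irrelevant. *)
Record chart (R : realType) (n : nat) (M : topologicalType) := Chart {
  dom : set M;
  coord : M -> 'rV[R]_n;
  param : 'rV[R]_n -> M;
  open_dom : open dom;
  open_coord : open (coord @` dom);
  coordK : {in dom, cancel coord param};
  coord_cts : {in dom, continuous coord};
  param_cts : {in coord @` dom, continuous param} }.

Definition transition_smooth (R : realType) (n : nat) (M : topologicalType)
    (c d : chart R n M) : Prop :=
  smooth_on (coord c @` (dom c `&` dom d)) (coord d \o param c).

HB.mixin Record isSmoothManifold (R : realType) (n : nat) M of Topological M := {
  atlas : set (chart R n M);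
  atlas_cover : forall x : M, exists2 c, atlas c & dom c x;
  atlas_smooth : forall c d, atlas c -> atlas d -> transition_smooth c d;
  manifold_hausdorff : hausdorff_space M;
  manifold_second_countable : @second_countable M }.

(* Manifolds of dimension n; [atlas] need not be maximal. *)
#[short(type="smoothManifoldType")]
HB.structure Definition SmoothManifold (R : realType) (n : nat) :=
  {M of isSmoothManifold R n M & Topological M}.

(* Membership in the maximal atlas. *)
Definition smooth_chart (R : realType) (n : nat) (M : smoothManifoldType R n)
    (c : chart R n M) : Prop :=
  forall d, atlas d -> transition_smooth c d /\ transition_smooth d c.

Definition smooth_map (R : realType) (n m : nat) (M : smoothManifoldType R n)
    (N : smoothManifoldType R m) (f : M -> N) : Prop :=
  continuous f /\
  forall (c : chart R n M) (d : chart R m N), atlas c -> atlas d ->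
    smooth_on (coord c @` (dom c `&` f @^-1` dom d)) (coord d \o f \o param c).

(* Embedded submanifolds of dimension k: around each of its points, S is the
   zero locus of the last n - k coordinates of some smooth chart. *)
Definition submanifold (R : realType) (n : nat) (M : smoothManifoldType R n)
    (k : nat) (S : set M) : Prop :=
  (k <= n)%N /\
  forall p, S p -> exists c : chart R n M,
    [/\ smooth_chart c, dom c p &
        forall y, dom c y ->
          (S y <-> forall i : 'I_n, (k <= i)%N -> coord c y 0 i = 0)].

Definition has_codim (R : realType) (n : nat) (M : smoothManifoldType R n)
    (d : nat) (S : set M) : Prop :=
  exists k : nat, (k + d = n)%N /\ submanifold k S.

Definition path_connected (R : realType) (M : topologicalType) : Prop :=
  forall x y : M, exists c : R -> M,
    [/\ {within `[0, 1], continuous c}, c 0 = x & c 1 = y].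

Definition null_homotopic (R : realType) (M : topologicalType) (x : M)
    (c : R -> M) : Prop :=
  exists H : R * R -> M,
    [/\ {within `[0, 1] `*` `[0, 1], continuous H},
        forall t, t \in `[0, 1] -> H (0, t) = c t,
        forall t, t \in `[0, 1] -> H (1, t) = x &
        forall s, s \in `[0, 1] -> H (s, 0) = x /\ H (s, 1) = x].

Definition simply_connected (R : realType) (M : topologicalType) : Prop :=
  path_connected R M /\
  forall (x : M) (c : R -> M),
    {within `[0, 1], continuous c} -> c 0 = x -> c 1 = x ->
    null_homotopic x c.

#[short(type="discreteGroupType")]
HB.structure Definition DiscreteGroup := {G of Group G & DiscreteTopology G}.

Definition generated_by (G : groupType) (S : set G) : Prop :=
  smallest (fun H : set G => group_closed (mem H)) S = [set: G].

Record group_action (G : groupType) (M : Type) := GroupAction {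
  act :> G -> M -> M;
  act1 : forall x, act 1%g x = x;
  actM : forall g h x, act (g * h)%g x = act g (act h x) }.

(* Since G is discrete, smoothness of the map G x M -> M amounts to smoothness
   of each of its restrictions to {g} x M. *)
Definition smooth_action (R : realType) (n : nat) (M : smoothManifoldType R n)
    (G : discreteGroupType) (a : group_action G M) : Prop :=
  forall g, smooth_map (a g).

Definition proper_map (X Y : topologicalType) (f : X -> Y) : Prop :=
  continuous f /\ forall K : set Y, compact K -> compact (f @^-1` K).

Definition proper_action (M : topologicalType) (G : discreteGroupType)
    (a : group_action G M) : Prop :=
  proper_map (fun gx : G * M => (a gx.1 gx.2, gx.2)).

Definition effective_action (G : groupType) (M : Type)
    (a : group_action G M) : Prop :=
  forall g, (forall x, a g x = x) -> g = 1%g.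

Definition fixed_set (G : groupType) (M : Type) (a : group_action G M)
    (g : G) : set M := [set x | a g x = x].

(* The identity is not a reflection: its fixed set has codimension 0. *)
Definition reflection (R : realType) (n : nat) (M : smoothManifoldType R n)
    (G : groupType) (a : group_action G M) (r : G) : Prop :=
  exists2 x, fixed_set a r x &
    has_codim 1 (connected_component (fixed_set a r) x).

Definition dissecting (M : topologicalType) (G : groupType)
    (a : group_action G M) (r : G) : Prop :=
  ~ connected (~` fixed_set a r).

Section OrbitSpace.
Context (G : groupType) (M : topologicalType) (a : group_action G M).

Definition orbit_rel : rel M := fun x y => `[< exists g, a g x = y >].

Lemma orbit_rel_refl : reflexive orbit_rel.
Proof. by move=> x; apply/asboolP; exists 1%g; rewrite act1. Qed.

Lemma orbit_rel_sym : symmetric orbit_rel.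
Proof.
have imp x y : orbit_rel x y -> orbit_rel y x.
  move=> /asboolP[g <-]; apply/asboolP; exists (g^-1)%g.
  by rewrite -actM mulVg act1.
by move=> x y; apply/idP/idP; exact: imp.
Qed.

Lemma orbit_rel_trans : transitive orbit_rel.
Proof.
move=> y x z /asboolP[g <-] /asboolP[h <-]; apply/asboolP.
by exists (h * g)%g; rewrite actM.
Qed.

Definition orbit_equiv :=
  EquivRel orbit_rel orbit_rel_refl orbit_rel_sym orbit_rel_trans.

Definition orbit_space : Type := quotient_topology {eq_quot orbit_equiv}.
HB.instance Definition _ := Topological.on orbit_space.
HB.instance Definition _ := Quotient.on orbit_space.

Definition orbit_map : M -> orbit_space := \pi_orbit_space.

End OrbitSpace.

Definition continuous_section (X Y : topologicalType) (q : X -> Y)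
    (s : Y -> X) : Prop :=
  continuous s /\ q \o s = id.

(* Main.v *)
From HB Require Import structures.
Require Import Defs.
From mathcomp Require Import all_boot all_order all_algebra.
From mathcomp Require Import all_classical all_reals all_analysis.
From mathcomp Require Import zify ring lra.

(* Properness and averaging give slice charts: around each point x the finite
   stabilizer acts linearly on a convex coordinate neighbourhood.  There the
   points fixed by some element of a given set of group elements form a finite
   union of linear subspaces, and if all of these have codimension at least two
   the complement is still connected, locally and hence in M.  A subspace of
   codimension one occurs exactly where a reflection acts locally as a linear
   reflection.

   Given a section s, let H be the subgroup generated by the reflections and
   write x = k s(q x).  Where no element outside H fixes x, whether k can be
   taken in H is locally constant in x; such x form a connected set, so k is
   always in H, which forces G = H.

   Conversely, let every reflection be dissecting and let D be a component of
   the complement of all mirrors.  Crossing the mirrors one at a time, through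
   points lying on a single mirror, shows that the translates of the closure of
   D by the group generated by the reflections in its walls cover M.  The
   exchange condition shows that two points of the closure of D in one orbit
   coincide, so the closure of D maps bijectively onto M/G, and the inverse is
   the section.

   If M is simply connected and r is a reflection whose fixed set F does not
   separate M, join a point x next to a wall of r to r x outside F and return
   across the wall.  This loop crosses F once, but the number of crossings
   modulo two is the monodromy of a double cover, hence trivial on
   null-homotopic loops. *)

Set Implicit Arguments.
Unset Strict Implicit.
Unset Printing Implicit Defensive.

Import Order.TTheory GRing.Theory Num.Theory.
Import numFieldNormedType.Exports.
Import Defs.

Local Open Scope classical_set_scope.
Local Open Scope ring_scope.
Local Open Scope quotient_scope.

(** * Differential calculus on row vectors *)

Section Increments.
Variable R : realType.

(** Notions that must be compared between charts are stated without them: a wall is a fixed point at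
    which the complement of the fixed set fails to be locally connected, and a slice chart turns
    this into [rho r - 1] having rank one. The fixed set of a reflection may have components of
    higher codimension besides its hypersurfaces. Dissecting excludes them, since a fixed point with
    connected complement nearby leaves no room for two sides exchanged by [r]. Only then are all
    mirrors hyperplanes in slice charts, so that two of them meet in codimension two. Galleries of
    chambers are replaced by locally constant properties on the connected set of points lying on at
    most one mirror. The sides of a reflection are chosen arbitrarily, so only the relation of being
    on different sides is used; it is compatible with conjugation although the choices are not. A
    reflection is defined through smooth charts, so slice charts have to lie in the maximal atlas.
    Hence the linearizing map needs a smooth inverse. Averaging makes its Jacobian the identity, the
    only case in which the inverse function theorem is proved. *)

Lemma derive_line (V W : normedModType R) (f : V -> W) (z v : V) (s : R) :
  derivable f (s *: v + z) v ->
  is_derive s 1 (fun h => f (h *: v + z)) ('D_v f (s *: v + z)).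
Proof.
move=> df.
have E : (fun h : R => h^-1 *: (((fun h => f (h *: v + z)) \o shift s) (h *: 1)
            - f (s *: v + z)))
       = (fun h => h^-1 *: ((f \o shift (s *: v + z)) (h *: v) - f (s *: v + z))).
  by apply/funext => h /=; rewrite [h%:A]mulr1 scalerDl addrA.
by split; rewrite ?/derivable ?/derive E.
Qed.

(** The mean value theorem along a line. The two conditions on [s] place it between 0 and [t],
    whatever the sign of [t]. *)
Lemma increment_line (V : normedModType R) (f : V -> R) (z v : V) (t c e : R) :
  (forall s, `|s| <= `|t| -> 0 <= s * t -> derivable f (s *: v + z) v) ->
  (forall s, `|s| <= `|t| -> 0 <= s * t -> `|'D_v f (s *: v + z) - c| <= e) ->
  `|f (t *: v + z) - f z - c * t| <= e * `|t|.
Proof.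
move=> df bf; pose g h := f (h *: v + z).
have dg s : `|s| <= `|t| -> 0 <= s * t -> is_derive s 1 g ('D_v f (s *: v + z)).
  by move=> st st0; apply/derive_line/df.
have ctsg s : `|s| <= `|t| -> 0 <= s * t -> {for s, continuous g}.
  move=> st st0; apply/differentiable_continuous/derivable1_diffP.
  by have [] := dg s st st0.
have fz : f z = g 0 by rewrite /g scale0r add0r.
rewrite fz -/(g t).
suff [s s1 [s2 ->]] : exists2 s, `|s| <= `|t| &
    0 <= s * t /\ g t - g 0 = 'D_v f (s *: v + z) * t.
  by rewrite -mulrBl normrM ler_wpM2r// bf.
have wc (a b : R) : (forall s, s \in `[a, b] -> `|s| <= `|t| /\ 0 <= s * t) ->
    {within `[a, b], continuous g}.
  move=> h; apply/continuous_in_subspaceT => s /set_mem /= sab.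
  by have [] := h s sab => *; exact: ctsg.
have [t0|/ltW t0] := leP 0 t.
  have io s : s \in `[0, t] -> `|s| <= `|t| /\ 0 <= s * t.
    rewrite in_itv /= => /andP[s0 st].
    by rewrite !ger0_norm//; split => //; exact: mulr_ge0.
  have [||c' c'io E] := @MVT_segment R g (fun s => 'D_v f (s *: v + z)) _ _ t0.
  - by move=> s /subset_itv_oo_cc /io[]; exact: dg.
  - exact: wc.
  - by exists c'; rewrite ?subr0 in E *; have [] := io _ c'io.
have io s : s \in `[t, 0] -> `|s| <= `|t| /\ 0 <= s * t.
  rewrite in_itv /= => /andP[ts s0].
  by rewrite !ler0_norm// lerN2; split => //; exact: mulr_le0.
have [||c' c'io E] := @MVT_segment R g (fun s => 'D_v f (s *: v + z)) _ _ t0.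
- by move=> s /subset_itv_oo_cc /io[]; exact: dg.
- exact: wc.
- exists c'; have [] := io _ c'io => // _ ?; split => //.
  by rewrite -opprB E sub0r mulrN opprK.
Qed.

Lemma coord_le_norm n (x : 'rV[R]_n) i : `|x 0 i| <= `|x|.
Proof.
rewrite [leRHS]/Num.Def.normr/= mx_normrE.
by apply: le_trans (le_bigmax _ _ (0, i)).
Qed.

Lemma rV_norm_le n (x : 'rV[R]_n) e : 0 <= e ->
  (forall i, `|x 0 i| <= e) -> `|x| <= e.
Proof.
move=> e0 xe; rewrite /Num.Def.normr/= mx_normrE.
by apply: bigmax_le => // -[i j] _; rewrite ord1.
Qed.

Lemma rV_norm_lt n (x : 'rV[R]_n) e : 0 < e ->
  (forall i, `|x 0 i| < e) -> `|x| < e.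
Proof.
move=> e0 xe; rewrite /Num.Def.normr/= mx_normrE.
by apply: bigmax_lt => // -[i j] _; rewrite ord1.
Qed.

(** Coordinates are changed one at a time. For the sup norm a ball is a box, so the intermediate
    segments stay inside it and only partial derivatives enter. *)
Lemma increment_ball n (f : 'rV[R]_n -> R) (p : 'rV[R]_n) (r e : R)
    (c : 'I_n -> R) (x y : 'rV[R]_n) :
  (forall z, ball p r z -> forall i, derivable f z (delta_mx 0 i)) ->
  (forall z, ball p r z -> forall i, `|'D_(delta_mx 0 i) f z - c i| <= e) ->
  ball p r x -> ball p r y ->
  `|f x - f y - \sum_i c i * (x 0 i - y 0 i)| <= e * (\sum_i `|x 0 i - y 0 i|).
Proof.
move=> df bf bx by_.
have r0 : 0 < r by move: bx; rewrite -ball_normE /=; exact: le_lt_trans.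
(* The corners of a staircase from [y] at [k = 0] to [x] at [k = n]. *)
pose z k : 'rV[R]_n := \row_j (if (j < k)%N then x 0 j else y 0 j).
have z0 : z 0%N = y by apply/rowP => j; rewrite mxE.
have zn : z n = x by apply/rowP => j; rewrite mxE ltn_ord.
have -> : f x - f y = \sum_(i < n) (f (z i.+1) - f (z i)).
  by rewrite -zn -z0 -(@telescope_sumr _ 0 n (fun k => f (z k)))// big_mkord.
rewrite -sumrB mulr_sumr; apply: le_trans (ler_norm_sum _ _ _) _.
apply: ler_sum => i _.
set v := delta_mx 0 i : 'rV[R]_n; set t := x 0 i - y 0 i.
have zS : z i.+1 = t *: v + z i.
  apply/rowP => j; rewrite !mxE eqxx /= ltnS leq_eqVlt val_eqE.
  case: (eqVneq j i) => [->|ne]; first by rewrite ltnn mulr1 subrK.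
  by rewrite mulr0 add0r.
have zb s : `|s| <= `|t| -> 0 <= s * t -> ball p r (s *: v + z i).
  move=> st st0; move: bx by_; rewrite -ball_normE /= => bx by_.
  apply: rV_norm_lt => // j; rewrite !mxE eqxx /=.
  have bxj : `|p 0 j - x 0 j| < r.
    by apply: le_lt_trans bx; have := coord_le_norm (p - x) j; rewrite !mxE.
  have byj : `|p 0 j - y 0 j| < r.
    by apply: le_lt_trans by_; have := coord_le_norm (p - y) j; rewrite !mxE.
  case: (eqVneq j i) => [ji|ne]; last by rewrite mulr0 add0r; case: ifP.
  rewrite {j}ji in bxj byj *; rewrite ltnn mulr1.
  have : (0 <= s <= t) || (t <= s <= 0).
    case: (ltrgtP t 0) st st0 => [t0|t0|->].
    - by rewrite nmulr_lge0// => st s0; rewrite s0 andbT;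
        move: st; rewrite !ler0_norm ?(ltW t0)// lerN2 => ->; rewrite orbT.
    - by rewrite pmulr_lge0// => st s0; rewrite s0;
        move: st; rewrite !ger0_norm ?(ltW t0)// => ->.
    - by rewrite normr0 normr_le0 => /eqP ->; rewrite !lexx.
  rewrite /t => /orP[]/andP[? ?]; move: bxj byj; rewrite !ltr_norml => /andP[? ?] /andP[? ?]; lra.
rewrite zS; apply: increment_line => s st st0.
  by apply: df; exact: zb.
by apply: bf; exact: zb.
Qed.

End Increments.

(** * Functions with continuous iterated partial derivatives *)

Section Ck.
Variable R : realType.

Definition dot n (c h : 'rV[R]_n) : R := \sum_i c 0 i * h 0 i.

Lemma dot_is_linear n (c : 'rV[R]_n) : linear (dot c).
Proof.
move=> k x y; rewrite /dot scaler_sumr -big_split /=; apply: eq_bigr => i _.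
by rewrite !mxE mulrDr mulrCA.
Qed.

HB.instance Definition _ n (c : 'rV[R]_n) :=
  GRing.isLinear.Build R 'rV[R]_n R _ (dot c) (@dot_is_linear n c).

Lemma continuous_sum (T : topologicalType) (V : normedModType R) (I : Type)
    (r : seq I) (F : I -> T -> V) : (forall i, continuous (F i)) ->
  continuous (fun x => \sum_(i <- r) F i x).
Proof.
move=> cF; elim: r => [|i r IH].
  under eq_fun do rewrite big_nil.
  by move=> x; exact: cvg_cst.
under eq_fun do rewrite big_cons.
by move=> x; apply: cvgD; [exact: cF|exact: IH].
Qed.

Lemma dot_continuous n (c : 'rV[R]_n) : continuous (dot c).
Proof.
apply: continuous_sum => i x.
exact: (cvgM (cvg_cst (c 0 i)) (@coord_continuous _ _ _ 0 i x)).
Qed.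

Lemma diff_intro (V W : normedModType R) (f : V -> W) (df : {linear V -> W}) x :
  continuous df ->
  (forall e : R, 0 < e ->
     \forall h \near (0 : V), `|f (h + x) - f x - df h| <= e * `|h|) ->
  differentiable f x /\ 'd f x = df :> (V -> W).
Proof.
move=> cdf h0; have E : f \o shift x = cst (f x) + df +o_ 0 id.
  apply/eqaddoP => _/posnumP[e]; apply: filterS (h0 e%:num _) => // h.
  by rewrite !fctE /= opprD addrA.
have D := diff_unique cdf E.
by split; [apply/diff_locallyP; rewrite D|].
Qed.

Lemma near_forall_ord (T : topologicalType) n (x : T) (P : 'I_n -> T -> Prop) :
  (forall i, \forall y \near x, P i y) -> \forall y \near x, forall i, P i y.
Proof.
by move=> cfi; have := @filter_forall _ 'I_n P (nbhs x) (nbhs_filter x) cfi.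
Qed.

(** The increment estimate on a small ball, with the partial derivatives at [x] as coefficients, is
    the required little-o bound. *)
Lemma C1_diff n (f : 'rV[R]_n -> R) (x : 'rV[R]_n) :
  (\forall y \near x, forall i, derivable f y (delta_mx 0 i)) ->
  (forall i, {for x, continuous ('D_(delta_mx 0 i) f)}) ->
  differentiable f x /\
  'd f x = dot (\row_i 'D_(delta_mx 0 i) f x) :> ('rV[R]_n -> R).
Proof.
move=> df cf; set c := \row_i _.
apply: diff_intro => [|e e0]; first exact: dot_continuous.
(* A sum over [n] coordinates is at most [n] times the sup norm; [n.+1] keeps the denominator
   nonzero when [n = 0]. *)
pose e' := e / n.+1%:R.
have e'0 : 0 < e' by rewrite /e' divr_gt0.
have cf' : \forall y \near x, forall i : 'I_n,
    `|'D_(delta_mx 0 i) f y - 'D_(delta_mx 0 i) f x| <= e'.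
  apply: near_forall_ord => i.
  have /cvgrPdist_le /(_ _ e'0) := cf i; apply: filterS => y.
  by rewrite distrC.
have /nbhs_ballP : nbhs x ((fun y => forall i : 'I_n, derivable f y (delta_mx 0 i)) `&`
    (fun y => forall i : 'I_n,
       `|'D_(delta_mx 0 i) f y - 'D_(delta_mx 0 i) f x| <= e')) by exact: filterI.
move=> [r /= r0 br].
near=> h.
have bh : ball x r (h + x).
  rewrite -ball_normE /= opprD addrCA subrr addr0 normrN.
  by near: h; apply/nbhs_ballP; exists r => //= h; rewrite -ball_normE /= sub0r normrN.
have -> : f (h + x) - f x - dot c h =
    f (h + x) - f x - \sum_i c 0 i * ((h + x) 0 i - x 0 i).
  congr (_ - _); apply: eq_bigr => i _.
  by rewrite !mxE addrK.
apply: le_trans (@increment_ball _ _ f x r e' (fun i => c 0 i) (h + x) x _ _ _ _) _.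
- by move=> z /br[].
- by move=> z /br[_ h2] i; rewrite mxE.
- exact: bh.
- exact: ballxx.
under eq_bigr do rewrite !mxE addrK.
apply: (@le_trans _ _ (e' * (\sum_(i < n) `|h|))).
  by apply: ler_wpM2l; [exact: ltW|apply: ler_sum => i _; exact: coord_le_norm].
rewrite sumr_const card_ord -mulr_natl mulrA ler_wpM2r//.
by rewrite /e' -mulrA ger_pMr// ler_pdivrMl// mulr1 ler_nat.
Unshelve. all: by end_near. Qed.

Lemma Ck_on_near n (D : set 'rV[R]_n) k f x : open D -> D x -> Ck_on D k.+1 f ->
  differentiable f x /\
  'd f x = dot (\row_i 'D_(delta_mx 0 i) f x) :> ('rV[R]_n -> R).
Proof.
move=> oD Dx [_ cf]; apply: C1_diff => [|i].
  have : nbhs x D by rewrite nbhsE; exists D.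
  by apply: filterS => y Dy i; have [+ _] := cf i; apply; rewrite inE.
have [_] := cf i; case: k {cf} => [|k] [+ _]; apply; rewrite inE//.
Qed.

Lemma Ck_onW n (D : set 'rV[R]_n) k f : Ck_on D k.+1 f -> Ck_on D k f.
Proof.
elim: k f => [|k IH] f [cf df]; split=> // i.
by have [? ?] := df i; split=> //; exact: IH.
Qed.

Lemma Ck_onS n (D E : set 'rV[R]_n) k f : D `<=` E -> Ck_on E k f -> Ck_on D k f.
Proof.
move=> DE; elim: k f => [|k IH] f [cf df].
  by split=> // x /set_mem/DE/mem_set; exact: cf.
split; first by move=> x /set_mem/DE/mem_set; exact: cf.
move=> i; have [d1 d2] := df i; split; last exact: IH.
by move=> x /set_mem/DE/mem_set; exact: d1.
Qed.

Lemma open_near_eq (T : topologicalType) (U : Type) (D : set T) (f g : T -> U) x :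
  open D -> D x -> {in D, f =1 g} -> {near x, f =1 g}.
Proof.
move=> oD Dx fg; have : nbhs x D by rewrite nbhsE; exists D.
by apply: filterS => y /mem_set /fg.
Qed.

Lemma eq_continuous_on (T U : topologicalType) (D : set T) (f g : T -> U) :
  open D -> {in D, f =1 g} -> {in D, continuous f} -> {in D, continuous g}.
Proof.
move=> oD fg cf x xD; have /set_mem Dx := xD.
rewrite /prop_for /continuous_at -(fg _ xD).
apply: cvg_trans (cf x xD); apply: near_eq_cvg.
by apply: filterS (open_near_eq oD Dx fg) => y ->.
Qed.

Lemma eq_Ck_on n (D : set 'rV[R]_n) k f g : open D -> {in D, f =1 g} ->
  Ck_on D k f -> Ck_on D k g.
Proof.
move=> oD; elim: k f g => [|k IH] f g fg [cf df].
  by split=> //; exact: eq_continuous_on cf.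
split; first exact: eq_continuous_on cf.
move=> i; have [d1 d2] := df i; split.
  move=> x xD; apply: near_eq_derivable (d1 x xD).
  by apply: open_near_eq oD _ fg; exact: set_mem.
apply: IH d2 => x xD; apply: near_eq_derive.
by apply: open_near_eq oD _ fg; exact: set_mem.
Qed.

Lemma Ck_on_cst n (D : set 'rV[R]_n) k (c : R) : Ck_on D k (cst c).
Proof.
elim: k c => [|k IH] c; split=> //; try by move=> x _; exact: cst_continuous.
move=> i; split; first by move=> x _; exact: derivable_cst.
have -> : 'D_(delta_mx 0 i) (cst c) = cst 0 :> ('rV[R]_n -> R).
  by apply/funext => x; rewrite derive_cst.
exact: IH.
Qed.

Lemma Ck_onD n (D : set 'rV[R]_n) k f g : open D -> Ck_on D k f -> Ck_on D k g ->
  Ck_on D k (fun x => f x + g x).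
Proof.
move=> oD; elim: k f g => [|k IH] f g [cf df] [cg dg].
  by split=> // x xD; exact: (cvgD (cf x xD) (cg x xD)).
split=> [x xD|i]; first by exact: (cvgD (cf x xD) (cg x xD)).
have [[d1 d2] [e1 e2]] := (df i, dg i); split.
  by move=> x xD; exact: (derivableD (d1 x xD) (e1 x xD)).
apply: eq_Ck_on oD _ (IH _ _ d2 e2) => x xD /=.
exact: esym (deriveD (d1 x xD) (e1 x xD)).
Qed.

Lemma Ck_onM n (D : set 'rV[R]_n) k f g : open D -> Ck_on D k f -> Ck_on D k g ->
  Ck_on D k (fun x => f x * g x).
Proof.
move=> oD; elim: k f g => [|k IH] f g Cf Cg.
  have [[cf _] [cg _]] := (Cf, Cg).
  by split=> // x xD; exact: (cvgM (cf x xD) (cg x xD)).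
have [[cf df] [cg dg]] := (Cf, Cg).
split=> [x xD|i]; first by exact: (cvgM (cf x xD) (cg x xD)).
have [[d1 d2] [e1 e2]] := (df i, dg i); split.
  by move=> x xD; exact: (derivableM (d1 x xD) (e1 x xD)).
apply: eq_Ck_on oD _ (Ck_onD oD (IH _ _ (Ck_onW Cf) e2) (IH _ _ (Ck_onW Cg) d2)).
by move=> x xD; exact: esym (deriveM (d1 x xD) (e1 x xD)).
Qed.

Lemma Ck_on_sum n (D : set 'rV[R]_n) k (I : Type) (r : seq I) (P : pred I)
    (F : I -> 'rV[R]_n -> R) : open D ->
  (forall i, P i -> Ck_on D k (F i)) -> Ck_on D k (fun x => \sum_(i <- r | P i) F i x).
Proof.
move=> oD CF; elim: r => [|i r IH].
  by apply: eq_Ck_on oD _ (@Ck_on_cst _ _ _ 0) => x _; rewrite big_nil.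
case: (boolP (P i)) => Pi.
  apply: eq_Ck_on oD _ (Ck_onD oD (CF i Pi) IH) => x _.
  by rewrite big_cons Pi.
by apply: eq_Ck_on oD _ IH => x _; rewrite big_cons (negPf Pi).
Qed.

Lemma Ck_on_prod n (D : set 'rV[R]_n) k (I : Type) (r : seq I) (P : pred I)
    (F : I -> 'rV[R]_n -> R) : open D ->
  (forall i, P i -> Ck_on D k (F i)) -> Ck_on D k (fun x => \prod_(i <- r | P i) F i x).
Proof.
move=> oD CF; elim: r => [|i r IH].
  by apply: eq_Ck_on oD _ (@Ck_on_cst _ _ _ 1) => x _; rewrite big_nil.
case: (boolP (P i)) => Pi.
  apply: eq_Ck_on oD _ (Ck_onM oD (CF i Pi) IH) => x _.
  by rewrite big_cons Pi.
by apply: eq_Ck_on oD _ IH => x _; rewrite big_cons (negPf Pi).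
Qed.

Lemma Ck_onV n (D : set 'rV[R]_n) k f : open D -> {in D, forall x, f x != 0} ->
  Ck_on D k f -> Ck_on D k (fun x => (f x)^-1).
Proof.
move=> oD f0; elim: k f f0 => [|k IH] f f0 Cf.
  have [cf _] := Cf; split=> // x xD; exact: (cvgV (f0 x xD) (cf x xD)).
have [cf df] := Cf; split=> [x xD|i].
  by exact: (cvgV (f0 x xD) (cf x xD)).
have [d1 d2] := df i; split.
  by move=> x xD; apply: derivableV; [exact: f0|exact: d1].
have Ci := IH _ f0 (Ck_onW Cf).
apply: eq_Ck_on oD _ (Ck_onM oD (Ck_onM oD (@Ck_on_cst _ _ _ (-1)) d2) (Ck_onM oD Ci Ci)).
move=> x xD; rewrite (deriveV (f0 x xD) (d1 x xD)) /GRing.scale /= expr2 invfM.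
by rewrite mulN1r !mulNr mulrC.
Qed.

Lemma Ck_on_dot n (D : set 'rV[R]_n) k (c : 'rV[R]_n) : Ck_on D k (dot c).
Proof.
case: k => [|k]; split=> //; try by move=> x _; exact: dot_continuous.
have dd x : differentiable (dot c) x.
  by apply: linear_differentiable; exact: dot_continuous.
move=> j; split=> [x _|]; first exact: diff_derivable.
have -> : 'D_(delta_mx 0 j) (dot c) = cst (dot c (delta_mx 0 j)).
  by apply/funext => x; rewrite deriveE// diff_lin//; exact: dot_continuous.
exact: Ck_on_cst.
Qed.

Lemma dot_delta n (i : 'I_n) (x : 'rV[R]_n) : dot (delta_mx 0 i) x = x 0 i.
Proof.
rewrite /dot (bigD1 i)//= big1 ?mxE ?eqxx ?mul1r ?addr0// => j ji.
by rewrite mxE (negPf ji) mul0r.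
Qed.

Lemma dot_deltar n (i : 'I_n) (c : 'rV[R]_n) : dot c (delta_mx 0 i) = c 0 i.
Proof.
rewrite /dot (bigD1 i)//= big1 ?mxE ?eqxx ?mulr1 ?addr0// => j ji.
by rewrite mxE (negPf ji) mulr0.
Qed.

Lemma rV_differentiable n m (f : 'rV[R]_n -> 'rV[R]_m) x :
  (forall j, differentiable (fun y => f y 0 j) x) -> differentiable f x.
Proof.
move=> df.
have -> : f = \sum_(j < m) (fun y => f y 0 j *: delta_mx 0 j : 'rV[R]_m).
  apply/funext => y; rewrite fct_sumE; apply/rowP => j.
  rewrite summxE (bigD1 j)//= big1 ?addr0 ?mxE ?eqxx ?mulr1//.
  by move=> k kj; rewrite !mxE eqxx /= eq_sym (negPf kj) mulr0.
by apply: differentiable_sum => j; exact: differentiableZl.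
Qed.

Lemma derive_coord n m (f : 'rV[R]_n -> 'rV[R]_m) x v j : derivable f x v ->
  'D_v f x 0 j = 'D_v (fun y => f y 0 j) x.
Proof. by move=> /derive_mx ->; rewrite mxE. Qed.

Lemma rV_continuous (T : topologicalType) m (f : T -> 'rV[R]_m) (x : T) :
  (forall j, {for x, continuous (fun y => f y 0 j)}) -> {for x, continuous f}.
Proof.
move=> cf; apply/cvgrPdist_lt => e e0; near=> y.
apply: rV_norm_lt => // j; rewrite !mxE.
by move: j; near: y; apply: near_forall_ord => j; have /cvgrPdist_lt /(_ _ e0) := cf j.
Unshelve. all: by end_near. Qed.

Lemma derive_comp n m (f : 'rV[R]_n -> 'rV[R]_m) (g : 'rV[R]_m -> R)
    (D : set 'rV[R]_n) (E : set 'rV[R]_m) k x i :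
  open D -> open E -> D x -> E (f x) ->
  (forall j, Ck_on D k.+1 (fun x => f x 0 j)) -> Ck_on E k.+1 g ->
  differentiable (g \o f) x /\
  'D_(delta_mx 0 i) (g \o f) x =
   \sum_j 'D_(delta_mx 0 j) g (f x) * 'D_(delta_mx 0 i) (fun x => f x 0 j) x.
Proof.
move=> oD oE Dx Efx Cf Cg.
have df : differentiable f x.
  by apply: rV_differentiable => j; have [] := Ck_on_near oD Dx (Cf j).
have [dg Eg] := Ck_on_near oE Efx Cg.
have dgf : differentiable (g \o f) x by exact: differentiable_comp.
split=> //; rewrite deriveE// diff_comp//= Eg /dot; apply: eq_bigr => j _.
by rewrite mxE -deriveE// derive_coord//; exact: diff_derivable.
Qed.

(** Induction on [k]: the chain rule writes a partial derivative of the composite as a sum of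
    products whose factors are [Ck] by the induction hypothesis. *)
Lemma Ck_on_comp n m (f : 'rV[R]_n -> 'rV[R]_m) (g : 'rV[R]_m -> R)
    (D : set 'rV[R]_n) (E : set 'rV[R]_m) k :
  open D -> open E -> (forall x, D x -> E (f x)) ->
  (forall j, Ck_on D k (fun x => f x 0 j)) -> Ck_on E k g -> Ck_on D k (g \o f).
Proof.
move=> oD oE fDE; elim: k g => [|k IH] g Cf Cg.
  split=> // x /set_mem Dx; apply: continuous_comp.
    by apply: rV_continuous => j; have [+ _] := Cf j; apply; rewrite inE.
  by have [+ _] := Cg; apply; rewrite inE; exact: fDE.
split=> [x /set_mem Dx|i].
  apply: continuous_comp.
    by apply: rV_continuous => j; have [+ _] := Cf j; apply; rewrite inE.
  by have [+ _] := Cg; apply; rewrite inE; exact: fDE.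
split=> [x /set_mem Dx|].
  apply: diff_derivable.
  by have [] := derive_comp i oD oE Dx (fDE _ Dx) Cf Cg.
have C : Ck_on D k (fun x =>
    \sum_j 'D_(delta_mx 0 j) g (f x) * 'D_(delta_mx 0 i) (fun x => f x 0 j) x).
  apply: Ck_on_sum => // j _; apply: Ck_onM => //.
    apply: (IH ('D_(delta_mx 0 j) g)) => [l|]; first exact: Ck_onW.
    by have [_ /(_ j)[]] := Cg.
  by have [_ /(_ i)[]] := Cf j.
apply: (eq_Ck_on oD _ C) => x /set_mem Dx.
by have [_ ->] := derive_comp i oD oE Dx (fDE _ Dx) Cf Cg.
Qed.

Lemma Ck_on_det n m (D : set 'rV[R]_n) k (A : 'rV[R]_n -> 'M[R]_m) : open D ->
  (forall i j, Ck_on D k (fun x => A x i j)) -> Ck_on D k (fun x => \det (A x)).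
Proof.
move=> oD CA; rewrite /determinant.
apply: (Ck_on_sum (index_enum _) oD) => s _; apply: (Ck_onM oD); first exact: Ck_on_cst.
exact: Ck_on_prod.
Qed.

(** Cramer's formula: the entries are cofactors divided by the determinant. *)
Lemma Ck_on_invmx n m (D : set 'rV[R]_n) k (A : 'rV[R]_n -> 'M[R]_m) : open D ->
  {in D, forall x, A x \in unitmx} ->
  (forall i j, Ck_on D k (fun x => A x i j)) ->
  forall i j, Ck_on D k (fun x => invmx (A x) i j).
Proof.
move=> oD uA CA i j.
suff C : Ck_on D k (fun x => (\det (A x))^-1 * cofactor (A x) j i).
  by apply: (eq_Ck_on oD _ C) => x /uA Au; rewrite /invmx Au !mxE.
apply: (Ck_onM oD).
  apply: (Ck_onV oD); last exact: Ck_on_det.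
  by move=> x /uA; rewrite unitmxE unitfE.
apply: (Ck_onM oD); first exact: Ck_on_cst.
apply: Ck_on_det => // a b.
by apply: eq_Ck_on oD _ (CA (lift j a) (lift i b)) => x _; rewrite !mxE.
Qed.

End Ck.

(** * The inverse function theorem at a point with identity Jacobian *)

Section InverseFunction.
Variable R : realType.

Lemma diff_elim (V W : normedModType R) (f : V -> W) x (e : R) :
  differentiable f x -> 0 < e ->
  \forall h \near (0 : V), `|f (h + x) - f x - 'd f x h| <= e * `|h|.
Proof.
move=> /diff_locally /eqaddoP E e0.
apply: filterS (E e e0) => h; by rewrite !fctE /= opprD addrA.
Qed.

Lemma mulmx_norm_le n m (A : 'M[R]_(n, m)) (x : 'rV[R]_n) :
  `|x *m A| <= (\sum_i \sum_j `|A i j|) * `|x|.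
Proof.
apply: rV_norm_le => [|j].
  by rewrite mulr_ge0// sumr_ge0// => i _; rewrite sumr_ge0.
rewrite mxE mulr_suml; apply: le_trans (ler_norm_sum _ _ _) _.
apply: ler_sum => i _; rewrite normrM mulrC; apply: ler_pM => //.
  rewrite (bigD1 j)//= lerDl sumr_ge0//.
exact: coord_le_norm.
Qed.

(** The displacement [|x - h x|] attains its minimum on [K]; at a minimizer that is not fixed, one
    application of [h] would make it strictly smaller. *)
Lemma compact_contraction_fixpoint n (K : set 'rV[R]_n)
    (h : 'rV[R]_n -> 'rV[R]_n) (q : R) :
  compact K -> K !=set0 -> q < 1 -> (forall x, K x -> K (h x)) ->
  (forall x y, K x -> K y -> `|h x - h y| <= q * `|x - y|) ->
  exists2 x, K x & h x = x.
Proof.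
move=> cK K0 q1 hK hq.
have hc : {within K, continuous (fun x => `|x - h x|)}.
  apply/subspace_continuousP => x Kx; apply/cvgrPdist_lt => e e0.
  rewrite near_withinE; near=> y => Ky.
  apply: le_lt_trans (ler_dist_dist _ _) _.
  have -> : x - h x - (y - h y) = (x - y) - (h x - h y).
    by apply/rowP => i; rewrite !mxE; ring.
  apply: le_lt_trans (ler_normB _ _) _.
  apply: (@le_lt_trans _ _ (`|x - y| + `|x - y|)).
    rewrite lerD2l; apply: le_trans (hq _ _ Kx Ky) _.
    by rewrite ler_piMl// ltW.
  rewrite -mulr2n -mulr_natl -ltr_pdivlMl// mulrC.
  near: y; apply/nbhs_ballP; exists (e / 2) => /=; first by rewrite divr_gt0.
  by move=> y; rewrite -ball_normE.
have [c Kc cmin] := EVT_min_rV K0 cK hc.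
have {}Kc := set_mem Kc; exists c => //; apply: contrapT => /eqP ne.
have d0 : 0 < `|c - h c| by rewrite normr_gt0 subr_eq0 eq_sym.
have := cmin _ (mem_set (hK _ Kc)); rewrite leNgt => /negP; apply.
apply: le_lt_trans (hq _ _ Kc (hK _ Kc)) _.
by rewrite -[ltRHS]mul1r ltr_pM2r.
Unshelve. all: by end_near. Qed.

(** Solving [f y = w] means fixing [y - f y + w], a contraction with factor one half. Half of the
    radius [d] is spent on the contraction and half on the distance from [w] to [f x], so the ball
    is mapped to itself. *)
Lemma closed_ball_contraction_surj n (f : 'rV[R]_n -> 'rV[R]_n) x d :
  0 < d ->
  (forall y z, `|y - x| <= d -> `|z - x| <= d ->
     `|(f y - f z) - (y - z)| <= 2^-1 * `|y - z|) ->
  forall w, `|w - f x| <= 2^-1 * d -> exists2 y, `|y - x| <= d & f y = w.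
Proof.
move=> d0 hf w wx.
have half : (2^-1 : R) < 1 by rewrite invf_lt1// ltr1n.
pose h y := y - f y + w.
have xx : `|x - x| <= d by rewrite subrr normr0 ltW.
have hE y z : h y - h z = - ((f y - f z) - (y - z)).
  by apply/rowP => i; rewrite !mxE; ring.
have [||//|y|y z yx zx|y yx hy] :=
    @compact_contraction_fixpoint n [set y | `|y - x| <= d] h 2^-1.
- apply: bounded_closed_compact.
    exists (d + `|x|); split; first exact: num_real.
    move=> M dM y /= yx; apply: le_trans (ltW dM).
    by rewrite -[y](subrK x); apply: le_trans (ler_normD _ _) _; rewrite lerD2r.
  have -> : [set y | `|y - x| <= d] = (fun y => `|y - x|) @^-1` [set t | t <= d] by [].
  apply: closed_comp; last exact: closed_le.
  by move=> y _; exact: (cvg_norm (cvgB cvg_id (cvg_cst x))).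
- by exists x.
- move=> /= yx; have -> : h y - x = (h y - h x) + (w - f x).
    by rewrite /h; apply/rowP => i; rewrite !mxE; ring.
  apply: le_trans (ler_normD _ _) _.
  rewrite [leRHS](_ : d = 2^-1 * d + 2^-1 * d); last by lra.
  apply: lerD => //; rewrite hE normrN.
  by apply: le_trans (hf _ _ yx xx) _; rewrite ler_pM2l.
- by rewrite hE normrN; exact: hf.
exists y => //; move: hy; rewrite /h -addrA => /eqP; rewrite -subr_eq0 addrAC.
by rewrite subrr add0r addrC subr_eq0 => /eqP.
Qed.

(** The transpose of the usual Jacobian: it acts on row vectors from the right, so rows are indexed
    by directions. *)
Definition jac n (f : 'rV[R]_n -> 'rV[R]_n) x : 'M[R]_n :=
  \matrix_(i, j) 'D_(delta_mx 0 i) (fun x => f x 0 j) x.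

Lemma jac_diff n k (D : set 'rV[R]_n) (f : 'rV[R]_n -> 'rV[R]_n) x : open D -> D x ->
  (forall j, Ck_on D k.+1 (fun x => f x 0 j)) ->
  forall e : R, 0 < e ->
  \forall h \near (0 : 'rV[R]_n), `|f (h + x) - f x - h *m jac f x| <= e * `|h|.
Proof.
move=> oD Dx Cf e e0.
have H j : \forall h \near (0 : 'rV[R]_n), `|f (h + x) 0 j - f x 0 j - (h *m jac f x) 0 j| <= e * `|h|.
  have [df Ef] := Ck_on_near oD Dx (Cf j).
  apply: filterS (diff_elim df e0) => h; rewrite Ef mxE /dot.
  by under eq_bigr do rewrite mxE mulrC; under [in X in _ -> X]eq_bigr do rewrite mxE.
apply: filterS (near_forall_ord H) => h hj.
apply: rV_norm_le => [|j]; first by rewrite mulr_ge0// ltW.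
by have := hj j; rewrite !mxE.
Qed.

(** Continuity keeps the first partial derivatives close to the identity matrix on a ball, and
    [increment_ball] integrates this bound. *)
Lemma strict_diff n (D : set 'rV[R]_n) (f : 'rV[R]_n -> 'rV[R]_n) p :
  open D -> D p -> smooth_on D f -> jac f p = 1%:M ->
  exists2 r : R, 0 < r & forall x, ball p r x ->
    [/\ D x, forall y, ball p r y -> `|(f x - f y) - (x - y)| <= 2^-1 * `|x - y| &
        forall v : 'rV[R]_n, `|v *m jac f x - v| <= 2^-1 * `|v|].
Proof.
move=> oD Dp Sf Jp.
pose e : R := 2^-1 / n.+1%:R.
have e0 : 0 < e by rewrite /e divr_gt0.
have H : \forall z \near p, forall i j : 'I_n,
    `|'D_(delta_mx 0 i) (fun x => f x 0 j) z - (i == j)%:R| <= e.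
  apply: near_forall_ord => i; apply: near_forall_ord => j.
  have [_ /(_ i)[_ [+ _]]] := Sf 1%N j.
  move=> /(_ p (mem_set Dp)) /cvgrPdist_le /(_ _ e0).
  have -> : 'D_(delta_mx 0 i) (fun x => f x 0 j) p = (i == j)%:R.
    by have := congr1 (fun M : 'M[R]_n => M i j) Jp; rewrite !mxE.
  by apply: filterS => z; rewrite distrC.
have /nbhs_ballP[r /= r0 br] : nbhs p (D `&` [set z | forall i j : 'I_n,
    `|'D_(delta_mx 0 i) (fun x => f x 0 j) z - (i == j)%:R| <= e]).
  by apply: filterI => //; rewrite nbhsE; exists D.
have e_sum (v : 'rV[R]_n) : e * (\sum_i `|v 0 i|) <= 2^-1 * `|v|.
  apply: (@le_trans _ _ (e * (\sum_(i < n) `|v|))).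
    by rewrite ler_pM2l//; apply: ler_sum => i _; exact: coord_le_norm.
  rewrite sumr_const card_ord -[_ *+ n]mulr_natl mulrA ler_wpM2r//.
  by rewrite /e -mulrA ger_pMr// ler_pdivrMl// mulr1 ler_nat.
exists r => // x bx; have [Dx dx] := br _ bx; split=> // [y by_|v].
  apply: rV_norm_le => [|j]; first by rewrite mulr_ge0// invr_ge0.
  have := @increment_ball R n (fun x => f x 0 j) p r e (fun i => (i == j)%:R) x y.
  rewrite (bigD1 j)//= eqxx mul1r big1 ?addr0; last first.
    by move=> i /negPf ->; rewrite mul0r.
  move=> /(_ _ _ bx by_) h; rewrite !mxE.
  apply: le_trans (h _ _) _ => [z /br[Dz _] i|z /br[_ +] i|]; last 1 first.
  - by apply: le_trans (e_sum _); under [in leRHS]eq_bigr do rewrite !mxE.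
  - by have [_ /(_ i)[+ _]] := Sf 1%N j; apply; rewrite inE.
  - by apply.
apply: rV_norm_le => [|j]; first by rewrite mulr_ge0// invr_ge0.
apply: le_trans (e_sum v); rewrite !mxE mulr_sumr.
have {1}-> : v 0 j = \sum_i v 0 i * (i == j)%:R.
  rewrite (bigD1 j)//= eqxx mulr1 big1 ?addr0//.
  by move=> i /negPf ->; rewrite mulr0.
rewrite -sumrB; apply: le_trans (ler_norm_sum _ _ _) _; apply: ler_sum => i _.
by rewrite -mulrBr normrM mulrC ler_wpM2r// mxE.
Qed.

Lemma near_unitmx n (A : 'M[R]_n) :
  (forall v : 'rV[R]_n, `|v *m A - v| <= 2^-1 * `|v|) -> A \in unitmx.
Proof.
move=> hA; rewrite -row_free_unit; apply/row_freeP.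
apply/row_freeP; apply: inj_row_free => v vA.
have := hA v; rewrite vA sub0r normrN => h.
apply/eqP; rewrite -normr_eq0 eq_le normr_ge0 andbT.
lra.
Qed.

Lemma lipschitz_continuous_on (V W : normedModType R) (D : set V) (g : V -> W) (K : R) :
  0 < K -> open D ->
  (forall y z, D y -> D z -> `|g y - g z| <= K * `|y - z|) -> {in D, continuous g}.
Proof.
move=> K0 oD lg y /set_mem Dy; apply/cvgrPdist_lt => e e0.
have nD : nbhs y D by rewrite nbhsE; exists D.
near=> z.
have Dz : D z by near: z.
apply: le_lt_trans (lg _ _ Dy Dz) _.
rewrite -ltr_pdivlMl// mulrC; near: z; apply/nbhs_ballP; exists (e / K) => /=.
  by rewrite divr_gt0.
by move=> z; rewrite -ball_normE.
Unshelve. all: by end_near. Qed.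

(** On a small ball [f] differs from the identity by a map of Lipschitz constant one half. Hence [f]
    shrinks distances at most by a factor 2, which gives injectivity and a Lipschitz inverse, and
    its image is open by the contraction argument. *)
Lemma inverse_function n (D : set 'rV[R]_n) (f : 'rV[R]_n -> 'rV[R]_n) p :
  open D -> D p -> smooth_on D f -> jac f p = 1%:M ->
  exists V g, [/\ open V, V p, V `<=` D & [/\ open (f @` V), {in V, cancel f g} &
    smooth_on (f @` V) g]].
Proof.
move=> oD Dp Sf Jp.
have [r r0 Hr] := strict_diff oD Dp Sf Jp.
pose V : set 'rV[R]_n := ball p r.
have oV : open V by exact: ball_open.
have VD : V `<=` D by move=> x /Hr[].
have expand x y : V x -> V y -> `|x - y| <= 2 * `|f x - f y|.
  move=> Vx Vy; have [_ /(_ _ Vy) h _] := Hr _ Vx.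
  have : `|x - y| <= `|f x - f y| + `|(f x - f y) - (x - y)|.
    have {1}-> : x - y = (f x - f y) - ((f x - f y) - (x - y)).
      by apply/rowP => i; rewrite !mxE; ring.
    exact: ler_normB.
  lra.
pose g := fun y => xget p [set x | V x /\ f x = y].
have gK : {in V, cancel f g}.
  move=> x /set_mem Vx; rewrite /g; case: xgetP => [y _ [Vy fyx]|/(_ x)]; last by case.
  apply/eqP; rewrite -subr_eq0 -normr_le0.
  by apply: le_trans (expand _ _ Vy Vx) _; rewrite fyx subrr normr0 mulr0.
have oW : open (f @` V).
  rewrite openE => _ [x Vx <-].
  have : nbhs x V by rewrite nbhsE; exists V.
  move=> /nbhs_ballP[d /= d0 bd].
  have d20 : 0 < d / 2 by rewrite divr_gt0.
  have cb y : `|y - x| <= d / 2 -> V y.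
    move=> yx; apply: bd; rewrite -ball_normE /= distrC.
    by apply: le_lt_trans yx _; rewrite ltr_pdivrMr// ltr_pMr// ltr1n.
  apply/nbhs_ballP; exists (2^-1 * (d / 2)) => /=; first by rewrite mulr_gt0// invr_gt0.
  move=> w; rewrite -ball_normE /= distrC => /ltW wx.
  have [y z yx zx|y yx <-] := closed_ball_contraction_surj d20 _ wx.
    by have [_ + _] := Hr _ (cb _ yx); apply; exact: cb.
  by exists y => //; exact: cb.
have gV y : (f @` V) y -> V (g y) /\ f (g y) = y.
  by move=> [x Vx <-]; rewrite gK ?inE.
exists V, g; split=> //; first exact: ballxx.
split=> //.
have g_lip y z : (f @` V) y -> (f @` V) z -> `|g y - g z| <= 2 * `|y - z|.
  by move=> /gV[? {2}<-] /gV[? {2}<-]; exact: expand.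
have g_near y : (f @` V) y -> \forall h \near (0 : 'rV[R]_n), (f @` V) (h + y).
  move=> Wy; have : nbhs y (f @` V) by rewrite nbhsE; exists (f @` V).
  move=> /nbhs_ballP[d /= d0 bd]; apply/nbhs_ballP; exists d => //= h.
  rewrite -ball_normE /= sub0r normrN => hd; apply: bd.
  by rewrite -ball_normE /= opprD addrCA subrr addr0 normrN.
have Cg j : {in f @` V, continuous (fun y => g y 0 j)}.
  move=> y Wy; apply: (@continuous_comp _ _ _ g (fun x : 'rV[R]_n => x 0 j)).
    have two_gt0 : 0 < 2 :> R by [].
    exact: (lipschitz_continuous_on two_gt0 oW g_lip Wy).
  exact: coord_continuous.
have Ju x : V x -> jac f x \in unitmx.
  by move=> /Hr[_ _ ?]; exact: near_unitmx.
(* With [u] the increment of [g], [h] equals [u *m jac f x] up to a small multiple of [|u|], and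
   [|u| <= 2 * |h|]. The constant [C] below bounds the effect of multiplying by the inverse
   Jacobian. *)
have Dg y j : (f @` V) y -> differentiable (fun y => g y 0 j) y /\
    'd (fun y => g y 0 j) y = dot (\row_i invmx (jac f (g y)) i j) :> ('rV[R]_n -> R).
  move=> Wy; have [Vx fx] := gV _ Wy; set x := g y in Vx fx *.
  set A := invmx (jac f x).
  apply: diff_intro => [|e e0]; first exact: dot_continuous.
  pose C := \sum_i \sum_j `|A i j| + 1.
  have C0 : 0 < C.
    by rewrite ltr_wpDl// sumr_ge0// => i _; rewrite sumr_ge0.
  have eC0 : 0 < e / (2 * C) by rewrite divr_gt0// mulr_gt0.
  have /nbhs_ballP[d /= d0 bd] := jac_diff oD (VD _ Vx) (Sf 1%N) eC0.
  have nW := g_near _ Wy.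
  near=> h.
  have Wh : (f @` V) (h + y) by near: h.
  have [Vh fh] := gV _ Wh.
  pose u := g (h + y) - x.
  have uh : `|u| <= 2 * `|h|.
    by have := g_lip _ _ Wh Wy; rewrite addrK.
  have := bd u; rewrite -ball_normE /= sub0r normrN.
  rewrite /u subrK fh fx addrK -/u => /(_ _) hu.
  have {}hu : `|h - u *m jac f x| <= e / (2 * C) * `|u|.
    apply: hu; apply: le_lt_trans uh _; rewrite -ltr_pdivlMl// mulrC.
    near: h; apply/nbhs_ballP; exists (d / 2) => /=; first by rewrite divr_gt0.
    by move=> h; rewrite -ball_normE /= sub0r normrN.
  have -> : g (h + y) 0 j - x 0 j - dot (\row_i A i j) h =
      - ((h - u *m jac f x) *m A) 0 j.
    rewrite mulmxBl mulmxK; last exact: Ju.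
    rewrite /u !mxE /dot opprB; congr (_ - _).
    by apply: eq_bigr => i _; rewrite mxE mulrC.
  rewrite normrN; apply: le_trans (coord_le_norm _ _) _.
  apply: le_trans (mulmx_norm_le _ _) _.
  apply: (@le_trans _ _ (C * (e / (2 * C) * (2 * `|h|)))).
    apply: ler_pM => //.
    - by rewrite sumr_ge0// => i _; rewrite sumr_ge0.
    - by rewrite /C lerDl.
    - by apply: le_trans hu _; rewrite ler_pM2l.
  have -> // : C * (e / (2 * C) * (2 * `|h|)) = e * `|h|.
  by field; rewrite gt_eqF.
move=> k; elim: k => [|k IH] j; first by split.
split=> // i; split=> [y /set_mem Wy|].
  by apply: diff_derivable; have [] := Dg _ j Wy.
(* Smoothness bootstraps: the partial derivatives of [g] are entries of the inverse Jacobian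
   evaluated at [g], which is already [Ck]. *)
have CJ : Ck_on (f @` V) k ((fun x => invmx (jac f x) i j) \o g).
  apply: (Ck_on_comp oW oV) => [y /gV[]//|//|].
  apply: Ck_on_invmx => // [x /set_mem/Ju//|a b].
  have [_ /(_ a)[_ h]] := Sf k.+1 b; apply: (eq_Ck_on oV _ (Ck_onS VD h)) => x _.
  by rewrite mxE.
apply: (eq_Ck_on oW _ CJ) => y /set_mem Wy.
have [dg Eg] := Dg _ j Wy.
by rewrite deriveE// Eg dot_deltar mxE.
Unshelve. all: by end_near. Qed.

End InverseFunction.

(** * Slice charts *)

Section Proper.
Variables (R : realType) (n : nat) (M : smoothManifoldType R n).
Variables (G : discreteGroupType) (a : group_action G M).
Hypotheses (hsmooth : smooth_action a) (hproper : proper_action a).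

Lemma act_continuous g : continuous (a g).
Proof. by have [] := hsmooth g. Qed.

Lemma actK g x : a g (a g^-1%g x) = x.
Proof. by rewrite -actM mulgV act1. Qed.

Lemma actVK g x : a g^-1%g (a g x) = x.
Proof. by rewrite -actM mulVg act1. Qed.

Lemma open_preimage_act g (U : set M) : open U -> open (a g @^-1` U).
Proof. by move=> oU; apply: open_comp => // x _; exact: act_continuous. Qed.

(** If [A] were infinite, the filter of sets containing all but finitely many points of [A] would
    cluster at some point, contradicting that its singleton is open. *)
Lemma discrete_compact_finite (T : discreteTopologicalType) (A : set T) :
  compact A -> finite_set A.
Proof.
move=> cA; apply: contrapT => iA.
pose F : set_system T := [set B | finite_set (A `\` B)].
have FF : ProperFilter F.
  split; first by rewrite /F /= setD0.
  split=> [|B C fB fC|B C BC]; rewrite /F /=; first by rewrite setDT.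
    by rewrite setDIr finite_setU.
  by apply: sub_finite_set => x [Ax Bx]; split=> // /BC.
have FA : F A by rewrite /F /= setDv.
have [x [_ clx]] := cA F FF FA.
have Fx : F (~` [set x]).
  by apply: sub_finite_set (finite_set1 x) => y [_ /contrapT].
by have [y []] := clx _ _ Fx (discrete_set1 x).
Qed.

(** Such elements lie in the projection to the discrete group of a compact set, the preimage of [K]
    times [K]. *)
Lemma proper_finite (K : set M) : compact K ->
  finite_set [set g | exists2 y, K y & K (a g y)].
Proof.
move=> cK; have [_ /(_ _ (compact_setX cK cK)) cF] := hproper.
apply: (@sub_finite_set _ _ (fst @` ((fun gx : G * M => (a gx.1 gx.2, gx.2)) @^-1` (K `*` K)))).
  by move=> g [y Ky Kgy]; exists (g, y).
apply: discrete_compact_finite.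
apply: continuous_compact => //; apply: continuous_subspaceT => x.
exact: cvg_fst.
Qed.

Lemma compact_nbhs (x : M) : exists2 K, compact K & nbhs x K.
Proof.
have [c _ cx] := atlas_cover x.
have oc := @open_coord _ _ _ c.
have nc : nbhs (coord c x) (coord c @` dom c).
  by rewrite nbhsE; exists (coord c @` dom c) => //; split=> //; exists x.
have /nbhs_ballP[r /= r0 br] := nc.
pose B := [set y : 'rV[R]_n | `|y - coord c x| <= r / 2].
have BD : B `<=` coord c @` dom c.
  move=> y yB; apply: br; rewrite -ball_normE /= distrC.
  by apply: le_lt_trans yB _; rewrite ltr_pdivrMr// ltr_pMr// ltr1n.
have cB : compact B.
  apply: bounded_closed_compact.
    exists (r / 2 + `|coord c x|); split; first exact: num_real.
    move=> m dm y /= yx; apply: le_trans (ltW dm).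
    by rewrite -[y](subrK (coord c x)); apply: le_trans (ler_normD _ _) _; rewrite lerD2r.
  have -> : B = (fun y => `|y - coord c x|) @^-1` [set t | t <= r / 2] by [].
  apply: closed_comp; last exact: closed_le.
  by move=> y _; exact: (cvg_norm (cvgB cvg_id (cvg_cst (coord c x)))).
exists (param c @` B).
  apply: continuous_compact => //; apply: continuous_in_subspaceT => y yB.
  by apply: (@param_cts _ _ _ c); apply/mem_set/BD/set_mem.
have : nbhs x (dom c `&` coord c @^-1` (ball (coord c x) (r / 2))).
  apply: filterI; first by rewrite nbhsE; exists (dom c) => //; split => //; exact: open_dom.
  apply: (coord_cts (mem_set cx)); apply: nbhsx_ballx; by rewrite divr_gt0.
apply: filterS => y [dy]; rewrite /= -ball_normE /= => yB.
exists (coord c y); last by rewrite coordK ?inE.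
by rewrite /B /= distrC ltW.
Qed.

Lemma nbhs_bigI (T : Type) (X : topologicalType) (x : X) (A : set T) (f : T -> set X) :
  finite_set A -> (forall t, A t -> nbhs x (f t)) -> nbhs x (\bigcap_(t in A) f t).
Proof.
(* Passing to finite sets with enumerated elements requires a choice structure on the index type. *)
elim/Pchoice: T => T in A f *.
move=> /finite_fsetP[D ->] Df; apply: filter_bigI => t tD.
exact: Df.
Qed.

Lemma hausdorff_sep (X : topologicalType) (x y : X) : hausdorff_space X -> x <> y ->
  exists A B, [/\ nbhs x A, nbhs y B & A `&` B = set0].
Proof.
rewrite open_hausdorff => hX /eqP xy.
have [[A B] /= [/set_mem Ax /set_mem By] [oA oB /eqP AB]] := hX _ _ xy.
by exists A, B; split=> //; rewrite nbhsE; [exists A|exists B].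
Qed.

(* Away from [gx = x], Hausdorffness separates [x] from the finitely many [gx]
   that properness leaves near [x]. *)
Lemma slice_nbhs x : exists2 N, nbhs x N &
  forall g y, N y -> N (a g y) -> a g x = x.
Proof.
have [K cK nK] := compact_nbhs x.
pose F := [set g | (exists2 y, K y & K (a g y)) /\ a g x <> x].
have fF : finite_set F by apply: sub_finite_set (proper_finite cK) => g [].
have sep g : exists N, F g -> nbhs x N /\ forall y, N y -> ~ N (a g y).
  have [[_ gx]|nF] := pselect (F g); last by exists setT.
  have [A [B [nA nB AB]]] := hausdorff_sep (manifold_hausdorff (s := M)) gx.
  exists (B `&` a g @^-1` A) => _; split=> [|y [By Agy] [Bgy _]].
    by apply: filterI => //; exact: act_continuous.
  have : (A `&` B) (a g y) by [].
  by rewrite AB.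
pose f g := projT1 (cid (sep g)).
exists (K `&` \bigcap_(g in F) f g).
  apply: filterI => //; apply: nbhs_bigI => // g Fg; rewrite /f.
  by case: cid => N /= /(_ Fg)[].
move=> g y [Ky fy] [Kgy fgy]; apply: contrapT => gx.
have Fg : F g by split=> //; exists y.
move: (fy g Fg) (fgy g Fg); rewrite /f.
by case: cid => N /= /(_ Fg)[_ h]; exact: h.
Qed.

Lemma stab_finite x : finite_set [set g | a g x = x].
Proof.
have [K cK nK] := compact_nbhs x; apply: sub_finite_set (proper_finite cK) => g /= gx.
by exists x; rewrite ?gx; exact: nbhs_singleton.
Qed.

End Proper.

(** * Jacobian matrices of sums, products with matrices, and composites *)

Section Jacobians.
Variable R : realType.

(** Differentiability as an explicit estimate, which passes to sums and to multiplication by a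
    constant matrix; this is what differentiating an average over the stabilizer requires. *)
Definition has_jac n (f : 'rV[R]_n -> 'rV[R]_n) p (J : 'M[R]_n) : Prop :=
  forall e : R, 0 < e ->
    \forall h \near (0 : 'rV[R]_n), `|f (h + p) - f p - h *m J| <= e * `|h|.

Lemma has_jac_jac n (f : 'rV[R]_n -> 'rV[R]_n) p J : has_jac f p J -> jac f p = J.
Proof.
move=> fJ; apply/matrixP => i j; rewrite mxE.
have [|e e0|df Ef] := @diff_intro R _ _ (fun x => f x 0 j) (dot (\row_i J i j)) p.
- exact: dot_continuous.
- apply: filterS (fJ e e0) => h; apply: le_trans => /=.
  have -> : dot (\row_i J i j) h = (h *m J) 0 j.
    by rewrite mxE; apply: eq_bigr => i' _; rewrite mxE mulrC.
  by have := coord_le_norm (f (h + p) - f p - h *m J) j; rewrite !mxE.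
- by rewrite deriveE// Ef /= dot_deltar mxE.
Qed.

Lemma has_jacM n (f : 'rV[R]_n -> 'rV[R]_n) p J b (A : 'M[R]_n) : has_jac f p J ->
  has_jac (fun v => (f v - b) *m A) p (J *m A).
Proof.
move=> fJ e e0.
pose C := \sum_i \sum_j `|A i j| + 1.
have C0 : 0 < C.
  by rewrite ltr_wpDl// sumr_ge0// => i _; rewrite sumr_ge0.
have eC : 0 < e / C by rewrite divr_gt0.
apply: filterS (fJ _ eC) => h hJ.
rewrite -mulmxBl mulmxA -mulmxBl.
have -> : f (h + p) - b - (f p - b) - h *m J = f (h + p) - f p - h *m J.
  by congr (_ - _); rewrite opprB addrA addrNK.
apply: le_trans (mulmx_norm_le _ _) _.
apply: (@le_trans _ _ (C * (e / C * `|h|))).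
  apply: ler_pM => //; last by rewrite /C lerDl.
  by rewrite sumr_ge0// => i _; rewrite sumr_ge0.
by rewrite mulrA mulrCA mulfV ?mulr1 ?gt_eqF.
Qed.

Lemma has_jacD n (f g : 'rV[R]_n -> 'rV[R]_n) p J K : has_jac f p J ->
  has_jac g p K -> has_jac (fun v => f v + g v) p (J + K).
Proof.
move=> fJ gK e e0; have e2 : 0 < e / 2 by rewrite divr_gt0.
apply: filterS (filterI (fJ _ e2) (gK _ e2)) => h [h1 h2].
have -> : f (h + p) + g (h + p) - (f p + g p) - h *m (J + K) =
  (f (h + p) - f p - h *m J) + (g (h + p) - g p - h *m K).
  rewrite mulmxDr; move: (h *m J) (h *m K) => u v.
  by apply/rowP => i; rewrite !mxE; ring.
apply: le_trans (ler_normD _ _) _.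
by rewrite [e]splitr mulrDl; apply: lerD.
Qed.

Lemma has_jac_cst n (b : 'rV[R]_n) p : has_jac (cst b) p 0.
Proof.
move=> e e0; near=> h.
by rewrite /cst subrr mulmx0 subrr normr0 mulr_ge0// ltW.
Unshelve. all: by end_near. Qed.

Lemma has_jac_sum n (I : Type) (s : seq I) (f : I -> 'rV[R]_n -> 'rV[R]_n) p J :
  (forall i, has_jac (f i) p (J i)) ->
  has_jac (fun v => \sum_(i <- s) f i v) p (\sum_(i <- s) J i).
Proof.
move=> fJ; elim: s => [|i s IH].
  rewrite big_nil; under eq_fun do rewrite big_nil.
  exact: has_jac_cst.
rewrite big_cons; under eq_fun do rewrite big_cons.
exact: (has_jacD (fJ i) IH).
Qed.

Lemma derive_coord_delta n (i j : 'I_n) (x : 'rV[R]_n) :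
  'D_(delta_mx 0 i) (fun v : 'rV[R]_n => v 0 j) x = (i == j)%:R.
Proof.
have -> : (fun x : 'rV[R]_n => x 0 j) = dot (delta_mx 0 j).
  by apply/funext => y; rewrite dot_delta.
rewrite deriveE; last by apply: linear_differentiable; exact: dot_continuous.
rewrite diff_lin; last exact: dot_continuous.
by rewrite /= dot_deltar mxE.
Qed.

Lemma eq_jac n (f g : 'rV[R]_n -> 'rV[R]_n) p D : open D -> D p -> {in D, f =1 g} ->
  jac f p = jac g p.
Proof.
move=> oD Dp fg; apply/matrixP => i j; rewrite !mxE; apply: near_eq_derive.
by apply: filterS (open_near_eq oD Dp fg) => x ->.
Qed.

Lemma jac_id n p : jac (fun v : 'rV[R]_n => v) p = 1%:M.
Proof. by apply/matrixP => i j; rewrite !mxE derive_coord_delta. Qed.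

Lemma jac_comp n (f g : 'rV[R]_n -> 'rV[R]_n) (D E : set 'rV[R]_n) x :
  open D -> open E -> D x -> E (f x) -> smooth_on D f -> smooth_on E g ->
  jac (g \o f) x = jac f x *m jac g (f x).
Proof.
move=> oD oE Dx Ex Sf Sg; apply/matrixP => i j; rewrite !mxE.
have [_ ->] := derive_comp i oD oE Dx Ex (Sf 1%N) (Sg 1%N j).
by apply: eq_bigr => l _; rewrite !mxE mulrC.
Qed.

Lemma smooth_on_comp n m k (f : 'rV[R]_n -> 'rV[R]_m) (g : 'rV[R]_m -> 'rV[R]_k)
    (D : set 'rV[R]_n) (E : set 'rV[R]_m) :
  open D -> open E -> (forall x, D x -> E (f x)) ->
  smooth_on D f -> smooth_on E g -> smooth_on D (g \o f).
Proof.
move=> oD oE DE Sf Sg l j; apply: (@Ck_on_comp _ _ _ f (fun x => g x 0 j) D E) => //.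
Qed.

Lemma smooth_onS n m (f : 'rV[R]_n -> 'rV[R]_m) (D E : set 'rV[R]_n) :
  D `<=` E -> smooth_on E f -> smooth_on D f.
Proof. by move=> DE Sf k j; apply: Ck_onS DE (Sf k j). Qed.

End Jacobians.

Lemma open_preimage_on (T U : topologicalType) (D : set T) (f : T -> U) (O : set U) :
  open D -> {in D, continuous f} -> open O -> open (D `&` f @^-1` O).
Proof.
move=> oD cf oO; rewrite openE => x [Dx Ofx]; apply: filterI.
  by rewrite nbhsE; exists D.
by apply: (cf x (mem_set Dx)); rewrite nbhsE; exists O.
Qed.

Lemma open_image_inverse (T U : topologicalType) (D O : set T) (f : T -> U) (g : U -> T) :
  open (f @` D) -> {in D, cancel f g} -> {in f @` D, continuous g} ->
  open O -> O `<=` D -> open (f @` O).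
Proof.
move=> ofD fK cg oO OD.
suff -> : f @` O = f @` D `&` g @^-1` O by exact: open_preimage_on.
apply/seteqP; split=> [_ [x Ox <-]|_ [[x Dx <-]]] /=.
  by split; [exists x => //; exact: OD|rewrite fK ?inE//; exact: OD].
by rewrite fK ?inE// => Ox; exists x.
Qed.

Lemma chart_open_image (R : realType) n (M : topologicalType) (c : chart R n M) (O : set M) :
  open O -> O `<=` dom c -> open (coord c @` O).
Proof.
move=> oO Oc; apply: (open_image_inverse (D := dom c) (g := param c)) => //.
- exact: open_coord.
- exact: coordK.
- exact: param_cts.
Qed.

(* [rho] matters only on the stabilizer of [x], where it is an
   antihomomorphism because coordinates are row vectors. *)
Record slice_chart (R : realType) (n : nat) (M : smoothManifoldType R n)
    (G : discreteGroupType) (a : group_action G M) (x : M) (N : set M)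
    (c : chart R n M) (rho : G -> 'M[R]_n) : Prop := SliceChart {
  slice_smooth : smooth_chart c;
  slice_center : dom c x;
  slice_sub : dom c `<=` N;
  slice_coord0 : coord c x = 0;
  slice_stab : forall g y, dom c y -> dom c (a g y) -> a g x = x;
  slice_inv : forall g y, a g x = x -> dom c y -> dom c (a g y);
  slice_lin : forall g y, a g x = x -> dom c y ->
    coord c (a g y) = coord c y *m rho g;
  slice_convex : forall u v (t : R), 0 <= t <= 1 ->
    (coord c @` dom c) u -> (coord c @` dom c) v ->
    (coord c @` dom c) ((1 - t) *: u + t *: v) }.

(** * Linearizing the action of a stabilizer by averaging *)

Section SliceCharts.
Variables (R : realType) (n : nat) (M : smoothManifoldType R n).
Variables (G : discreteGroupType) (a : group_action G M).
Hypotheses (hsmooth : smooth_action a) (hproper : proper_action a).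

Lemma stab_mul x g h : a g x = x -> a h x = x -> a (g * h)%g x = x.
Proof. by move=> gx hx; rewrite actM hx. Qed.

Lemma stab_inv x g : a g x = x -> a g^-1%g x = x.
Proof. by move=> gx; rewrite -{1}gx actVK. Qed.

(** Openness rests on the finiteness of the stabilizer. The set is the largest part of [W] that the
    stabilizer preserves, the standard way below to make domains invariant. *)
Lemma open_stab x (W : set M) : open W -> open [set y | forall g, a g x = x -> W (a g y)].
Proof.
move=> oW; rewrite openE => y Wy.
have : nbhs y (\bigcap_(g in [set g | a g x = x]) (a g @^-1` W)).
  apply: nbhs_bigI => [|g gx]; first exact: stab_finite.
  rewrite nbhsE; exists (a g @^-1` W); last by [].
  by split; [exact: open_preimage_act|exact: Wy].
by apply: filterS => z h g gx; exact: h.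
Qed.

Lemma mulmx_continuous m (A : 'M[R]_(n, m)) : continuous (fun v : 'rV[R]_n => v *m A).
Proof.
move=> v; apply: rV_continuous => j.
have -> : (fun y : 'rV[R]_n => (y *m A) 0 j) = dot (\row_i A i j).
  by apply/funext => y; rewrite mxE /dot; apply: eq_bigr => i _; rewrite mxE mulrC.
exact: dot_continuous.
Qed.

Section Averaging.
Variables (x : M) (c0 : chart R n M).
Hypotheses (Ac : atlas c0) (c0x : dom c0 x).

Let p := coord c0 x.
(** The invariant core of the chart domain, on which every element of the stabilizer can be
    expressed in the coordinates of [c0] and composed with the others. *)
Let O := [set y | forall g, a g x = x -> dom c0 (a g y)].
Let D := coord c0 @` O.
Let f g := coord c0 \o a g \o param c0.
Let rho g := jac (f g) p.

Let oO : open O.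
Proof. by apply: open_stab; exact: open_dom. Qed.

Let Odom : O `<=` dom c0.
Proof. by move=> y /(_ 1%g); rewrite !act1; exact. Qed.

Let Ox : O x.
Proof. by move=> g ->. Qed.

Let Oact g y : a g x = x -> O y -> O (a g y).
Proof.
by move=> gx Oy h hx; rewrite -actM; apply: Oy; exact: stab_mul.
Qed.

Let oD : open D.
Proof. exact: chart_open_image. Qed.

Let Dp : D p.
Proof. by exists x. Qed.

Let fE g y : O y -> f g (coord c0 y) = coord c0 (a g y).
Proof. by move=> Oy; rewrite /f /= coordK// inE; exact: Odom. Qed.

Let fp g : a g x = x -> f g p = p.
Proof. by move=> gx; rewrite /p fE// gx. Qed.

Let f_smooth g : a g x = x -> smooth_on D (f g).
Proof.
move=> gx; have [_ /(_ _ _ Ac Ac)] := hsmooth g.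
by apply: smooth_onS => _ [y Oy <-]; exists y => //; split; [exact: Odom|exact: Oy].
Qed.

Let fD g v : a g x = x -> D v -> D (f g v).
Proof.
by move=> gx [y Oy <-]; rewrite fE//; exists (a g y) => //; exact: Oact.
Qed.

Let fM g h v : a g x = x -> a h x = x -> D v -> f (g * h)%g v = f g (f h v).
Proof.
move=> gx hx [y Oy <-].
by rewrite !fE// ?actM// ; exact: Oact.
Qed.

Lemma jac_act1 : rho 1%g = 1%:M.
Proof.
rewrite -(jac_id p); apply: (eq_jac oD Dp) => v /set_mem[y Oy <-].
by rewrite fE// act1.
Qed.

Let rhoM g h : a g x = x -> a h x = x -> rho (g * h)%g = rho h *m rho g.
Proof.
move=> gx hx; rewrite /rho -[X in _ *m jac _ X](fp hx).
rewrite -(jac_comp oD oD Dp)//; [|exact: fD|exact: f_smooth|exact: f_smooth].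
by apply: (eq_jac oD Dp) => v /set_mem Dv; rewrite fM.
Qed.

(** Bochner's linearization. Each summand has Jacobian [rho g *m rho g^-1] divided by the order of
    the stabilizer, so the average has Jacobian the identity and is locally invertible. *)
Lemma averaged_chart : exists Phi,
  [/\ smooth_on D Phi, jac Phi p = 1%:M, Phi p = 0 &
      forall g y, a g x = x -> O y ->
        Phi (coord c0 (a g y)) = Phi (coord c0 y) *m rho g].
Proof.
have [s0 s0E] := (finite_seqP _).1 (stab_finite hproper x).
pose s := undup s0.
have sP g : (g \in s) <-> a g x = x.
  rewrite mem_undup; have : [set g | a g x = x] g = [set` s0] g by rewrite s0E.
  by move=> /= ->.
have s1 : (1%g \in s) by apply/sP; rewrite act1.
have sz : ((size s)%:R : R) != 0 by rewrite pnatr_eq0 -lt0n; case: (s) s1.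
pose A g := (size s)%:R^-1 *: rho g^-1%g.
(* The average over the stabilizer intertwines its action with [rho], since
   right translation only permutes the summands. *)
pose Phi v := \sum_(g <- s) (f g v - p) *m A g.
exists Phi; split.
- move=> k j.
  suff C : Ck_on D k (fun v => \sum_(g <- s) if g \in s then ((f g v - p) *m A g) 0 j else 0).
    apply: (eq_Ck_on oD _ C) => v _; rewrite /= /Phi summxE big_seq [RHS]big_seq.
    by apply: eq_bigr => g ->.
  apply: (Ck_on_sum _ oD) => g _.
  case: (boolP (g \in s)) => [/sP gs|_]; last exact: Ck_on_cst.
  suff C : Ck_on D k (fun v => \sum_i (f g v 0 i + - p 0 i) * A g i j).
    apply: (eq_Ck_on oD _ C) => v _; rewrite !mxE; apply: eq_bigr => i _.
    by rewrite !mxE.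
  apply: (Ck_on_sum _ oD) => i _; apply: (Ck_onM oD); last exact: Ck_on_cst.
  by apply: (Ck_onD oD); [exact: f_smooth|exact: Ck_on_cst].
- apply: has_jac_jac.
  (* Outside the stabilizer the summands are replaced by harmless ones, because [has_jac_sum] asks
     for a Jacobian at every index. *)
  pose f' g := if g \in s then f g else (fun v => v).
  pose J g := (if g \in s then rho g else 1%:M) *m A g.
  have -> : Phi = fun v => \sum_(g <- s) (f' g v - p) *m A g.
    apply/funext => v; rewrite /Phi big_seq [RHS]big_seq; apply: eq_bigr => g gs.
    by rewrite /f' gs.
  have -> : 1%:M = \sum_(g <- s) J g.
    rewrite big_seq (eq_bigr (fun=> (size s)%:R^-1 *: 1%:M)) => [|g gs].
      by rewrite -big_seq big_const_seq count_predT iter_addr_0 -scaler_nat scalerA mulfV// scale1r.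
    have gx := (sP g).1 gs.
    by rewrite /J gs /A -scalemxAr -rhoM ?mulVg ?jac_act1//; exact: stab_inv.
  apply: has_jac_sum => g; apply: has_jacM; rewrite /f'; case: (boolP (g \in s)) => [/sP gs|_].
    exact: (jac_diff oD Dp (f_smooth gs 1%N)).
  by move=> e e0; near=> h; rewrite addrK mulmx1 subrr normr0 mulr_ge0// ltW.
- rewrite /Phi big_seq big1// => g /sP gs.
  by rewrite fp// subrr mul0mx.
- move=> h y hx Oy; rewrite /Phi mulmx_suml.
  have ps : perm_eq [seq (g * h)%g | g <- s] s.
    apply: uniq_perm; rewrite ?undup_uniq//.
      rewrite map_inj_uniq ?undup_uniq// => g g' e.
      by rewrite -(mulgK h g) e mulgK.
    move=> g; apply/idP/idP => [/mapP[k /sP kx ->]|/sP gx].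
      by apply/sP; exact: stab_mul.
    apply/mapP; exists (g * h^-1)%g; last by rewrite mulgVK.
    by apply/sP; apply: stab_mul => //; exact: stab_inv.
  rewrite -[RHS](perm_big _ ps)/= [RHS]big_map big_seq [RHS]big_seq.
  apply: eq_bigr => g /sP gx.
  rewrite -mulmxA /A -scalemxAl -rhoM//; last by apply: stab_inv; exact: stab_mul.
  rewrite invgM mulgA mulgV mul1g; congr ((_ - _) *m _).
  by rewrite !fE// ?actM//; exact: Oact.
Unshelve. all: by end_near. Qed.

End Averaging.
End SliceCharts.

Section SliceChartExists.
Variables (R : realType) (n : nat) (M : smoothManifoldType R n).
Variables (G : discreteGroupType) (a : group_action G M).
Hypotheses (hsmooth : smooth_action a) (hproper : proper_action a).

Lemma coord_open_preimage (c : chart R n M) (W : set 'rV[R]_n) : open W ->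
  open (dom c `&` coord c @^-1` W).
Proof.
by move=> oW; apply: open_preimage_on => //; [exact: open_dom|exact: coord_cts].
Qed.

Lemma ball0 (r : R) (v : 'rV[R]_n) : ball 0 r v = (`|v| < r).
Proof. by rewrite -ball_normE /= sub0r normrN. Qed.

(** The averaged map is inverted locally, after which only the domain has to be shrunk: into [N],
    into a neighbourhood given by [slice_nbhs], and to an invariant set with convex image. *)
Lemma slice_chart_exists x N : nbhs x N ->
  exists c rho, slice_chart a x N c rho.
Proof.
move=> nN; have [c0 Ac c0x] := atlas_cover x.
have [Phi [SPhi JPhi Phi0 Phiact]] := averaged_chart hsmooth hproper Ac c0x.
set p := coord c0 x in JPhi Phi0.
set O := [set y | forall g, a g x = x -> dom c0 (a g y)] in SPhi Phiact.
set rho := fun g => jac (coord c0 \o a g \o param c0) p in Phiact.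
have oO : open O by apply: open_stab => //; exact: open_dom.
have Odom : O `<=` dom c0 by move=> y /(_ 1%g); rewrite !act1; exact.
have Ox : O x by move=> g ->.
have oD : open (coord c0 @` O) by exact: chart_open_image.
have Dp : (coord c0 @` O) p by exists x.
have [V [Psi [oV Vp VD [oE PhiK SPsi]]]] := inverse_function oD Dp SPhi JPhi.
have [N1 nN1 N1slice] := slice_nbhs hsmooth hproper x.
have nNN : nbhs x (N `&` N1) by exact: filterI.
have [N0 [oN0 N0x] N0N] : exists2 B, open_nbhs x B & B `<=` N `&` N1.
  by move: nNN; rewrite nbhsE.
have cPsi : {in Phi @` V, continuous Psi}.
  move=> v vE; apply: rV_continuous => j; exact: (SPsi 0%N j).1.
pose W := (dom c0 `&` coord c0 @^-1` V) `&` N0.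
have oW : open W by apply: openI => //; exact: coord_open_preimage.
pose U := [set y | forall g, a g x = x -> W (a g y)].
have oU : open U by exact: open_stab.
have UW : U `<=` W by move=> y /(_ 1%g); rewrite !act1; exact.
have Ux : U x by move=> g ->; split=> //; split.
have UO : U `<=` O by move=> y Uy g /Uy[[]].
have Uact g y : a g x = x -> U y -> U (a g y).
  by move=> gx Uy h hx; rewrite -actM; apply: Uy; exact: stab_mul.
pose phi := Phi \o coord c0.
have UV : coord c0 @` U `<=` V by move=> _ [y /UW[[_ ?] _] <-].
have phiO A : open A -> A `<=` U -> open (phi @` A).
  move=> oA AU; rewrite /phi -image_comp.
  apply: (open_image_inverse oE PhiK cPsi) => [|_ [y Ay <-]].
    by apply: chart_open_image => // y /AU/UW[[]].
  by apply: UV; exists y => //; exact: AU.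
have phi0 : phi x = 0 by [].
have : nbhs (0 : 'rV[R]_n) (phi @` U).
  by rewrite nbhsE; exists (phi @` U) => //; split; [exact: phiO|exists x].
move=> /nbhs_ballP[r /= r0 br].
have phiact g y : a g x = x -> U y -> phi (a g y) = phi y *m rho g.
  by move=> gx /UO Oy; exact: Phiact.
(* Its image consists of the [v] with [|v *m rho g| < r] for all [g] in the stabilizer: an
   intersection of convex sets which the stabilizer permutes, hence convex and invariant at once. *)
pose U' := [set y | forall g, a g x = x -> (U `&` phi @^-1` (ball 0 r)) (a g y)].
have phi_cts : {in U, continuous phi}.
  move=> y /set_mem Uy; apply: continuous_comp.
    by apply: coord_cts; apply/mem_set/Odom/UO.
  apply: rV_continuous => j; apply: (SPhi 0%N j).1.
  by apply/mem_set; exists y => //; exact: UO.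
have oU' : open U'.
  apply: open_stab => //; apply: open_preimage_on => //; exact: ball_open.
have U'U : U' `<=` U by move=> y /(_ 1%g); rewrite !act1 => /(_ erefl)[].
have U'x : U' x by move=> g ->; split=> //=; rewrite phi0; exact: ballxx.
have U'act g y : a g x = x -> U' y -> U' (a g y).
  by move=> gx Uy h hx; rewrite -actM; apply: Uy; exact: stab_mul.
have imU' v : (phi @` U') v <-> forall g, a g x = x -> `|v *m rho g| < r.
  split=> [[y U'y <-] g gx|vr].
    have [_] := U'y _ gx; rewrite /= ball0 phiact//; exact: U'U.
  have [y Uy yv] : (phi @` U) v.
    apply: br; rewrite ball0 -[v]mulmx1 -(jac_act1 hsmooth hproper c0x).
    by apply: vr; rewrite act1.
  exists y => // g gx; split; first exact: Uact.
  by rewrite /= ball0 phiact// yv vr.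
have phiK : {in U', cancel phi (param c0 \o Psi)}.
  move=> y /set_mem/U'U Uy; rewrite /phi /= PhiK; last first.
    by apply/mem_set/UV; exists y.
  by rewrite coordK// inE; exact/Odom/UO.
have phi'cts : {in phi @` U', continuous (param c0 \o Psi)}.
  move=> v /set_mem[y U'y <-]; apply: continuous_comp.
    apply: cPsi; apply/mem_set; exists (coord c0 y) => //.
    by apply: UV; exists y => //; exact: U'U.
  rewrite /phi /= PhiK; last by apply/mem_set/UV; exists y => //; exact: U'U.
  apply: param_cts; apply/mem_set; exists y => //; exact/Odom/UO/(U'U _).
have cts' : {in U', continuous phi}.
  by move=> y /set_mem/U'U/mem_set; exact: phi_cts.
pose c := Chart oU' (phiO _ oU' U'U) phiK cts' phi'cts.
exists c, rho; split.
- move=> d Ad; split.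
    rewrite /transition_smooth /=.
    have oI : open (phi @` (U' `&` dom d)).
      by apply: (phiO (U' `&` dom d)); [apply: openI => //; exact: open_dom|move=> y [/U'U]].
    have -> : coord d \o (param c0 \o Psi) = (coord d \o param c0) \o Psi by [].
    apply: (@smooth_on_comp _ _ _ _ _ _ _ (coord c0 @` (dom c0 `&` dom d))) => //.
    + by apply: chart_open_image; [apply: openI; exact: open_dom|move=> y []].
    + move=> _ [y [U'y dy] <-]; exists y.
        by split=> //; exact/Odom/UO/(U'U _).
      by rewrite PhiK//; apply/mem_set/UV; exists y => //; exact: (U'U y).
    + apply: smooth_onS SPsi => _ [y [U'y _] <-]; exists (coord c0 y) => //.
      by apply: UV; exists y => //; exact: (U'U y).
    + exact: atlas_smooth.
  rewrite /transition_smooth /=.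
  have oI : open (coord d @` (dom d `&` U')).
    by apply: chart_open_image; [apply: openI => //; exact: open_dom|move=> y []].
  have -> : phi \o param d = Phi \o (coord c0 \o param d) by [].
  apply: (@smooth_on_comp _ _ _ _ _ _ _ (coord c0 @` O)) => //.
  + move=> _ [y [dy U'y] <-]; exists y; first exact/UO/(U'U _).
    by rewrite /= coordK// inE.
  + have S : smooth_on (coord d @` (dom d `&` dom c0)) (coord c0 \o param d).
      exact: atlas_smooth.
    apply: smooth_onS S => _ [y [dy U'y] <-]; exists y => //.
    by split=> //; exact/Odom/UO/(U'U _).
- exact: (U'x).
- by move=> y U'y; have [_ /N0N[]] := UW _ (U'U _ U'y).
- exact: phi0.
- move=> g y /= U'y U'gy; apply: (N1slice g y).
    by have [_ /N0N[]] := UW _ (U'U _ U'y).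
  by have [_ /N0N[]] := UW _ (U'U _ U'gy).
- exact: (@U'act).
- by move=> g y gx U'y; apply: (@phiact g y) => //; exact: (U'U y).
- move=> u v t /andP[t0 t1] /imU' ur /imU' vr; apply/imU' => g gx.
  rewrite mulmxDl -!scalemxAl; apply: le_lt_trans (ler_normD _ _) _.
  rewrite !normrZ [`|t|]ger0_norm// ger0_norm ?subr_ge0//.
  have := ur g gx; have := vr g gx.
  move: `|u *m rho g| `|v *m rho g| => A B Br Ar.
  have [->|tn0] := eqVneq t 0; first by rewrite subr0 mul1r mul0r addr0.
  have tp : 0 < t by rewrite lt_def tn0.
  have : t * B < t * r by rewrite ltr_pM2l.
  have : (1 - t) * A <= (1 - t) * r by rewrite ler_wpM2l ?subr_ge0// ltW.
  lra.
Qed.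

End SliceChartExists.

(** * Complements of thin sets, walls *)

Section Connectedness.

Lemma connected_opens (T : topologicalType) (A : set T) : connected A <->
  forall P Q, open P -> open Q -> A `<=` P `|` Q -> A `&` P `&` Q = set0 ->
    A `<=` P \/ A `<=` Q.
Proof.
split=> [cA P Q oP oQ APQ AI|h B [x Bx] [P oP BP] [C cC BC]].
  have [[x [Ax Px]]|nP] := pselect (A `&` P !=set0); last first.
    right=> x Ax; have [Px|//] := APQ _ Ax.
    by exfalso; apply: nP; exists x.
  left; have <- : A `&` P = A; last by move=> y [].
  apply: cA; [by exists x|by exists P|].
  exists (~` Q); first exact: open_closedC.
  apply/seteqP; split=> y [Ay] => [Py|nQy]; split=> //.
    by move=> Qy; have : (A `&` P `&` Q) y by []; rewrite AI.
  by have [] := APQ _ Ay.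
have [||AP|AQ] := h P (~` C) oP (closed_openC cC).
- move=> y Ay; have [Cy|nC] := pselect (C y); last by right.
  left; have : (A `&` C) y by [].
  by rewrite -BC BP => -[].
- apply/seteqP; split=> // y [[Ay Py]]; apply.
  have : (A `&` P) y by [].
  by rewrite -BP BC => -[].
- by rewrite BP; apply/seteqP; split=> [y []//|y Ay]; split=> //; exact: AP.
- by move: (Bx); rewrite {1}BC => -[/AQ + Cx] => /(_ Cx).
Qed.

Lemma connected_sub_opens (T : topologicalType) (A P Q : set T) : connected A ->
  open P -> open Q -> A `<=` P `|` Q -> P `&` Q = set0 -> A `<=` P \/ A `<=` Q.
Proof.
move=> cA oP oQ APQ PQ; apply: (connected_opens _).1 => //.
by rewrite -setIA PQ setI0.
Qed.

Lemma pairwise_connected (T : topologicalType) (A : set T) :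
  (forall x y, A x -> A y -> exists C, [/\ connected C, C `<=` A, C x & C y]) ->
  connected A.
Proof.
move=> h; apply/connected_opens => P Q oP oQ APQ AI.
have [[x [Ax Px]]|nP] := pselect (A `&` P !=set0); last first.
  right=> x Ax; have [Px|//] := APQ _ Ax.
  by exfalso; apply: nP; exists x.
left=> y Ay; have [C [cC CA Cx Cy]] := h _ _ Ax Ay.
have [||CP|CQ] := (connected_opens _).1 cC _ _ oP oQ.
- by move=> z /CA/APQ.
- apply/seteqP; split=> // z [[/CA Az Pz] Qz].
  by have : (A `&` P `&` Q) z by []; rewrite AI.
- exact: CP.
- have : (A `&` P `&` Q) x by split=> //; exact: CQ.
  by rewrite AI.
Qed.

(** A separation of [E] extends to the whole space: each point has a neighbourhood whose trace on
    [E] lies in one part, and density of [E] prevents it from belonging to both. *)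
Lemma locally_connected_dense (T : topologicalType) (E : set T) :
  connected [set: T] -> dense E ->
  (forall x, exists2 U, open_nbhs x U & connected (U `&` E)) -> connected E.
Proof.
move=> cT dE lE; apply/connected_opens => P Q oP oQ EPQ EI.
pose X P := [set x | exists2 U, open_nbhs x U & U `&` E `<=` P].
have oX A : open (X A).
  rewrite openE => x [U [oU Ux] UE]; rewrite /interior nbhsE; exists U => //.
  by move=> y Uy; exists U.
have [||XP|XQ] := connected_sub_opens cT (oX P) (oX Q).
- move=> x _; have [U oU cU] := lE x.
  have [||UP|UQ] := (connected_opens _).1 cU _ _ oP oQ.
  + by move=> y [_ /EPQ].
  + apply/seteqP; split=> // y [[[_ Ey] Py] Qy].
    by have : (E `&` P `&` Q) y by []; rewrite EI.
  + by left; exists U.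
  + by right; exists U.
- apply/seteqP; split=> // x [[U [oU Ux] UP] [V [oV Vx] VQ]].
  have [|y [[Uy Vy] Ey]] := dE (U `&` V) _ (openI oU oV); first by exists x.
  have : (E `&` P `&` Q) y.
    by split; [split=> //; apply: UP; split|apply: VQ; split].
  by rewrite EI.
- by left=> x Ex; have [U [_ Ux] UP] := XP x I; apply: UP; split.
- by right=> x Ex; have [U [_ Ux] UQ] := XQ x I; apply: UQ; split.
Qed.

Lemma connected_image (T U : topologicalType) (A : set T) (f : T -> U) :
  connected A -> {in A, continuous f} -> connected (f @` A).
Proof. by move=> cA /continuous_in_subspaceT; exact: connected_continuous_connected. Qed.

Lemma locally_constant_connected (T : topologicalType) (f : T -> bool) (C : set T) y z : connected C ->
  (forall w, C w -> exists2 V, open_nbhs w V & forall v, V v -> f v = f w) ->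
  C y -> C z -> f y = f z.
Proof.
move=> cC lf Cy Cz.
pose X b := [set w | exists2 V, open_nbhs w V & forall v, V v -> f v = b].
have oX b : open (X b).
  rewrite openE => p [U [oU Up] UZ]; rewrite /interior nbhsE; exists U => // q Uq.
  by exists U.
have [||h|h] := (connected_opens _).1 cC _ _ (oX true) (oX false).
- move=> w Cw; have [V oV hV] := lf _ Cw.
  by case E : (f w) hV => hV; [left|right]; exists V.
- apply/seteqP; split=> // w [[_ [V [_ Vw] hV]] [W [_ Ww] hW]].
  by have := hV _ Vw; rewrite hW.
- by have [[V [_ Vy] hy] [W [_ Wz] hz]] := (h _ Cy, h _ Cz); rewrite hy// hz.
- by have [[V [_ Vy] hy] [W [_ Wz] hz]] := (h _ Cy, h _ Cz); rewrite hy// hz.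
Qed.

End Connectedness.

(** * Complements of finitely many linear subspaces in convex sets *)

Section Subspaces.
Variables (R : realType) (n : nat).

Lemma line_continuous (u v : 'rV[R]_n) : continuous (fun t : R => (1 - t) *: u + t *: v).
Proof.
move=> t; apply: cvgD.
  by apply: cvgZl; apply: cvgB; [exact: cvg_cst|exact: cvg_id].
by apply: cvgZl; exact: cvg_id.
Qed.

Definition seg (u v : 'rV[R]_n) := (fun t : R => (1 - t) *: u + t *: v) @` `[0, 1].

Lemma connected_itv01 : connected (`[0, 1] : set R).
Proof. exact/connected_intervalP/interval_is_interval. Qed.

Lemma seg_connected u v : connected (seg u v).
Proof.
apply: connected_image; first exact: connected_itv01.
by move=> t _; exact: line_continuous.
Qed.

Lemma seg_left u v : seg u v u.
Proof.
by exists 0; [rewrite /= in_itv/= lexx ler01|rewrite subr0 scale1r scale0r addr0].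
Qed.

Lemma seg_right u v : seg u v v.
Proof.
by exists 1; [rewrite /= in_itv/= lexx ler01|rewrite subrr scale1r scale0r add0r].
Qed.

Lemma nbhs_line (O : set 'rV[R]_n) (y v : 'rV[R]_n) : open O -> O y ->
  exists2 e : R, 0 < e & forall t, `|t| <= e -> O (y + t *: v).
Proof.
move=> oO Oy; have cf : {for 0, continuous (fun t : R => y + t *: v)}.
  apply: cvgD; first exact: cvg_cst.
  by apply: cvgZl; exact: cvg_id.
have : nbhs (0 : R) ((fun t : R => y + t *: v) @^-1` O).
  apply: cf; rewrite scale0r addr0 nbhsE; exists O => //.
move=> /nbhs_ballP[e /= e0 be]; exists (e / 2); first by rewrite divr_gt0.
move=> t te; apply: be; rewrite -ball_normE /= sub0r normrN.
by apply: le_lt_trans te _; rewrite ltr_pdivrMr// ltr_pMr// ltr1n.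
Qed.

(** Subspaces are given as kernels, proper because the matrices are nonzero. A point in a kernel
    leaves it along a coordinate direction belonging to a nonzero row, and the open set is shrunk
    before the next kernel is treated. *)
Lemma open_avoid_subspaces m (s : seq 'M[R]_(n, m)) (O : set 'rV[R]_n) :
  open O -> O !=set0 -> {in s, forall P, P != 0} ->
  exists2 v, O v & {in s, forall P, v *m P != 0}.
Proof.
elim: s O => [|P s IH] O oO [y Oy] s0; first by exists y.
have oO' : open (O `&` [set v | v *m P != 0]).
  apply: openI => //.
  have -> : [set v : 'rV[R]_n | v *m P != 0] =
      (fun v : 'rV[R]_n => v *m P) @^-1` (~` [set 0]).
    by apply/seteqP; split=> v /= /eqP.
  apply: open_comp; first by move=> v _; exact: mulmx_continuous.
  apply: closed_openC; apply: accessible_closed_set1; apply: hausdorff_accessible.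
  exact: norm_hausdorff.
have [||v [Ov vP] vs] := IH _ oO'.
- have [yP|yP] := boolP (y *m P == 0); last by exists y.
  have P0 : P != 0 by apply: s0; rewrite inE eqxx.
  have [i Pi] : exists i, row i P != 0.
    apply/existsP; apply: contraNT P0 => /existsPn P0.
    by apply/eqP/row_matrixP => i; rewrite row0; apply/eqP; have := P0 i; rewrite negbK.
  have [e e0 Oe] := nbhs_line (delta_mx 0 i) oO Oy.
  exists (y + e *: delta_mx 0 i); split; first by apply: Oe; rewrite ger0_norm// ltW.
  rewrite /= mulmxDl (eqP yP) add0r -scalemxAl -rowE scaler_eq0 negb_or Pi andbT.
  by rewrite gt_eqF.
- by move=> Q Qs; apply: s0; rewrite inE Qs orbT.
by exists v => // Q; rewrite inE => /orP[/eqP ->|/vs].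
Qed.

(** The kernel of [Q] is spanned by [y] and the kernel of [P], and is still proper since [P] has
    rank at least two. A segment from [y] that meets the kernel of [P] away from [y] has its other
    end in this span. *)
Lemma segment_avoid m (P : 'M[R]_(n, m)) (y : 'rV[R]_n) : (1 < \rank P)%N ->
  y *m P != 0 -> exists2 Q : 'M[R]_(n, m), Q != 0 &
    forall w, w *m Q != 0 -> forall z, seg y w z -> z *m P != 0.
Proof.
move=> rP yP; have [j yPj] : exists j, (y *m P) 0 j != 0.
  apply/existsP; apply: contraNT yP => /existsPn y0.
  by apply/eqP/rowP => j; rewrite [RHS]mxE; apply/eqP; have := y0 j; rewrite negbK.
set b := (y *m P) 0 j in yPj.
pose Q := P - b^-1 *: (col j P *m (y *m P)).
have yQ : y *m Q = 0.
  rewrite /Q mulmxBr -scalemxAr [y *m (_ *m _)]mulmxA.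
  have -> : y *m col j P = b%:M.
    by apply/rowP => i; rewrite ord1 !mxE eqxx /b mxE; apply: eq_bigr => k _; rewrite mxE.
  by rewrite mul_scalar_mx scalerA mulVf// scale1r subrr.
exists Q.
  apply/eqP => Q0; move: rP; have -> : P = b^-1 *: (col j P *m (y *m P)).
    by apply/eqP; rewrite -subr_eq0 -/Q Q0.
  rewrite ltnNge; apply/negP; rewrite negbK.
  apply: leq_trans (mxrank_scale _ _) _.
  by apply: leq_trans (mulmx_max_rank _ _) _.
move=> w wQ z [t _ <-]; apply/eqP => zP.
have zQ : ((1 - t) *: y + t *: w) *m Q = 0.
  rewrite /Q mulmxBr zP sub0r -scalemxAr [(_ + _) *m (_ *m _)]mulmxA.
  have -> : ((1 - t) *: y + t *: w) *m col j P = 0.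
    by rewrite colE mulmxA zP mul0mx.
  by rewrite mul0mx scaler0 oppr0.
move: zQ; rewrite mulmxDl -!scalemxAl yQ scaler0 add0r => /eqP.
rewrite scaler_eq0 (negPf wQ) orbF => /eqP t0.
by move: zP; rewrite t0 subr0 scale1r scale0r addr0 => /eqP; exact/negP.
Qed.

Definition convex_on (B : set 'rV[R]_n) := forall u v, B u -> B v -> seg u v `<=` B.

(** Any two points are joined through a third one [w], generic enough for both segments to avoid all
    the kernels. *)
Lemma convex_minus_connected m (s : seq 'M[R]_(n, m)) (B : set 'rV[R]_n) :
  open B -> convex_on B -> {in s, forall P, (1 < \rank P)%N} ->
  connected [set v | B v /\ {in s, forall P, v *m P != 0}].
Proof.
move=> oB cB rs; apply: pairwise_connected => y z [By ys] [Bz zs].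
have key (y' : 'rV[R]_n) : {in s, forall P, y' *m P != 0} ->
    exists2 q : seq 'M[R]_(n, m), {in q, forall Q, Q != 0} &
    forall w, {in q, forall Q, w *m Q != 0} ->
      forall u, seg y' w u -> {in s, forall P, u *m P != 0}.
  elim: (s) (rs) => [|P s' IH] rs' y's; first by exists [::].
  have [||q q0 hq] := IH.
  - by move=> Q Qs; apply: rs'; rewrite inE Qs orbT.
  - by move=> Q Qs; apply: y's; rewrite inE Qs orbT.
  have Ps : P \in P :: s' by rewrite inE eqxx.
  have [Q Q0 hQ] := segment_avoid (rs' P Ps) (y's P Ps).
  exists (Q :: q) => [Q'|w ws u uw P']; rewrite inE.
    by move=> /orP[/eqP ->|/q0].
  move=> /orP[/eqP ->|P's]; first by apply: hQ uw; apply: ws; rewrite inE eqxx.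
  by apply: (hq w) uw _ P's => Q' Q'q; apply: ws; rewrite inE Q'q orbT.
have [[q1 q10 h1] [q2 q20 h2]] := (key _ ys, key _ zs).
have [||w Bw wq] := @open_avoid_subspaces m (q1 ++ q2) B oB; first by exists y.
  by move=> Q; rewrite mem_cat => /orP[/q10|/q20].
exists (seg y w `|` seg z w); split.
- apply: connectedU; [|exact: seg_connected|exact: seg_connected].
  by exists w; split; exact: seg_right.
- move=> u [uw|uw]; split.
  + exact: cB uw.
  + by apply: h1 uw => Q Qq; apply: wq; rewrite mem_cat Qq.
  + exact: cB uw.
  + by apply: h2 uw => Q Qq; apply: wq; rewrite mem_cat Qq orbT.
- by left; exact: seg_left.
- by right; exact: seg_left.
Qed.

End Subspaces.

(** * Group elements in a slice chart *)

Section LocalModel.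
Variables (R : realType) (n : nat) (M : smoothManifoldType R n).
Variables (G : discreteGroupType) (a : group_action G M).
Hypotheses (hM : connected [set: M]).
Hypotheses (hsmooth : smooth_action a) (hproper : proper_action a).
Hypotheses (heffective : effective_action a).

Lemma open_mx_eq m (O : set 'rV[R]_n) (A B : 'M[R]_(n, m)) : open O -> O !=set0 ->
  (forall v, O v -> v *m A = v *m B) -> A = B.
Proof.
move=> oO O0 AB; apply: contrapT => /eqP ne.
have [|v Ov] := open_avoid_subspaces (s := [:: A - B]) oO O0.
  by move=> P; rewrite inE => /eqP ->; rewrite subr_eq0.
by move=> /(_ _ (mem_head _ _)); rewrite mulmxBr AB// subrr eqxx.
Qed.

Lemma fixed_closed g : closed (fixed_set a g).
Proof.
rewrite -openC openE => x /= gx.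
have [A [B [nA nB AB]]] := hausdorff_sep (manifold_hausdorff (s := M)) gx.
have : nbhs x (B `&` a g @^-1` A) by apply: filterI => //; exact: act_continuous.
apply: filterS => y [By + /= gy]; rewrite /= gy => Ay.
by have : (A `&` B) y by []; rewrite AB.
Qed.

Section Chart.
Variables (x : M) (N : set M) (c : chart R n M) (rho : G -> 'M[R]_n).
Hypothesis sc : slice_chart a x N c rho.

Lemma dom_param v : (coord c @` dom c) v -> dom c (param c v) /\ coord c (param c v) = v.
Proof. by move=> [y cy <-]; rewrite coordK ?inE. Qed.

Lemma dom_image y : dom c y -> (coord c @` dom c) (coord c y).
Proof. by move=> cy; exists y. Qed.

Lemma dom_nonempty : (coord c @` dom c) !=set0.
Proof. by exists 0, x; [exact: (slice_center sc)|exact: (slice_coord0 sc)]. Qed.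

Lemma slice_open_nbhs : open_nbhs x (dom c).
Proof. by split; [exact: open_dom|exact: (slice_center sc)]. Qed.

Lemma slice_convex_on : convex_on (coord c @` dom c).
Proof. by move=> u v Bu Bv _ [t t01 <-]; apply: (slice_convex sc); rewrite // -in_itv. Qed.

Lemma slice_fixed g y : a g x = x -> dom c y ->
  (a g y = y <-> coord c y *m (rho g - 1%:M) = 0).
Proof.
move=> gx cy; rewrite mulmxBr mulmx1 -(slice_lin sc gx cy); split=> [->|/subr0_eq e].
  by rewrite subrr.
rewrite -[RHS](coordK (mem_set cy)) -e coordK// inE.
exact: (slice_inv sc).
Qed.

Lemma rho_mul g h : a g x = x -> a h x = x -> rho (g * h)%g = rho h *m rho g.
Proof.
move=> gx hx; apply: (open_mx_eq (@open_coord _ _ _ c) dom_nonempty) => _ [y cy <-].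
rewrite mulmxA -!(slice_lin sc)// ?actM// ?hx//.
exact: (slice_inv sc).
Qed.

Lemma rho_one : rho 1%g = 1%:M.
Proof.
apply: (open_mx_eq (@open_coord _ _ _ c) dom_nonempty) => _ [y cy <-].
by rewrite -(slice_lin sc) ?act1// mulmx1.
Qed.

End Chart.

(** The interior of the fixed set is also closed: at a point of its closure a slice chart makes [g]
    linear, and a linear map fixing an open set is the identity. Connectedness and effectiveness
    conclude. *)
Lemma fixed_nbhs (y : M) g : nbhs y (fixed_set a g) -> g = 1%g.
Proof.
move=> ny; apply: heffective => z; apply: contrapT => gz.
pose I := [set x : M | nbhs x (fixed_set a g)].
have oI : open I by rewrite openE => x Ix; exact: nbhs_interior Ix.
have oC : open (~` I).
  rewrite openE => x nIx; have [gx|gx] := pselect (a g x = x); last first.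
    have : nbhs x (~` fixed_set a g).
      by apply: open_nbhs_nbhs; split=> //; exact/closed_openC/fixed_closed.
    by apply: filterS => w gw /nbhs_singleton.
  have [c [rho sc]] := slice_chart_exists hsmooth hproper (@filterT _ _ (nbhs_filter x)).
  have A0 : rho g - 1%:M != 0.
    apply/eqP => A0; apply: nIx; rewrite /I /= nbhsE; exists (dom c).
      exact: slice_open_nbhs sc.
    by move=> w cw; apply/(slice_fixed sc) => //; rewrite A0 mulmx0.
  have : nbhs x (dom c) by apply: open_nbhs_nbhs; exact: slice_open_nbhs sc.
  apply: filterS => w cw; rewrite /I /= nbhsE => -[U [oU Uw] Ug].
  have [|||v] := @open_avoid_subspaces R n n [:: rho g - 1%:M] (coord c @` (dom c `&` U)).
  - by apply: chart_open_image => [|? []//]; apply: openI => //; exact: open_dom.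
  - by exists (coord c w), w.
  - by move=> P; rewrite inE => /eqP ->.
  move=> [w' [cw' Uw'] <-] /(_ _ (mem_head _ _)) /eqP; apply.
  by apply/(slice_fixed sc) => //; exact: Ug.
have [||h|h] := connected_sub_opens hM oI oC.
- by rewrite setUv.
- by rewrite setICr.
- by apply: gz; have := h z Logic.I => /nbhs_singleton.
- by have := h y Logic.I; apply.
Qed.

Section StabilizerOrder.
Variables (x : M) (N : set M) (c : chart R n M) (rho : G -> 'M[R]_n).
Hypothesis sc : slice_chart a x N c rho.

Lemma rho_faithful g : a g x = x -> rho g = 1%:M -> g = 1%g.
Proof.
move=> gx r1; apply: (@fixed_nbhs x).
rewrite nbhsE; exists (dom c); first exact: (slice_open_nbhs sc).
by move=> y cy; apply/(slice_fixed sc) => //; rewrite r1 subrr mulmx0.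
Qed.

Lemma stab_exp k g : a g x = x -> a (g ^+ k)%g x = x.
Proof.
by move=> gx; elim: k => [|k IH]; rewrite ?expg0 ?act1// expgS actM IH.
Qed.

Lemma stab_finite_order g : a g x = x -> exists2 k, (0 < k)%N & (g ^+ k)%g = 1%g.
Proof.
move=> gx; have [s sE] := (finite_seqP _).1 (stab_finite hproper x).
have ins k : (g ^+ k)%g \in s.
  have : [set g | a g x = x] (g ^+ k)%g by exact: stab_exp.
  by rewrite sE.
have : ~~ uniq [seq (g ^+ k)%g | k <- iota 0 (size s).+1].
  apply/negP => u; have := uniq_leq_size u.
  rewrite size_map size_iota => /(_ s) h; have : (size s < size s)%N.
    by apply: h => _ /mapP[k _ ->].
  by rewrite ltnn.
apply: contraNP => no; rewrite map_inj_in_uniq ?iota_uniq// => i j _ _.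
have inj i' j' : (i' < j')%N -> (g ^+ i' <> g ^+ j')%g.
  move=> ij e; apply: no; exists (j' - i')%N; first by rewrite subn_gt0.
  by apply: (mulgI (g ^+ i')%g); rewrite -expgnDr subnKC ?mulg1// ltnW.
by move=> e; case: (ltngtP i j) => // /inj; rewrite e.
Qed.

End StabilizerOrder.
End LocalModel.

(** * Thin sets and walls *)

Section Walls.
Variables (R : realType) (n : nat) (M : smoothManifoldType R n).
Variables (G : discreteGroupType) (a : group_action G M).
Hypotheses (hM : connected [set: M]).
Hypotheses (hsmooth : smooth_action a) (hproper : proper_action a).
Hypotheses (heffective : effective_action a).

(* In a slice chart at [x], [Z] is a finite union of linear subspaces of
   codimension at least [r], given as kernels. *)
Definition thin_at m r (Z : set M) (x : M) : Prop :=
  exists N c rho (s : seq 'M[R]_(n, m)), [/\ slice_chart a x N c rho,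
    {in s, forall P, (r <= \rank P)%N} &
    forall y, dom c y -> (Z y <-> exists2 P, P \in s & coord c y *m P = 0)].

Lemma thin_dense m (Z : set M) : (forall x, thin_at m 1 Z x) -> dense (~` Z).
Proof.
move=> tZ O [x Ox] oO; have [N [c [rho [s [sc rs Zs]]]]] := tZ x.
have cx := slice_center sc.
have oI : open (coord c @` (dom c `&` O)).
  by apply: chart_open_image => [|y []//]; apply: openI => //; exact: open_dom.
have [||v [y [cy Oy] <-] ys] := open_avoid_subspaces (s := s) oI.
- by exists (coord c x), x.
- by move=> P /rs; apply: contraTneq => ->; rewrite mxrank0.
exists y; split=> // /(Zs _ cy)[P Ps /eqP]; exact/negP/ys.
Qed.

Lemma thin_connected m (Z : set M) : (forall x, thin_at m 2 Z x) -> connected (~` Z).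
Proof.
move=> tZ; apply: locally_connected_dense => //.
  apply: thin_dense => x; have [N [c [rho [s [sc rs Zs]]]]] := tZ x.
  by exists N, c, rho, s; split=> // P /rs /ltnW.
move=> x; have [N [c [rho [s [sc rs Zs]]]]] := tZ x.
exists (dom c); first exact: (slice_open_nbhs sc).
have -> : dom c `&` ~` Z = param c @` [set v | (coord c @` dom c) v /\
    {in s, forall P, v *m P != 0}].
  apply/seteqP; split=> [y [cy Zy]|_ [v [Bv vs] <-]].
    exists (coord c y); last by rewrite coordK// inE.
    split=> [|P Ps]; first by exists y.
    by apply/eqP => yP; apply: Zy; apply/(Zs _ cy); exists P.
  have [cv vE] := dom_param Bv; split=> // /(Zs _ cv)[P Ps].
  by rewrite vE => /eqP; exact/negP/vs.
apply: connected_image => [|v /set_mem[Bv _]].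
  apply: convex_minus_connected => //; first exact: open_coord.
  exact: (slice_convex_on sc).
by apply: param_cts; rewrite inE.
Qed.

(* Being a wall is defined without reference to charts; by [wall_rank] it means
   that [fixed_set a r] is a hypersurface near the point. *)
Definition loc_connected (r : G) (y : M) := forall N, nbhs y N ->
  exists V, [/\ open_nbhs y V, V `<=` N & connected (V `\` fixed_set a r)].

Definition wall (r : G) (x : M) := a r x = x /\ ~ loc_connected r x.

Lemma ball_convex (p : 'rV[R]_n) (e : R) : convex_on (ball p e).
Proof.
move=> u v; rewrite -ball_normE /= => pu pv _ [t + <-].
rewrite /= in_itv /= => /andP[t0 t1].
have -> : p - ((1 - t) *: u + t *: v) = (1 - t) *: (p - u) + t *: (p - v).
  by apply/rowP => i; rewrite !mxE; ring.
apply: le_lt_trans (ler_normD _ _) _; rewrite !normrZ.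
rewrite [`|t|]ger0_norm// [`|1 - t|]ger0_norm ?subr_ge0//.
move: pu pv; move: `|p - u| `|p - v| => A B Ae Be.
have [->|tn0] := eqVneq t 0; first by rewrite subr0 mul1r mul0r addr0.
have tp : 0 < t by rewrite lt_def tn0.
have : t * B < t * e by rewrite ltr_pM2l.
have : (1 - t) * A <= (1 - t) * e by rewrite ler_wpM2l ?subr_ge0// ltW.
lra.
Qed.

Lemma rank_loc_connected x N c rho r y : slice_chart a x N c rho -> a r x = x ->
  dom c y -> (1 < \rank (rho r - 1%:M)%R)%N -> loc_connected r y.
Proof.
move=> sc rx cy rk N' nN'.
have oI : open (coord c @` (dom c `&` N'°)).
  by apply: chart_open_image => [|z []//]; apply: openI; [exact: open_dom|exact: open_interior].
have : nbhs (coord c y) (coord c @` (dom c `&` N'°)).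
  by rewrite nbhsE; exists (coord c @` (dom c `&` N'°)) => //; split=> //; exists y.
move=> /nbhs_ballP[e /= e0 be].
pose V := dom c `&` coord c @^-1` (ball (coord c y) e).
have VE z : V z -> N' z.
  move=> [cz /be[w [cw Nw] wz]]; apply: nbhs_singleton; rewrite -(coordK (mem_set cz)) -wz.
  by rewrite coordK// inE.
exists V; split=> //.
  split; first by apply: coord_open_preimage; exact: ball_open.
  by split=> //; exact: ballxx.
have -> : V `\` fixed_set a r = param c @` [set v | ball (coord c y) e v /\
    {in [:: rho r - 1%:M], forall P, v *m P != 0}].
  apply/seteqP; split=> [z [[cz bz] rz]|_ [v [bv vs] <-]].
    exists (coord c z); last by rewrite coordK// inE.
    split=> // P; rewrite inE => /eqP ->; apply/eqP => zP; apply: rz.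
    exact/(slice_fixed sc).
  have [w [cw _] wv] := be _ bv.
  have [cv vE] : dom c (param c v) /\ coord c (param c v) = v.
    by apply: dom_param; exists w.
  split; first by split=> //=; rewrite vE.
  move=> /(slice_fixed sc rx cv); rewrite vE => /eqP.
  by apply/negP/vs; rewrite inE.
apply: connected_image => [|v /set_mem[bv _]].
  apply: convex_minus_connected; [exact: ball_open|exact: ball_convex|].
  by move=> P; rewrite inE => /eqP ->.
by apply: param_cts; rewrite inE; have [w [cw _] wv] := be _ bv; exists w.
Qed.

(** The two open half-spaces separate the complement, and every neighbourhood of [y] meets both. The
    chart is arbitrary, since the lemma also serves for the adapted charts that occur in the
    definition of a reflection. *)
Lemma hyperplane_not_loc_connected (c : chart R n M) r y O (l : 'rV[R]_n) :
  dom c y -> nbhs y O -> l != 0 ->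
  (forall z, O z -> dom c z -> (a r z = z <-> dot l (coord c z) = 0)) ->
  a r y = y -> ~ loc_connected r y.
Proof.
move=> cy nO l0 rE ry lc.
have nOc : nbhs y (O `&` dom c).
  by apply: filterI => //; rewrite nbhsE; exists (dom c) => //; split=> //; exact: open_dom.
have [V [[oV Vy] VO cV]] := lc _ nOc.
have ly : dot l (coord c y) = 0 by apply/rE => //; exact: nbhs_singleton.
have oP : open (dom c `&` coord c @^-1` [set v | 0 < dot l v]).
  apply: coord_open_preimage; apply: (@open_comp _ _ (dot l) [set t | 0 < t]) => //.
  by move=> ? _; exact: dot_continuous.
have oQ : open (dom c `&` coord c @^-1` [set v | dot l v < 0]).
  apply: coord_open_preimage; apply: (@open_comp _ _ (dot l) [set t | t < 0]) => //.
  by move=> ? _; exact: dot_continuous.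
have [i li] : exists i, l 0 i != 0.
  apply/existsP; apply: contraNT l0 => /existsPn l0.
  by apply/eqP/rowP => i; rewrite [RHS]mxE; apply/eqP; have := l0 i; rewrite negbK.
have oI : open (coord c @` V) by apply: chart_open_image => // z /VO[].
have [e e0 Ve] := nbhs_line (delta_mx 0 i) oI (ex_intro2 _ _ y Vy erefl).
have dE t : dot l (coord c y + t *: delta_mx 0 i) = t * l 0 i.
  by rewrite linearD linearZ /= ly add0r dot_deltar.
have pt t : `|t| <= e -> t != 0 -> exists z, (V `\` fixed_set a r) z /\
    dot l (coord c z) = t * l 0 i.
  move=> /Ve[z Vz zt] t0; exists z; rewrite zt dE; split=> //; split=> //.
  have [Oz cz] := VO _ Vz; move=> /(rE _ Oz cz); rewrite zt dE => /eqP.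
  by rewrite mulf_eq0 (negPf t0) (negPf li).
(* The sign makes [s * l 0 i] positive, so [s] and [- s] give points in opposite half-spaces. *)
pose s := Num.sg (l 0 i) * e.
have s0 : s != 0 by rewrite mulf_neq0 ?sgr_eq0// gt_eqF.
have se : `|s| <= e by rewrite normrM normr_sg li mul1r ger0_norm// ltW.
have sl : 0 < s * l 0 i.
  by rewrite /s mulrAC -normrEsg mulr_gt0 ?normr_gt0.
have [z1 [Vz1 z1E]] := pt s se s0.
have [z2 [Vz2 z2E]] := pt (- s) (etrans (congr1 (fun t => t <= e) (normrN s)) se)
  (etrans (congr1 negb (oppr_eq0 s)) s0).
have [||VP|VQ] := connected_sub_opens cV oP oQ.
- move=> z [Vz rz]; have [Oz cz] := VO _ Vz.
  have : dot l (coord c z) != 0 by apply/eqP => /(rE _ Oz cz).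
  by rewrite neq_lt => /orP[z0|z0]; [right|left].
- apply/seteqP; split=> // z [[_ /= z0] [_ /= z0']].
  by have := lt_trans z0 z0'; rewrite ltxx.
- by have [_ /=] := VP _ Vz2; rewrite z2E mulNr oppr_gt0 ltNge ltW.
- by have [_ /=] := VQ _ Vz1; rewrite z1E ltNge ltW.
Qed.

Lemma rank1_factor m (P : 'M[R]_(n, m)) : \rank P = 1%N ->
  exists (u : 'cV[R]_n) (w : 'rV[R]_m), [/\ P = u *m w, u != 0 & w != 0].
Proof.
move=> rP; have := mulmx_base P; have := row_base_free P.
move: (col_base P) (row_base P); rewrite rP => u w fw E.
exists u, w; split=> //.
  by apply/eqP => u0; move: rP; rewrite -E u0 mul0mx mxrank0.
by apply/eqP => w0; move: rP; rewrite -E w0 mulmx0 mxrank0.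
Qed.

Lemma mulmx_rank1_eq0 m (u : 'cV[R]_n) (w : 'rV[R]_m) (v : 'rV[R]_n) : w != 0 ->
  (v *m (u *m w) = 0 <-> dot u^T v = 0).
Proof.
have uE : v *m u = (dot u^T v)%:M.
  apply/rowP => i; rewrite ord1 !mxE eqxx mulr1n /dot; apply: eq_bigr => k _.
  by rewrite mxE mulrC.
move=> w0; rewrite mulmxA uE mul_scalar_mx; split=> [/eqP|->]; last by rewrite scale0r.
by rewrite scaler_eq0 (negPf w0) orbF => /eqP.
Qed.

(** Rank zero leaves an empty, hence connected, complement; rank at least two leaves a connected
    one; rank one leaves two half-spaces. As the rank does not involve [y], being a wall is locally
    constant along the fixed set. *)
Lemma wall_rank x N c rho r y : slice_chart a x N c rho -> a r x = x ->
  dom c y -> a r y = y -> (wall r y <-> \rank (rho r - 1%:M) = 1%N).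
Proof.
move=> sc rx cy ry; split=> [[_ nlc]|rk].
  case rk : (\rank (rho r - 1%:M)) => [|[|k]] //; exfalso; apply: nlc; last first.
    by apply: (rank_loc_connected sc) => //; rewrite rk.
  move=> N' nN'; exists (dom c `&` N'°); split.
  - by split; [apply: openI; [exact: open_dom|exact: open_interior]|].
  - by move=> z [_ /nbhs_singleton].
  - have -> : dom c `&` N'° `\` fixed_set a r = set0; last exact: connected0.
    apply/seteqP; split=> // z [[cz _]]; apply; apply/(slice_fixed sc) => //.
    by move/eqP: rk; rewrite mxrank_eq0 => /eqP ->; rewrite mulmx0.
split=> //; have [u [w [E u0 w0]]] := rank1_factor rk.
apply: (@hyperplane_not_loc_connected c r y setT u^T) => //.
- exact: filterT.
- by rewrite trmx_eq0.
- move=> z _ cz; apply: iff_trans (slice_fixed sc rx cz) _.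
  by rewrite E; exact: mulmx_rank1_eq0.
Qed.

Lemma loc_connected_conj g r x : loc_connected r x ->
  loc_connected (g * r * g^-1)%g (a g x).
Proof.
move=> lc N nN; have [V [[oV Vx] VN cV]] := lc (a g @^-1` N) (act_continuous hsmooth nN).
exists (a g^-1%g @^-1` V); split.
- by split; [exact: open_preimage_act|rewrite /= actVK].
- by move=> y /VN; rewrite /= actK.
have -> : a g^-1%g @^-1` V `\` fixed_set a (g * r * g^-1)%g = a g @` (V `\` fixed_set a r).
  apply/seteqP; split=> [y [Vy fy]|_ [y [Vy fy] <-]].
    exists (a g^-1%g y); last by rewrite actK.
    by split=> // e; apply: fy; rewrite /fixed_set /= !actM e actK.
  split; first by rewrite /= actVK.
  rewrite /fixed_set /= !actM actVK => e; apply: fy.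
  by rewrite /fixed_set /= -[LHS](actVK a g) e actVK.
by apply: connected_image => // y _; exact: act_continuous.
Qed.

Lemma wall_conj g r x : wall r x -> wall (g * r * g^-1)%g (a g x).
Proof.
move=> [rx nlc]; split; first by rewrite !actM actVK rx.
move=> /(@loc_connected_conj g^-1%g); rewrite actVK invgK.
by rewrite !mulgA mulVg mul1g -mulgA mulVg mulg1.
Qed.

End Walls.

(** * Group elements of rank one in a slice chart *)

Section Reflections.
Variables (R : realType) (n : nat) (M : smoothManifoldType R n).
Variables (G : discreteGroupType) (a : group_action G M).
Hypotheses (hM : connected [set: M]).
Hypotheses (hsmooth : smooth_action a) (hproper : proper_action a).
Hypotheses (heffective : effective_action a).

Section Chart.
Variables (x : M) (N : set M) (c : chart R n M) (rho : G -> 'M[R]_n).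
Hypothesis sc : slice_chart a x N c rho.

(* A nontrivial transvection has infinite order. *)
Lemma shear_trivial h (u : 'cV[R]_n) (w : 'rV[R]_n) : a h x = x ->
  rho h = 1%:M + u *m w -> w *m u = 0 -> u *m w = 0.
Proof.
move=> hx hE wu.
have rE k : rho (h ^+ k)%g = 1%:M + k%:R *: (u *m w).
  elim: k => [|k IH]; first by rewrite expg0 (rho_one sc) scale0r addr0.
  rewrite expgS (rho_mul sc)//; last exact: stab_exp.
  rewrite IH hE mulmxDl mul1mx mulmxDr mulmx1 -scalemxAl mulmxA -(mulmxA u) wu.
  by rewrite mulmx0 mul0mx scaler0 addr0 -addrA; congr (_ + _); rewrite -nat1r scalerDl scale1r.
have [k k0 hk] := stab_finite_order hproper hx.
have := rE k; rewrite hk (rho_one sc) => /eqP.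
rewrite -subr_eq0 opprD addrA subrr sub0r oppr_eq0 scaler_eq0 pnatr_eq0.
by rewrite (gtn_eqF k0) => /eqP.
Qed.

(** The column [u] is an eigenvector of [rho r] with eigenvalue [1 + k], where [k] is the trace
    [w *m u]. Finite order leaves 1 and -1 as eigenvalues, and 1 would make [rho r] a nontrivial
    transvection. *)
Lemma rank1_trace r (u : 'cV[R]_n) (w : 'rV[R]_n) : a r x = x ->
  rho r = 1%:M + u *m w -> u *m w != 0 -> w *m u = (-2)%:M.
Proof.
move=> rx rE uw0; pose k := (w *m u) 0 0.
have wu : w *m u = k%:M by apply/matrixP => i j; rewrite !ord1 !mxE eqxx mulr1n /k mxE.
have rk j : rho (r ^+ j)%g *m u = (1 + k) ^+ j *: u.
  elim: j => [|j IH]; first by rewrite expg0 (rho_one sc) mul1mx expr0 scale1r.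
  rewrite expgSr (rho_mul sc)//; last exact: stab_exp.
  have ru : rho r *m u = (1 + k) *: u.
    by rewrite rE mulmxDl mul1mx -mulmxA wu mul_mx_scalar scalerDl scale1r.
  by rewrite -mulmxA IH -scalemxAr ru scalerA -exprSr.
have [m m0 rm] := stab_finite_order hproper rx.
have u0 : u != 0 by apply: contraNneq uw0 => ->; rewrite mul0mx.
have : (1 + k) ^+ m = 1.
  have := rk m; rewrite rm (rho_one sc) mul1mx => /eqP.
  rewrite -subr_eq0 -[X in X - _]scale1r -scalerBl scaler_eq0 (negPf u0) orbF subr_eq0.
  by move=> /eqP.
move=> /(congr1 Num.norm); rewrite normrX normr1 => /eqP.
rewrite pexpr_eq1// => /eqP h.
suff k2 : k = -2 by rewrite wu k2.
have k0 : k != 0.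
  apply/eqP => k0; move: uw0; rewrite (shear_trivial rx rE) ?eqxx//.
  by rewrite wu k0; apply/matrixP => i j; rewrite !mxE mul0rn.
have [kp|kn] := leP 0 (1 + k).
  by move: h; rewrite ger0_norm// => h; exfalso; move/eqP: k0; apply; lra.
by move: h; rewrite ltr0_norm// => h; lra.
Qed.

Lemma rank1_involutive r : a r x = x -> \rank (rho r - 1%:M) = 1%N -> (r * r = 1)%g.
Proof.
move=> rx rk; have [u [w [E u0 w0]]] := rank1_factor rk.
have rE : rho r = 1%:M + u *m w by rewrite -E addrC subrK.
have uw0 : u *m w != 0 by rewrite -E -mxrank_eq0 rk.
apply: (rho_faithful hM hsmooth hproper heffective sc); first exact: stab_mul.
rewrite (rho_mul sc)// rE mulmxDl mul1mx mulmxDr mulmx1 mulmxA -(mulmxA u).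
rewrite (rank1_trace rx rE uw0) mul_mx_scalar -scalemxAl.
by move: (u *m w) => X; apply/matrixP => i j; rewrite !mxE; ring.
Qed.

(** The kernel of the block matrix is the intersection of the two fixed hyperplanes. If they
    coincided, both matrices would factor through the same column, the product of [r] and [r'] would
    be a transvection and hence trivial, and [r'] would equal [r]. *)
Lemma rank1_pair r r' : a r x = x -> a r' x = x ->
  \rank (rho r - 1%:M) = 1%N -> \rank (rho r' - 1%:M) = 1%N -> r != r' ->
  (1 < \rank (row_mx (rho r - 1%:M) (rho r' - 1%:M))%R)%N.
Proof.
move=> rx r'x k k'; apply: contraNT; rewrite -leqNgt => le1.
have rk : \rank (row_mx (rho r - 1%:M) (rho r' - 1%:M)) = 1%N.
  apply/eqP; rewrite eqn_leq le1 lt0n mxrank_eq0; apply/eqP => E.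
  move: k; have -> : rho r - 1%:M = lsubmx (row_mx (rho r - 1%:M) (rho r' - 1%:M)).
    by rewrite row_mxKl.
  by rewrite E linear0 mxrank0.
have [u [w [+ u0 w0]]] := rank1_factor rk.
rewrite -[w]hsubmxK mul_mx_row => /eq_row_mx[E E'].
set w1 := lsubmx w in E; set w2 := rsubmx w in E'.
have rE : rho r = 1%:M + u *m w1 by rewrite -E addrC subrK.
have rE' : rho r' = 1%:M + u *m w2 by rewrite -E' addrC subrK.
have uw1 : u *m w1 != 0 by rewrite -E -mxrank_eq0 k.
have uw2 : u *m w2 != 0 by rewrite -E' -mxrank_eq0 k'.
have t1 := rank1_trace rx rE uw1; have t2 := rank1_trace r'x rE' uw2.
have rr'x : a (r * r')%g x = x by exact: stab_mul.
have hE : rho (r * r')%g = 1%:M + u *m (w2 - w1).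
  rewrite (rho_mul sc)// rE rE' mulmxDl mul1mx mulmxDr mulmx1 mulmxA -(mulmxA u).
  rewrite t2 mul_mx_scalar -scalemxAl mulmxBr.
  by move: (u *m w1) (u *m w2) => X Y; apply/matrixP => i j; rewrite !mxE; ring.
have h0 : u *m (w2 - w1) = 0.
  apply: (shear_trivial rr'x hE).
  by rewrite mulmxBl t1 t2 subrr.
have rr' : (r * r' = 1)%g.
  apply: (rho_faithful hM hsmooth hproper heffective sc) => //.
  by rewrite hE h0 addr0.
apply/eqP/(mulgI r); rewrite rr'; exact: rank1_involutive.
Qed.

(** The halves are the two signs of a linear form that vanishes on the fixed hyperplane; the trace
    -2 says that [rho r] negates this form. They are connected because the chart image is convex. *)
Lemma wall_halves r : a r x = x -> \rank (rho r - 1%:M) = 1%N ->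
  exists H1 H2, [/\ dom c `\` fixed_set a r = H1 `|` H2, H1 `&` H2 = set0,
    [/\ open H1, open H2, connected H1 & connected H2] &
    forall y, (H1 y -> H2 (a r y)) /\ (H2 y -> H1 (a r y))].
Proof.
move=> rx rk; have [u [w [E u0 w0]]] := rank1_factor rk.
have rE : rho r = 1%:M + u *m w by rewrite -E addrC subrK.
have uw0 : u *m w != 0 by rewrite -E -mxrank_eq0 rk.
have t := rank1_trace rx rE uw0.
pose l := dot u^T.
have lu v : v *m u = (l v)%:M.
  apply/rowP => i; rewrite ord1 !mxE eqxx mulr1n /l /dot; apply: eq_bigr => k _.
  by rewrite mxE mulrC.
have lr v : l (v *m rho r) = - l v.
  have : (l (v *m rho r))%:M = (- l v)%:M :> 'M[R]_1.
    rewrite -lu rE -mulmxA mulmxDl mul1mx -mulmxA t mul_mx_scalar mulmxDr -scalemxAr lu.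
    by apply/matrixP => i j; rewrite !ord1 !mxE eqxx !mulr1n; ring.
  by move=> /(congr1 (fun P : 'M[R]_1 => P 0 0)); rewrite !mxE eqxx !mulr1n.
have fixE y : dom c y -> (a r y = y <-> l (coord c y) = 0).
  move=> cy; apply: iff_trans (slice_fixed sc rx cy) _.
  by rewrite E; exact: mulmx_rank1_eq0.
pose H (s : R) := dom c `&` coord c @^-1` [set v | 0 < s * l v].
have oH s : open (H s).
  apply: coord_open_preimage.
  apply: (@open_comp _ _ (fun v => s * l v) [set t | 0 < t]) => // v _.
  apply: (@continuous_comp _ _ _ l (fun t => s * t)); first exact: dot_continuous.
  exact: mulrl_continuous.
have cH s : connected (H s).
  have -> : H s = param c @` ((coord c @` dom c) `&` [set v | 0 < s * l v]).
    apply/seteqP; split=> [y [cy ly]|_ [v [Bv lv] <-]].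
      by exists (coord c y); [split=> //; exists y|rewrite coordK// inE].
    by have [cv vE] := dom_param Bv; split=> //=; rewrite vE.
  apply: connected_image => [|v /set_mem[Bv _]]; last first.
    by apply: param_cts; rewrite inE.
  apply: pairwise_connected => v v' [Bv lv] [Bv' lv'].
  exists (seg v v'); split; [exact: seg_connected| |exact: seg_left|exact: seg_right].
  move=> z vz; split; first exact: (slice_convex_on sc) vz.
  case: vz => t' + <-; rewrite /= in_itv /= => /andP[t0 t1].
  rewrite /l linearD !linearZ /= -/l mulrDr !(mulrCA s).
  have [->|tn0] := eqVneq t' 0; first by rewrite subr0 mul1r mul0r addr0.
  have tp : 0 < t' by rewrite lt_def tn0.
  apply: ltr_wpDl; last exact: mulr_gt0.
  by rewrite mulr_ge0 ?subr_ge0//; exact: ltW.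
have act s y : H s y -> H (- s) (a r y).
  move=> [cy ly]; split; first exact: (slice_inv sc).
  by rewrite /= (slice_lin sc)// lr mulrNN.
exists (H 1), (H (-1)); split.
- apply/seteqP; split=> [y [cy ry]|y [[cy /= ly]|[cy /= ly]]].
  + have : l (coord c y) != 0 by apply/eqP => /(fixE _ cy).
    rewrite neq_lt => /orP[l0|l0]; [right|left]; split=> //=; last by rewrite mul1r.
    by rewrite mulN1r oppr_gt0.
  + by split=> // /(fixE _ cy) l0; move: ly; rewrite l0 mulr0 ltxx.
  + by split=> // /(fixE _ cy) l0; move: ly; rewrite l0 mulr0 ltxx.
- apply/seteqP; split=> // y [[_ /= l1] [_ /=]].
  by move: l1; rewrite mul1r mulN1r oppr_gt0 => l1; rewrite ltNge ltW.
- by split.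
- by move=> y; split=> /act//; rewrite opprK.
Qed.

End Chart.
End Reflections.

(** * Reflections are the elements that have a wall *)

Section ReflectionWalls.
Variables (R : realType) (n : nat) (M : smoothManifoldType R n).
Variables (G : discreteGroupType) (a : group_action G M).
Hypotheses (hM : connected [set: M]).
Hypotheses (hsmooth : smooth_action a) (hproper : proper_action a).
Hypotheses (heffective : effective_action a).

Lemma smooth_on_mulmx (A : 'M[R]_n) D : smooth_on D (fun v : 'rV[R]_n => v *m A).
Proof.
move=> k j; have -> : (fun v : 'rV[R]_n => (v *m A) 0 j) = dot (\row_i A i j).
  by apply/funext => y; rewrite mxE /dot; apply: eq_bigr => i _; rewrite mxE mulrC.
exact: Ck_on_dot.
Qed.

Lemma chart_mulmx (c : chart R n M) (T : 'M[R]_n) : smooth_chart c -> T \in unitmx ->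
  exists c' : chart R n M,
    [/\ smooth_chart c', dom c' = dom c & coord c' = fun y => coord c y *m T].
Proof.
move=> sc uT; pose f y := coord c y *m T; pose f' v := param c (v *m invmx T).
have fim A : f @` A = (fun v => v *m invmx T) @^-1` (coord c @` A).
  apply/seteqP; split=> [_ [y Ay <-]|v [y Ay yv]] /=.
    by exists y => //; rewrite /f mulmxK.
  by exists y => //; rewrite /f yv mulmxKV.
have opre A : open A -> open ((fun v : 'rV[R]_n => v *m invmx T) @^-1` A).
  by move=> oA; apply: open_comp => // v _; exact: mulmx_continuous.
have of_ A : open A -> A `<=` dom c -> open (f @` A).
  by move=> oA Ac; rewrite fim; apply: opre; exact: chart_open_image.
have fK : {in dom c, cancel f f'}.
  by move=> y cy; rewrite /f /f' mulmxK// coordK.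
have f_cts : {in dom c, continuous f}.
  move=> y cy; apply: (@continuous_comp _ _ _ (coord c) (fun v => v *m T)).
    exact: coord_cts.
  exact: mulmx_continuous.
have f'_cts : {in f @` dom c, continuous f'}.
  move=> v /set_mem[y cy <-]; apply: (@continuous_comp _ _ _ (fun v : 'rV[R]_n => v *m invmx T) (param c)).
    exact: mulmx_continuous.
  by rewrite /f mulmxK//; apply: param_cts; rewrite inE; exists y.
have oc := @open_dom _ _ _ c.
exists (Chart oc (of_ _ oc (fun _ => id)) fK f_cts f'_cts); split=> // d Ad.
have [Scd Sdc] := sc d Ad; split.
  rewrite /transition_smooth /=.
  have oI : open (dom c `&` dom d) by apply: openI => //; exact: open_dom.
  have -> : coord d \o f' = (coord d \o param c) \o (fun v => v *m invmx T) by [].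
  apply: (@smooth_on_comp _ _ _ _ _ _ _ (coord c @` (dom c `&` dom d))) => //.
  - by apply: of_ => // y [].
  - by apply: chart_open_image => // y [].
  - by move=> _ [y Iy <-]; exists y => //; rewrite /f mulmxK.
  - exact: smooth_on_mulmx.
rewrite /transition_smooth /=.
have oI : open (dom d `&` dom c) by apply: openI => //; exact: open_dom.
have -> : f \o param d = (fun v => v *m T) \o (coord c \o param d) by [].
apply: (@smooth_on_comp _ _ _ _ _ _ _ setT) => //.
- by apply: chart_open_image => // y [].
- exact: openT.
- exact: smooth_on_mulmx.
Qed.

(** Brings a hyperplane into the normal form that [submanifold] requires in codimension one;
    [m.-1 <= i] singles out the last index. *)
Lemma last_coordinate m (u : 'rV[R]_m) : u != 0 -> exists2 T : 'M[R]_m, T \in unitmx &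
  forall v, dot u v = 0 <-> (forall i : 'I_m, (m.-1 <= i)%N -> (v *m T) 0 i = 0).
Proof.
case: m u => [|m] u u0; first by move: u0; rewrite thinmx0 eqxx.
have ru : \rank u = 1%N by apply/eqP; rewrite eqn_leq rank_leq_row lt0n mxrank_eq0.
have := mulmx_ebase u; rewrite ru => uE.
pose k := col_ebase u 0 0.
have k0 : k != 0.
  by have := col_ebase_unit u; rewrite unitmxE [\det _]det_mx11 unitfE.
have uk : u = k *: row 0 (row_ebase u).
  rewrite -[LHS]uE; apply/rowP => i; rewrite -mulmxA mxE big_ord1 [RHS]mxE; congr (_ * _).
  rewrite mxE (bigD1 0)//= big1 ?addr0 => [|j /negPf j0].
    by rewrite !mxE /= mul1r.
  rewrite !mxE; have -> : ((0 : 'I_1) == j :> nat) = false by rewrite eq_sym; exact: j0.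
  by rewrite mul0r.
(* The first base vector is proportional to [u], so its pairing with [v] becomes coordinate 0, which
   is then exchanged with the last one. *)
exists ((row_ebase u)^T *m tperm_mx 0 ord_max).
  by rewrite unitmx_mul unitmx_tr row_ebase_unit unitmx_perm.
have last v : (v *m ((row_ebase u)^T *m tperm_mx 0 ord_max)) 0 ord_max =
    dot (row 0 (row_ebase u)) v.
  rewrite mulmxA -xcolE !mxE perm.tpermR /dot; apply: eq_bigr => i _.
  by rewrite !mxE mulrC.
have dk v : dot u v = k * dot (row 0 (row_ebase u)) v.
  rewrite /dot mulr_sumr; apply: eq_bigr => i _.
  by rewrite {1}uk mxE mulrA.
move=> v; rewrite dk -last; split=> [/eqP|h].
  rewrite mulf_eq0 (negPf k0) /= => /eqP h i mi.
  suff -> : i = ord_max by [].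
  by apply/val_inj/eqP; rewrite /= eqn_leq mi andbT -ltnS ltn_ord.
by rewrite h ?mulr0.
Qed.

(** The fixed points in a slice chart form a convex piece of a linear subspace through the center,
    so segments join all of them to [x]. *)
Lemma fixed_component x N c rho r y : slice_chart a x N c rho -> a r x = x ->
  dom c y -> (connected_component (fixed_set a r) x y <-> a r y = y).
Proof.
move=> sc rx cy; split=> [/connected_component_sub//|ry].
have segB := slice_convex_on sc (dom_image (slice_center sc)) (dom_image cy).
apply: (@connected_component_max _ _ (param c @` seg (coord c x) (coord c y))).
- by exists (coord c x); [exact: seg_left|rewrite coordK// inE; exact: (slice_center sc)].
- move=> _ [v vs <-]; have [cv vE] := dom_param (segB _ vs).
  apply/(slice_fixed sc) => //; rewrite vE; case: vs => t _ <-.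
  rewrite mulmxDl -!scalemxAl (slice_coord0 sc) mul0mx scaler0 add0r.
  by rewrite ((slice_fixed sc rx cy).1 ry) scaler0.
- apply: connected_image => [|v /set_mem/segB Bv]; first exact: seg_connected.
  by apply: param_cts; rewrite inE.
- by exists (coord c y); [exact: seg_right|rewrite coordK// inE].
Qed.

Lemma slice_existsT x : exists c rho, slice_chart a x setT c rho.
Proof. exact: slice_chart_exists (@filterT _ _ (nbhs_filter x)). Qed.

(** By [wall_rank] being a wall is locally constant along the fixed set, hence constant on a
    component. *)
Lemma wall_component x y r : wall a r x ->
  connected_component (fixed_set a r) x y -> wall a r y.
Proof.
move=> wx Cy; set C := connected_component _ _ in Cy.
have CF p : C p -> a r p = p by move/connected_component_sub.
pose X (Z : set M) := [set p | exists2 U, open_nbhs p U &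
  forall q, U q -> a r q = q -> Z q].
have oX Z : open (X Z).
  rewrite openE => p [U [oU Up] UZ]; rewrite /interior nbhsE; exists U => // q Uq.
  by exists U.
have [||CX|CX] := (connected_opens _).1 (@component_connected _ (fixed_set a r) x)
  _ _ (oX (wall a r)) (oX (~` wall a r)).
- move=> p /CF rp; have [c [rho sc]] := slice_existsT p.
  have [k1|k1] := eqVneq (\rank (rho r - 1%:M)) 1%N; [left|right].
    exists (dom c); first exact: (slice_open_nbhs sc).
    by move=> q cq rq; apply/(wall_rank sc).
  exists (dom c); first exact: (slice_open_nbhs sc).
  by move=> q cq rq /(wall_rank sc rp cq rq) /eqP; exact/negP.
- apply/seteqP; split=> // p [[/CF rp [U [_ Up] h]] [V [_ Vp] h']].
  by have := h' _ Vp rp; have := h _ Up rp.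
- by have [U [_ Up] h] := CX _ Cy; apply: h => //; exact: CF.
- have Cx : C x by apply: connected_component_refl; case: wx.
  by have [U [_ Up] h] := CX _ Cx; have [] := h _ Up (CF _ Cx).
Qed.

(** All points of the component are walls, and a linear change of coordinates turns a slice chart at
    each of them into an adapted chart. *)
Lemma wall_reflection r x : wall a r x -> reflection a r.
Proof.
move=> wx; have rx := wx.1; exists x => //.
have n0 : (0 < n)%N.
  have [c [rho sc]] := slice_existsT x.
  have k1 := (wall_rank sc rx (slice_center sc) rx).1 wx.
  by have := rank_leq_row (rho r - 1%:M); rewrite k1.
exists n.-1; split; first by rewrite addn1 prednK.
split=> [|p Cp]; first exact: leq_pred.
have wp := wall_component wx Cp; have rp := wp.1.
have [c [rho sc]] := slice_existsT p.
have k1 := (wall_rank sc rp (slice_center sc) rp).1 wp.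
have [u [w [E u0 w0]]] := rank1_factor k1.
have [|T uT Tl] := @last_coordinate n u^T; first by rewrite trmx_eq0.
have [c' [sc' dc' cc']] := chart_mulmx (slice_smooth sc) uT.
exists c'; split=> //; first by rewrite dc'; exact: (slice_center sc).
move=> y; rewrite dc' cc' => cy.
rewrite (same_connected_component Cp).
apply: iff_trans (fixed_component sc rp cy) _.
apply: iff_trans (slice_fixed sc rp cy) _.
by rewrite E; apply: iff_trans (mulmx_rank1_eq0 _ _ w0) (Tl _).
Qed.

(** An adapted chart describes only one component of the fixed set; a slice chart shows that near
    [x] there is nothing else. *)
Lemma reflection_wall r : reflection a r -> exists x, wall a r x.
Proof.
move=> [x rx [k [kn [_ /(_ x)]]]].
move=> /(_ (connected_component_refl rx)) [c [_ cx cC]]; exists x; split=> //.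
have [c0 [rho sc]] := slice_existsT x.
have kn' : (k < n)%N by rewrite -kn addn1.
apply: (@hyperplane_not_loc_connected _ _ _ _ _ c r x (dom c0) (delta_mx 0 (Ordinal kn'))) => //.
- apply: open_nbhs_nbhs; exact: (slice_open_nbhs sc).
- apply/eqP => /rowP /(_ (Ordinal kn')) /eqP.
  by rewrite !mxE !eqxx oner_eq0.
move=> z c0z cz; rewrite dot_delta.
apply: iff_trans (iff_sym (fixed_component sc rx c0z)) _.
apply: iff_trans (cC _ cz) _; split=> [|h i ki]; first exact.
suff -> : i = Ordinal kn' by [].
apply/val_inj/eqP; rewrite /= eqn_leq ki andbT.
by have := ltn_ord i; rewrite -[X in (_ < X)%N]kn addn1.
Qed.

(** Argued through walls, whose topological definition is transported by a homeomorphism without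
    moving any chart. *)
Lemma reflection_conj g r : reflection a r -> reflection a (g * r * g^-1)%g.
Proof.
move=> /reflection_wall[x wx]; apply: (@wall_reflection _ (a g x)).
exact: wall_conj.
Qed.

Lemma reflection_involutive r : reflection a r -> (r * r = 1)%g.
Proof.
move=> /reflection_wall[x wx]; have [c [rho sc]] := slice_existsT x.
apply: (rank1_involutive hM hsmooth hproper heffective sc wx.1).
exact: (wall_rank sc wx.1 (slice_center sc) wx.1).1.
Qed.

End ReflectionWalls.

(** * From a section to generation by reflections *)

Section Orbits.
Variables (G : groupType) (M : topologicalType) (a : group_action G M).

Lemma orbit_mapP x y : orbit_map a x = orbit_map a y <-> exists g, a g x = y.
Proof.
split=> [/eqmodP/asboolP//|h]; apply/eqmodP; exact/asboolP.
Qed.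

Lemma orbit_map_continuous : continuous (orbit_map a).
Proof. exact: pi_continuous. Qed.

End Orbits.

Section SectionGenerates.
Variables (R : realType) (n : nat) (M : smoothManifoldType R n).
Variables (G : discreteGroupType) (a : group_action G M).
Hypotheses (hM : connected [set: M]).
Hypotheses (hsmooth : smooth_action a) (hproper : proper_action a).
Hypotheses (heffective : effective_action a).

(** Whatever fixes a point of a slice chart fixes its center, so the finite stabilizer of [x] yields
    all the subspaces needed. *)
Lemma stab_thin (Q : set G) r x :
  (forall c rho g, slice_chart a x setT c rho -> a g x = x -> Q g ->
    (r <= \rank (rho g - 1%:M)%R)%N) ->
  thin_at a n r [set y | exists2 g, a g y = y & Q g] x.
Proof.
move=> h; have [c [rho sc]] := slice_existsT hsmooth hproper x.
have [s sE] := (finite_seqP _).1 (stab_finite hproper x).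
have sP g : a g x = x <-> g \in s.
  by rewrite -[a g x = x]/([set g | a g x = x] g) sE.
exists setT, c, rho, [seq rho g - 1%:M | g <- s & `[< Q g >]]; split=> //.
  move=> _ /mapP[g + ->]; rewrite mem_filter => /andP[/asboolP Qg /sP gx].
  exact: (h _ _ _ sc).
move=> y cy; split=> [[g gy Qg]|[_ /mapP[g + ->]]].
  have gx : a g x = x by apply: (slice_stab sc cy); rewrite gy.
  exists (rho g - 1%:M); last exact/(slice_fixed sc).
  by apply: map_f; rewrite mem_filter; apply/andP; split; [exact/asboolP|exact/sP].
rewrite mem_filter => /andP[/asboolP Qg /sP gx] /(slice_fixed sc gx cy) gy.
by exists g.
Qed.

Lemma rank_gt0 x N c rho g : slice_chart a x N c rho -> a g x = x -> g <> 1%g ->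
  (0 < \rank (rho g - 1%:M)%R)%N.
Proof.
move=> sc gx g1; rewrite lt0n mxrank_eq0 subr_eq0; apply/eqP => r1; apply: g1.
exact: (rho_faithful hM hsmooth hproper heffective sc).
Qed.

Lemma free_dense : dense [set x | forall g, a g x = x -> g = 1%g].
Proof.
have -> : [set x | forall g, a g x = x -> g = 1%g] =
    ~` [set x | exists2 g, a g x = x & g <> 1%g].
  apply/seteqP; split=> [x h [g /h //]|x h g gx].
  by apply: contrapT => g1; apply: h; exists g.
apply: (@thin_dense _ _ _ _ a n) => x.
apply: (@stab_thin [set g | g <> 1%g]) => c rho g sc gx; exact: (rank_gt0 sc).
Qed.

Lemma section_generates (s : orbit_space a -> M) (H : set G) :
  continuous_section (orbit_map a) s -> H 1%g ->
  (forall g h, H g -> H h -> H (g * h)%g) -> (forall g, H g -> H g^-1%g) ->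
  (forall r, reflection a r -> H r) -> forall g, H g.
Proof.
move=> [cs qs] H1 HM HV HR g; apply: contrapT => nHg.
pose f x := s (orbit_map a x).
have fc : continuous f.
  by move=> x; apply: continuous_comp; [exact: orbit_map_continuous|exact: cs].
have fx x : exists k, x = a k (f x).
  have : orbit_map a (f x) = orbit_map a x.
    exact: (congr1 (fun h => h (orbit_map a x)) qs).
  by move=> /orbit_mapP[k kx]; exists k.
have fa k x : f (a k x) = f x.
  by congr s; apply/orbit_mapP; exists k^-1%g; rewrite actVK.
(* An element outside [H] is no reflection, so its fixed subspaces have codimension at least two;
   this is where reflections enter. *)
pose E := [set x | exists2 k, a k x = x & ~ H k].
have tE x : thin_at a n 2 E x.
  apply: (@stab_thin [set k | ~ H k]) => c rho k sc kx nHk.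
  case rk : (\rank (rho k - 1%:M)) => [|[|//]]; exfalso; apply: nHk.
    suff -> : k = 1%g by [].
    apply: contrapT => k1; have := rank_gt0 sc kx k1; by rewrite rk.
  apply: HR; apply: (wall_reflection hsmooth hproper (x := x)).
  exact/(wall_rank sc kx (slice_center sc) kx).
have cE : connected (~` E) by apply: (@thin_connected _ _ _ _ a hM n).
have dE : dense (~` E).
  apply: (@thin_dense _ _ _ _ a n) => x; have [N [c [rho [l [sc rl Zl]]]]] := tE x.
  by exists N, c, rho, l; split=> // P /rl /ltnW.
have nE x k : (~` E) x -> a k x = x -> H k.
  by move=> Ex kx; apply: contrapT => nk; apply: Ex; exists k.
have loc x g0 : x = a g0 (f x) -> exists2 U, open_nbhs x U & forall y k, U y ->
    y = a k (f y) -> a (k * g0^-1)%g x = x.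
  move=> xE; have [c [rho sc]] := slice_existsT hsmooth hproper x.
  have oc := @open_dom _ _ _ c; have cx := slice_center sc.
  (* Both [y] and [a g0 (f y)] lie in the slice chart, and [k * g0^-1] maps the second to the first,
     so it fixes the center. *)
  exists (dom c `&` (fun y => a g0 (f y)) @^-1` dom c).
    split; last by split=> //=; rewrite -xE.
    apply: openI => //; apply: open_comp => // y _.
    by apply: continuous_comp; [exact: fc|exact: act_continuous].
  move=> y k [cy cfy] yE; apply: (slice_stab sc cfy).
  by rewrite -actM -mulgA mulVg mulg1 -yE.
pose A := [set y | exists2 h, H h & y = a h (f y)].
pose X (Z : set M) := [set p | exists2 U, open_nbhs p U & U `<=` Z].
have oX Z : open (X Z).
  rewrite openE => p [U [oU Up] UZ]; rewrite /interior nbhsE; exists U => // q Uq.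
  by exists U.
have XZ Z p : X Z p -> Z p by move=> [U [_ Up]]; exact.
(* Every [h] occurs as a transporter outside [E]. Near a free point [x] the transporter is
   constantly [g0]; since [f] is constant on orbits, translation by [h * g0^-1] turns it into
   [h]. *)
have VE h : exists2 z, (~` E) z & z = a h (f z).
  have [x0 _] : [set: M] !=set0.
    apply/set0P/negP => /eqP M0; apply: nHg; suff -> : g = 1%g by [].
    by apply: heffective => y; have : [set: M] y by []; rewrite M0.
  have [|x [_ xfree]] := free_dense _ openT; first by exists x0.
  have [g0 xE] := fx x; have [U [oU Ux] UE] := loc _ _ xE.
  have [||z [Uz Ez]] := dE (a (g0 * h^-1)%g @^-1` U).
  - exists (a (h * g0^-1)%g x).
    by rewrite /= -actM mulgA -(mulgA g0) mulVg mulg1 mulgV act1.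
  - exact: open_preimage_act.
  exists z => //; set y := a (g0 * h^-1)%g z in Uz.
  have [k yk] := fx y; have := UE _ _ Uz yk => /xfree /(congr1 (fun t => t * g0)%g).
  rewrite mulgVK mul1g => kg0; rewrite kg0 /y fa in yk.
  have := congr1 (a (h * g0^-1)%g) yk.
  by rewrite -!actM mulgVK mulgA mulgVK mulgV act1.
have [z Ez zE] := VE g.
(* Then [g * h^-1] fixes [z], which is outside [E], so it belongs to [H], and so does [g]. *)
suff [h Hh zh] : A z.
  apply: nHg; rewrite -(mulgVK h g); apply: HM => //; apply: (nE z) => //.
  by rewrite {1}zh -actM mulgVK -zE.
have [||EX|EX] := (connected_opens _).1 cE _ _ (oX A) (oX (~` A)).
- move=> x Ex; have [[h Hh xE]|nA] := pselect (A x); [left|right].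
    have [U oU UE] := loc _ _ xE; exists U => // y Uy; have [k yk] := fx y.
    exists k => //; rewrite -(mulgVK h k); apply: HM => //.
    by apply: (nE x) => //; exact: (UE y).
  have [g0 xE] := fx x; have [U oU UE] := loc _ _ xE; exists U => // y Uy [h Hh yh].
  apply: nA; exists g0 => //; have := nE x _ Ex (UE _ _ Uy yh) => Hhg.
  have -> : g0 = ((h * g0^-1)^-1 * h)%g by rewrite invgM invgK mulgVK.
  by apply: HM => //; exact: HV.
- apply/seteqP; split=> // x [[_ /XZ Ax] /XZ nAx]; exact: nAx.
- by have /XZ := EX _ Ez.
- have [z1 Ez1 z1E] := VE 1%g; have /XZ nA := EX _ Ez1.
  by exfalso; apply: nA; exists 1%g.
Qed.

End SectionGenerates.

(** * Chambers *)

Section Sides.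
Variables (R : realType) (n : nat) (M : smoothManifoldType R n).
Variables (G : discreteGroupType) (a : group_action G M).
Hypotheses (hM : connected [set: M]).
Hypotheses (hsmooth : smooth_action a) (hproper : proper_action a).
Hypotheses (heffective : effective_action a).

Lemma reflection_neq1 r : reflection a r -> r <> 1%g.
Proof.
move=> /(reflection_wall hsmooth hproper)[x [_ nlc]] r1; apply: nlc; rewrite r1.
move=> N; rewrite nbhsE => -[U oU UN]; exists U; split=> //.
have -> : U `\` fixed_set a 1%g = set0; last exact: connected0.
by apply/seteqP; split=> // y [_]; rewrite /fixed_set /= act1.
Qed.

Lemma fixed_codense r : reflection a r -> dense (~` fixed_set a r).
Proof.
move=> rr O O0 oO; have [x [Ox fx]] := free_dense hM hsmooth hproper heffective O0 oO.
by exists x; split=> // /fx; exact: reflection_neq1.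
Qed.

Lemma reflectionK r x : reflection a r -> a r (a r x) = x.
Proof.
move=> rr; rewrite -actM.
by rewrite (reflection_involutive hM hsmooth hproper heffective rr) act1.
Qed.

Lemma fixed_reflection r y : reflection a r -> ~ fixed_set a r y -> ~ fixed_set a r (a r y).
Proof. by move=> rr ry; rewrite /fixed_set /= reflectionK// => e; apply: ry. Qed.

(* Both sides of every wall are interchanged by [r], so an [r]-invariant
   separation of the complement of the fixed set extends across it. *)
Lemma invariant_split r (X Y : set M) : reflection a r -> open X -> open Y ->
  X `&` Y = set0 -> X `|` Y = ~` fixed_set a r ->
  (forall y, X y -> X (a r y)) -> (forall y, Y y -> Y (a r y)) ->
  X = set0 \/ Y = set0.
Proof.
move=> rr oX oY XY0 XYF Xr Yr.
pose X' (Z : set M) := [set p | exists2 U, open_nbhs p U & U `\` fixed_set a r `<=` Z].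
have oX' Z : open (X' Z).
  rewrite openE => p [U [oU Up] UZ]; rewrite /interior nbhsE; exists U => // q Uq.
  by exists U.
have dF := fixed_codense rr.
have emptyP Z Z' : Z `|` Z' = ~` fixed_set a r -> Z `&` Z' = set0 ->
    [set: M] `<=` X' Z -> Z' = set0.
  move=> ZF ZZ hZ; apply/seteqP; split=> // p Z'p; have [U [_ Up] UZ] := hZ p Logic.I.
  rewrite -ZZ; split=> //; apply: UZ; split=> //.
  by have : (~` fixed_set a r) p by rewrite -ZF; right.
have [||hX|hY] := connected_sub_opens hM (oX' X) (oX' Y); last 2 first.
- by right; exact: emptyP hX.
- by left; apply: emptyP hY; rewrite 1?setUC 1?setIC.
- move=> x _; have [rx|rx] := pselect (fixed_set a r x); last first.
    have : (X `|` Y) x by rewrite XYF.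
    by move=> [Xx|Yx]; [left; exists X|right; exists Y] => // y [].
  have [c [rho sc]] := slice_existsT hsmooth hproper x.
  have cx := slice_center sc.
  have [k1|k1] := pselect (wall a r x).
    have rk := (wall_rank sc rx cx rx).1 k1.
    have [H1 [H2 [E _ [oH1 oH2 cH1 _] Hr]]] := wall_halves hproper sc rx rk.
    have H1F : H1 `<=` X `|` Y.
      move=> y H1y; rewrite XYF; have : (dom c `\` fixed_set a r) y by rewrite E; left.
      by case.
    have oc : open_nbhs x (dom c) by exact: (slice_open_nbhs sc).
    have [HX|HY] := connected_sub_opens cH1 oX oY H1F XY0; [left|right].
      exists (dom c) => // y; rewrite E => -[/HX//|H2y].
      by rewrite -(reflectionK y rr); apply: Xr; apply: HX; exact: (Hr y).2.
    exists (dom c) => // y; rewrite E => -[/HY//|H2y].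
    by rewrite -(reflectionK y rr); apply: Yr; apply: HY; exact: (Hr y).2.
  have lc : loc_connected a r x by apply: contrapT => nlc; apply: k1.
  have [V [oV _ cV]] := lc _ (@filterT _ _ (nbhs_filter x)).
  have VF : V `\` fixed_set a r `<=` X `|` Y by move=> y [_]; rewrite XYF.
  by have [VX|VY] := connected_sub_opens cV oX oY VF XY0; [left|right]; exists V.
apply/seteqP; split=> // p [[U [oU Up] UX] [V [oV Vp] VY]].
have [|q [[Uq Vq] qF]] := dF (U `&` V) _ (openI oU oV); first by exists p.
have : (X `&` Y) q by split; [apply: UX; split|apply: VY; split].
by rewrite XY0.
Qed.

Lemma fixed_open_compl r : open (~` fixed_set a r).
Proof. by rewrite openC; exact: fixed_closed. Qed.

(** A separation of the complement need not be exchanged by [r] a priori. The points that [r] keeps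
    in their part and those that it moves to the other part form an invariant splitting, so one kind
    does not occur. *)
Lemma dissecting_sides r : reflection a r -> dissecting a r ->
  exists2 A, open A & forall y, ~ fixed_set a r y -> (A y <-> ~ A (a r y)).
Proof.
move=> rr dr; apply: contrapT => nA; apply: dr; apply/connected_opens => P Q oP oQ FPQ FI.
pose F := fixed_set a r; pose P0 := ~` F `&` P; pose Q0 := ~` F `&` Q.
have oP0 : open P0 by apply: openI => //; exact: fixed_open_compl.
have oQ0 : open Q0 by apply: openI => //; exact: fixed_open_compl.
have PQ0 : P0 `&` Q0 = set0.
  by apply/seteqP; split=> // y [[Fy Py] [_ Qy]]; rewrite -FI; split.
have PQF : P0 `|` Q0 = ~` F.
  apply/seteqP; split=> [y [[]|[]]//|y Fy].
  by have [Py|Qy] := FPQ _ Fy; [left|right].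
have Fr y : ~ F y -> ~ F (a r y) by exact: fixed_reflection.
have opre Z : open Z -> open (a r @^-1` Z) by exact: open_preimage_act.
(* If [X] is empty, [P0] is a side. If [Y] is empty, [P0] and [Q0] are themselves invariant, so one
   of them is empty and there was no separation. *)
pose X := (P0 `&` a r @^-1` P0) `|` (Q0 `&` a r @^-1` Q0).
pose Y := (P0 `&` a r @^-1` Q0) `|` (Q0 `&` a r @^-1` P0).
have cov y : ~ F y -> P0 y \/ Q0 y by move=> Fy; have : (~` F) y by []; rewrite -PQF.
have nPQ y : P0 y -> Q0 y -> False by move=> Py Qy; rewrite -[False]/(set0 y) -PQ0.
have [||||||X0|Y0] := @invariant_split r X Y rr.
- by apply: openU; apply: openI => //; exact: opre.
- by apply: openU; apply: openI => //; exact: opre.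
- apply/seteqP; split=> // y [[[h1 h2]|[h1 h2]] [[h3 h4]|[h3 h4]]].
  + exact: (nPQ (a r y)).
  + exact: (nPQ y).
  + exact: (nPQ y).
  + exact: (nPQ (a r y)).
- apply/seteqP; split=> [y [[[[]]|[[]]]|[[[]]|[[]]]]//|y Fy].
  have [h1|h1] := cov _ Fy; have [h2|h2] := cov _ (Fr _ Fy).
  + by left; left.
  + by right; left.
  + by right; right.
  + by left; right.
- by move=> y [[h1 h2]|[h1 h2]]; [left|right]; split=> //=; rewrite reflectionK.
- by move=> y [[h1 h2]|[h1 h2]]; [right|left]; split=> //=; rewrite reflectionK.
- exfalso; apply: nA; exists P0 => // y Fy; split=> [h1 h2|h].
    by have Xy : X y by [left]; rewrite X0 in Xy.
  have [//|h1] := cov _ Fy; have [//|h2] := cov _ (Fr _ Fy).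
  by have Xy : X y by [right]; rewrite X0 in Xy.
- have [||P00|Q00] := @invariant_split r P0 Q0 rr oP0 oQ0 PQ0 PQF.
  + move=> y Py; have [//|Qry] := cov _ (Fr _ Py.1).
    by have Yy : Y y by [left]; rewrite Y0 in Yy.
  + move=> y Qy; have [Pry|//] := cov _ (Fr _ Qy.1).
    by have Yy : Y y by [right]; rewrite Y0 in Yy.
  + by right=> y Fy; have [|[]//] := cov _ Fy; rewrite P00.
  + by left=> y Fy; have [[]//|] := cov _ Fy; rewrite Q00.
Qed.

(** A connected punctured neighbourhood would lie on one side, yet it contains a point together with
    its image under [r]. So the fixed set of a dissecting reflection has no component of higher
    codimension. *)
Lemma dissecting_wall r x : reflection a r -> dissecting a r -> a r x = x -> wall a r x.
Proof.
move=> rr dr rx; split=> // lc; have [A oA Ar] := dissecting_sides rr dr.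
have [V [[oV Vx] _ cV]] := lc _ (@filterT _ _ (nbhs_filter x)).
have [||y [[Vy Vry] Fy]] := fixed_codense rr (O := V `&` a r @^-1` V).
- by exists x; split=> //=; rewrite rx.
- by apply: openI => //; exact: open_preimage_act.
have oA' : open (a r @^-1` A) by exact: open_preimage_act.
have [||VA|VA] := (connected_opens _).1 cV _ _ oA oA'.
- move=> z [_ Fz]; have [Az|nAz] := pselect (A z); [by left|right].
  by apply: contrapT => nA; apply: nAz; apply/(Ar _ Fz).
- apply/seteqP; split=> // z [[[_ Fz] Az] Arz].
  by have := (Ar _ Fz).1 Az.
- have := (Ar _ Fy).1 (VA _ (conj Vy Fy)); apply; apply: VA.
  by split=> //; exact: fixed_reflection.
- have ryF : ~ fixed_set a r (a r y) by exact: fixed_reflection.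
  have := VA _ (conj Vy Fy); have := VA _ (conj Vry ryF); rewrite /= reflectionK//.
  by move=> Ay /=; exact: (Ar _ Fy).1.
Qed.

End Sides.

(** * Mirrors and the points on at most one of them *)

Section Chambers.
Variables (R : realType) (n : nat) (M : smoothManifoldType R n).
Variables (G : discreteGroupType) (a : group_action G M).
Hypotheses (hM : connected [set: M]).
Hypotheses (hsmooth : smooth_action a) (hproper : proper_action a).
Hypotheses (heffective : effective_action a).
Hypothesis hdis : forall r, reflection a r -> dissecting a r.

Lemma dissecting_rank1 x N c rho r : slice_chart a x N c rho -> reflection a r ->
  a r x = x -> \rank (rho r - 1%:M) = 1%N.
Proof.
move=> sc rr rx; apply/(wall_rank sc rx (slice_center sc) rx).
exact: dissecting_wall (hdis rr) rx.
Qed.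

Definition mirrors : set M := [set x | exists2 r, reflection a r & a r x = x].

Definition simple_points : set M := [set x | forall r r', reflection a r ->
  reflection a r' -> a r x = x -> a r' x = x -> r = r'].

Lemma fixed_conj g r x : a (g * r * g^-1)%g (a g x) = a g x <-> a r x = x.
Proof.
rewrite !actM actVK; split=> [e|-> //].
by rewrite -[LHS](actVK a g) e actVK.
Qed.

Lemma fixed_conjV g r x : a (g^-1 * r * g)%g (a g^-1%g x) = a g^-1%g x <-> a r x = x.
Proof. by have := fixed_conj g^-1%g r x; rewrite invgK. Qed.

Lemma reflection_conjV g r : reflection a r -> reflection a (g^-1 * r * g)%g.
Proof. by move=> rr; have := reflection_conj hsmooth hproper g^-1%g rr; rewrite invgK. Qed.

Lemma mirrors_act g x : mirrors (a g x) <-> mirrors x.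
Proof.
split=> -[r rr rx].
  exists (g^-1 * r * g)%g; first exact: reflection_conjV.
  by apply/(fixed_conj g); rewrite !mulgA mulgV mul1g mulgK.
by exists (g * r * g^-1)%g; [exact: reflection_conj|apply/fixed_conj].
Qed.

Lemma simple_points_actV g x : simple_points x -> simple_points (a g^-1%g x).
Proof.
move=> sx r r' rr rr' rx rx'.
have conjx t : a t (a g^-1%g x) = a g^-1%g x -> a (g * t * g^-1)%g x = x.
  by move=> tx; rewrite !actM tx actK.
have : (g * r * g^-1 = g * r' * g^-1)%g.
  by apply: sx; [exact: reflection_conj|exact: reflection_conj|exact: conjx|exact: conjx].
by move=> /mulIg/mulgI.
Qed.

(** The bad points are the pairwise intersections of distinct mirrors, of codimension two by
    [rank1_pair]; the block matrices defining them have [n + n] columns. *)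
Lemma simple_points_thin x : thin_at a (n + n) 2 (~` simple_points) x.
Proof.
have [c [rho sc]] := slice_existsT hsmooth hproper x.
have [s sE] := (finite_seqP _).1 (stab_finite hproper x).
have sP g : a g x = x <-> g \in s.
  by rewrite -[a g x = x]/([set g | a g x = x] g) sE.
pose q := [seq p <- [seq (r, r') | r <- s, r' <- s] |
  `[< [/\ reflection a p.1, reflection a p.2 & p.1 <> p.2] >]].
exists setT, c, rho, [seq row_mx (rho p.1 - 1%:M) (rho p.2 - 1%:M) | p <- q]; split=> //.
  move=> _ /mapP[[r r'] + ->]; rewrite mem_filter => /andP[/asboolP[rr rr' /eqP ne]].
  move=> /allpairsP[[r1 r1'] [/sP rx /sP rx' [? ?]]]; subst r1 r1'.
  by apply: (rank1_pair hM hsmooth hproper heffective sc) => //; exact: (dissecting_rank1 sc).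
move=> y cy; split=> [ny|[_ /mapP[[r r'] + ->]]].
  have [r [r' [[rr rr' ne] ry ry']]] : exists r r', [/\ [/\ reflection a r, reflection a r' & r <> r'],
      a r y = y & a r' y = y].
    apply: contrapT => no; apply: ny => r r' rr rr' ry ry'.
    by apply: contrapT => ne; apply: no; exists r, r'.
  have rx : a r x = x by apply: (slice_stab sc cy); rewrite ry.
  have rx' : a r' x = x by apply: (slice_stab sc cy); rewrite ry'.
  exists (row_mx (rho r - 1%:M) (rho r' - 1%:M)); last first.
    rewrite mul_mx_row ((slice_fixed sc rx cy).1 ry) ((slice_fixed sc rx' cy).1 ry').
    by rewrite row_mx0.
  apply/mapP; exists (r, r') => //; rewrite mem_filter; apply/andP; split; first exact/asboolP.
  by apply/allpairsP; exists (r, r'); split=> //; exact/sP.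
rewrite mem_filter => /andP[/asboolP[rr rr' ne]].
move=> /allpairsP[[r1 r1'] [/sP rx /sP rx' [? ?]]]; subst r1 r1'.
rewrite mul_mx_row -[0 in RHS]row_mx0 => /eq_row_mx[ry ry'] sy; apply: ne.
by apply: sy => //; apply/(slice_fixed sc).
Qed.

Lemma simple_points_connected : connected simple_points.
Proof.
rewrite -[simple_points]setCK; apply: (@thin_connected _ _ _ _ a hM (n + n)).
exact: simple_points_thin.
Qed.

(** A generic point of the hyperplane of [r] works, since every other mirror through [x] cuts this
    hyperplane in a proper subspace. *)
Lemma reflection_simple_point r : reflection a r -> exists2 x, simple_points x & a r x = x.
Proof.
move=> rr; have [x [rx _]] := reflection_wall hsmooth hproper rr.
have [c [rho sc]] := slice_existsT hsmooth hproper x.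
have rk := dissecting_rank1 sc rr rx.
have [s sE] := (finite_seqP _).1 (stab_finite hproper x).
have sP g : a g x = x <-> g \in s.
  by rewrite -[a g x = x]/([set g | a g x = x] g) sE.
(* The map [w] to [w *m K] parametrizes the hyperplane, so genericity inside it becomes avoidance of
   kernels in the full space. *)
pose K := kermx (rho r - 1%:M).
pose q := [seq K *m (rho r' - 1%:M) | r' <- s & `[< reflection a r' /\ r' <> r >]].
have [|||w Bw wq] := @open_avoid_subspaces R n n q
  ((fun w => w *m K) @^-1` (coord c @` dom c)).
- by apply: open_comp; [move=> v _; exact: mulmx_continuous|exact: open_coord].
- by exists 0; rewrite /= mul0mx; exists x; [exact: (slice_center sc)|exact: (slice_coord0 sc)].
- move=> _ /mapP[r' + ->]; rewrite mem_filter => /andP[/asboolP[rr' ne] /sP rx'].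
  apply/eqP => K0.
  have rk' := dissecting_rank1 sc rr' rx'.
  have ne' : r != r' by apply/eqP => e; apply: ne.
  have := rank1_pair hM hsmooth hproper heffective sc rx rx' rk rk' ne'.
  have : K *m row_mx (rho r - 1%:M) (rho r' - 1%:M) = 0.
    by rewrite mul_mx_row K0 mulmx_ker row_mx0.
  (* A space of dimension [n - 1] would lie in one of dimension [n - k], with [k] between 2 and
     [n]. *)
  move=> /sub_kermxP/mxrankS; rewrite !mxrank_ker rk.
  have := rank_leq_row (row_mx (rho r - 1%:M) (rho r' - 1%:M)).
  by move: (\rank _) => k; lia.
have [cy yE] := dom_param Bw; exists (param c (w *m K)); last first.
  by apply/(slice_fixed sc) => //; rewrite yE -mulmxA mulmx_ker mulmx0.
suff H r' : reflection a r' -> a r' (param c (w *m K)) = param c (w *m K) -> r' = r.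
  by move=> r1 r2 rr1 rr2 f1 f2; rewrite (H r1)// (H r2).
move=> rr' fy; apply: contrapT => ne.
have rx' : a r' x = x by apply: (slice_stab sc cy); rewrite fy.
have Pq : K *m (rho r' - 1%:M) \in q.
  by apply: map_f; rewrite mem_filter; apply/andP; split; [exact/asboolP|exact/sP].
have := wq _ Pq; rewrite mulmxA -yE => /eqP; apply.
exact/(slice_fixed sc).
Qed.

End Chambers.

(** * A chamber and words in the reflections in its walls *)

Section Chamber.
Variables (R : realType) (n : nat) (M : smoothManifoldType R n).
Variables (G : discreteGroupType) (a : group_action G M).
Hypotheses (hM : connected [set: M]).
Hypotheses (hsmooth : smooth_action a) (hproper : proper_action a).
Hypotheses (heffective : effective_action a).
Hypothesis hdis : forall r, reflection a r -> dissecting a r.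

Variable side : G -> set M.
Hypothesis side_open : forall r, reflection a r -> open (side r).
Hypothesis side_swap : forall r, reflection a r -> forall y, ~ fixed_set a r y ->
  (side r y <-> ~ side r (a r y)).

Variable x0 : M.
Hypothesis x0_free : forall g, a g x0 = x0 -> g = 1%g.

(** The labelling of the two sides is arbitrary; the exclusive or does not depend on it and is
    additive along a chain of points. It is meaningful only off the fixed set. *)
Definition sep r y z : bool := `[< side r y >] (+) `[< side r z >].

Lemma sep_trans r x y z : sep r x z = sep r x y (+) sep r y z.
Proof. by rewrite /sep addbA -(addbA _ _ `[< side r y >]) addbb addbF. Qed.

Lemma sepC r x y : sep r x y = sep r y x.
Proof. by rewrite /sep addbC. Qed.

Lemma sep_refl r x : sep r x x = false.
Proof. by rewrite /sep addbb. Qed.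

Lemma off_side_open r : reflection a r -> open (~` fixed_set a r `&` ~` side r).
Proof.
move=> rr.
have -> : ~` fixed_set a r `&` ~` side r = ~` fixed_set a r `&` a r @^-1` side r.
  apply/seteqP; split=> y [Fy sy]; split=> //=.
    by apply: contrapT => ns; apply: sy; apply/(side_swap rr Fy).
  by move=> /(side_swap rr Fy); apply.
apply: openI; first exact: fixed_open_compl.
by apply: open_preimage_act => //; exact: side_open.
Qed.

Lemma on_side_open r : reflection a r -> open (~` fixed_set a r `&` side r).
Proof.
by move=> rr; apply: openI; [exact: fixed_open_compl|exact: side_open].
Qed.

Lemma connected_sep r C y z : reflection a r -> connected C ->
  C `<=` ~` fixed_set a r -> C y -> C z -> sep r y z = false.
Proof.
move=> rr cC CF Cy Cz.
have [||CA|CB] := connected_sub_opens cC (on_side_open rr) (off_side_open rr).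
- move=> w Cw; have [sw|sw] := pselect (side r w); [left|right]; split=> //; exact: CF.
- by apply/seteqP; split=> // w [[_ h] [_]]; apply.
- have [[_ sy] [_ sz]] := (CA _ Cy, CA _ Cz).
  by rewrite /sep !asboolT.
- have [[_ sy] [_ sz]] := (CB _ Cy, CB _ Cz).
  by rewrite /sep !asboolF.
Qed.

Lemma sep_reflection r y : reflection a r -> ~ fixed_set a r y -> sep r y (a r y).
Proof.
move=> rr Fy; rewrite /sep; have [sy|sy] := pselect (side r y).
  by rewrite asboolT// asboolF//; exact: (side_swap rr Fy).1.
rewrite asboolF// asboolT//; apply: contrapT => ns; apply: sy.
exact/(side_swap rr Fy).
Qed.

Lemma near_sep r y : reflection a r -> ~ fixed_set a r y ->
  exists2 U, open_nbhs y U & forall z, U z -> ~ fixed_set a r z /\ sep r y z = false.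
Proof.
move=> rr Fy; have [sy|sy] := pselect (side r y).
  exists (~` fixed_set a r `&` side r); first by split=> //; exact: on_side_open.
  by move=> z [Fz sz]; split=> //; rewrite /sep !asboolT.
exists (~` fixed_set a r `&` ~` side r); first by split=> //; exact: off_side_open.
by move=> z [Fz sz]; split=> //; rewrite /sep !asboolF.
Qed.

(** The sides of [r] and of its conjugate are chosen independently. Whether [a g] matches the two
    labellings is locally constant off the fixed set and invariant under [r], hence constant by
    [invariant_split]. *)
Lemma sep_conj g r y z : reflection a r -> ~ fixed_set a r y -> ~ fixed_set a r z ->
  sep (g * r * g^-1)%g (a g y) (a g z) = sep r y z.
Proof.
move=> rr Fy Fz; set t := (g * r * g^-1)%g.
have tt : reflection a t by exact: reflection_conj.
have Ft w : ~ fixed_set a r w -> ~ fixed_set a t (a g w).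
  by move=> Fw /fixed_conj.
pose d w := `[< side r w >] (+) `[< side t (a g w) >].
pose X b := [set w | ~ fixed_set a r w /\ d w = b].
have dloc w : ~ fixed_set a r w -> exists2 U, open_nbhs w U &
    forall v, U v -> ~ fixed_set a r v /\ d v = d w.
  move=> Fw; have [U [oU Uw] hU] := near_sep rr Fw.
  have [V [oV Vw] hV] := near_sep tt (Ft _ Fw).
  exists (U `&` a g @^-1` V).
    by split=> //; apply: openI => //; exact: open_preimage_act.
  move=> v [/hU[Fv sv] /hV[_ sv']]; split=> //; move: sv sv'; rewrite /sep /d.
  by case: `[< _ >]; case: `[< _ >]; case: `[< _ >]; case: `[< _ >].
have oX b : open (X b).
  rewrite openE => w [Fw dw]; have [U oU hU] := dloc _ Fw.
  rewrite /interior nbhsE; exists U => // v /hU[Fv dv]; split=> //.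
  by rewrite dv.
have dr w : ~ fixed_set a r w -> d (a r w) = d w.
  move=> Fw; have h1 := sep_reflection rr Fw; have h2 := sep_reflection tt (Ft _ Fw).
  have E : a g (a r w) = a t (a g w) by rewrite /t !actM actVK.
  move: h1 h2; rewrite /d /sep E.
  by case: `[< _ >]; case: `[< _ >]; case: `[< _ >]; case: `[< _ >].
have Xr b w : X b w -> X b (a r w).
  move=> [Fw dw]; split; first exact: (fixed_reflection hM hsmooth hproper heffective).
  by rewrite dr.
have [||h|h] := invariant_split hM hsmooth hproper heffective rr (oX true) (oX false) _ _
  (Xr true) (Xr false).
- by apply/seteqP; split=> // w [[_ dw] [_]]; rewrite dw.
- apply/seteqP; split=> [w [[]|[]]//|w Fw]; rewrite /X /=.
  by case: (d w) => //; [left|right].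
- have dE w : ~ fixed_set a r w -> d w = false.
    by move=> Fw; case E : (d w) => //; have : X true w by []; rewrite h.
  have := dE _ Fy; have := dE _ Fz; rewrite /d /sep.
  by case: `[< _ >]; case: `[< _ >]; case: `[< _ >]; case: `[< _ >].
- have dE w : ~ fixed_set a r w -> d w = true.
    by move=> Fw; case E : (d w) => //; have : X false w by []; rewrite h.
  have := dE _ Fy; have := dE _ Fz; rewrite /d /sep.
  by case: `[< _ >]; case: `[< _ >]; case: `[< _ >]; case: `[< _ >].
Qed.

Definition chamber := connected_component (~` mirrors a) x0.

Lemma x0_mirrors g : ~ mirrors a (a g x0).
Proof.
move=> /(mirrors_act hsmooth hproper)[r rr rx].
by apply: (reflection_neq1 hsmooth hproper rr); exact: x0_free.
Qed.

Lemma x0_chamber : chamber x0.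
Proof.
by apply: connected_component_refl; have := @x0_mirrors 1%g; rewrite act1.
Qed.

Lemma chamber_absorb g C y z : connected C -> C `<=` ~` mirrors a -> C y -> C z ->
  chamber (a g^-1%g y) -> chamber (a g^-1%g z).
Proof.
move=> cC CW Cy Cz Dy; rewrite /chamber (same_connected_component Dy).
apply: (@connected_component_max _ _ (a g^-1%g @` C)); last by exists z.
- by exists y.
- by move=> _ [w Cw <-] /(mirrors_act hsmooth hproper); exact: CW.
- by apply: connected_image => // w _; exact: act_continuous.
Qed.

Lemma chamber_off_mirrors y : chamber y -> ~ mirrors a y.
Proof. by move/connected_component_sub. Qed.

(* A slice chart is star-shaped about its center, and so is the complement of
   the mirrors in it. *)
Lemma chamber_star x N c rho g y : slice_chart a x N c rho -> dom c y ->
  chamber (a g^-1%g y) -> closure chamber (a g^-1%g x).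
Proof.
move=> sc cy Dy B nB.
have Wy : ~ mirrors a y.
  by move/(mirrors_act hsmooth hproper g^-1%g); exact: chamber_off_mirrors.
have nO : nbhs x (a g^-1%g @^-1` B) by exact: act_continuous.
move: nO; rewrite nbhsE => -[V [oV Vx] VB].
have oI : open (coord c @` (dom c `&` V)).
  by apply: chart_open_image => [|? []//]; apply: openI => //; exact: open_dom.
have cx := slice_center sc.
have [e e0 he] := nbhs_line (coord c y) oI (ex_intro2 _ _ x (conj cx Vx) (slice_coord0 sc)).
have Bt t : 0 <= t <= 1 -> (coord c @` dom c) (t *: coord c y).
  move=> t01; have := slice_convex sc t01 (dom_image cx) (dom_image cy).
  by rewrite (slice_coord0 sc) scaler0 add0r.
pose t0 := Num.min e 1.
have t00 : 0 < t0 by rewrite lt_min e0 ltr01.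
have t01 : t0 <= 1 by rewrite ge_min lexx orbT.
have t0e : `|t0| <= e by rewrite ger0_norm ?ge_min ?lexx// ltW.
have [z [cz Vz] zE] := he _ t0e.
rewrite add0r in zE.
exists (a g^-1%g z); split; last exact: VB.
pose C := param c @` ((fun t : R => t *: coord c y) @` `[t0, 1]).
have CE t : t \in `[t0, 1] -> 0 < t /\ (coord c @` dom c) (t *: coord c y).
  rewrite in_itv /= => /andP[tt0 tt1]; split; first exact: lt_le_trans tt0.
  by apply: Bt; rewrite tt1 andbT (le_trans (ltW t00)).
apply: (@chamber_absorb g C y) Dy.
- apply: connected_image.
    apply: connected_image; first exact/connected_intervalP/interval_is_interval.
    by move=> t _; exact: (cvgZl cvg_id).
  move=> v /set_mem[t /CE[_ Btt] <-].
  by apply: param_cts; rewrite inE.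
- move=> _ [_ [t /CE[tp Btt] <-] <-] [r rr]; have [ct tE] := dom_param Btt => rt.
  have rx : a r x = x by apply: (slice_stab sc ct); rewrite rt.
  apply: Wy; exists r => //; apply/(slice_fixed sc) => //.
  move/(slice_fixed sc rx ct): rt; rewrite tE -scalemxAl => /eqP.
  by rewrite scaler_eq0 gt_eqF//= => /eqP.
- exists (1 *: coord c y); last by rewrite scale1r coordK// inE.
  by exists 1; rewrite //= in_itv /= t01 lexx.
- exists (t0 *: coord c y); last by rewrite -zE coordK// inE.
  by exists t0; rewrite //= in_itv /= lexx t01.
Qed.

Lemma near_closure_chamber g y U : open U -> U y -> closure chamber (a g^-1%g y) ->
  exists2 z, U z & chamber (a g^-1%g z).
Proof.
move=> oU Uy /(_ (a g @^-1` U)) [|w [Dw Uw]].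
  rewrite nbhsE; exists (a g @^-1` U); last by [].
  by split; [exact: open_preimage_act|rewrite /= actK].
by exists (a g w) => //; rewrite actVK.
Qed.

(** No mirror cuts a translate of the chamber, so a limit point off the mirror stays on the side of
    the whole translate. *)
Lemma closure_chamber_sep r g w : reflection a r -> closure chamber w ->
  ~ fixed_set a r (a g w) -> sep r (a g w) (a g x0) = false.
Proof.
move=> rr cw Fw; have [U [oU Uw] hU] := near_sep rr Fw.
have [|z Uz Dz] := @near_closure_chamber g (a g w) U oU Uw; first by rewrite actVK.
have [Fz sz] := hU _ Uz.
rewrite (sep_trans r _ z) sz /=.
apply: (@connected_sep r (a g @` chamber)) => //.
- apply: connected_image; first exact: component_connected.
  by move=> v _; exact: act_continuous.
- move=> _ [v Dv <-] Fv; apply: (chamber_off_mirrors Dv).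
  by apply/(mirrors_act hsmooth hproper g); exists r.
- by exists (a g^-1%g z) => //; rewrite actK.
- by exists x0 => //; exact: x0_chamber.
Qed.

(** Reflections in the walls of the chamber. Asking for a simple point of the mirror in the closure,
    rather than any point, makes [s] the only reflection separating the chamber from its image under
    [s]. *)
Definition simple_reflection r := reflection a r /\
  exists z, [/\ simple_points a z, closure chamber z & a r z = z].

Fixpoint word k g : Prop := if k is k'.+1 then
  exists s h, [/\ simple_reflection s, word k' h & g = (s * h)%g] else g = 1%g.

Let refl2 r : reflection a r -> (r * r = 1)%g.
Proof. exact: (reflection_involutive hM hsmooth hproper heffective). Qed.

Let reflV r : reflection a r -> (r^-1 = r)%g.
Proof. by move=> rr; apply: (mulgI r); rewrite mulgV refl2. Qed.

Let x0F g r : reflection a r -> ~ fixed_set a r (a g x0).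
Proof. by move=> rr rx; apply: (@x0_mirrors g); exists r. Qed.

Let x0F1 r : reflection a r -> ~ fixed_set a r x0.
Proof. by move=> rr; have := @x0F 1%g r rr; rewrite act1. Qed.

Lemma word_mul k l g h : word k g -> word l h -> word (k + l) (g * h)%g.
Proof.
elim: k g => [|k IH] g /=; first by move=> ->; rewrite mul1g.
move=> [s [g' [ss wg ->]]] wh; exists s, (g' * h)%g; split=> //; last by rewrite mulgA.
exact: IH.
Qed.

Lemma word1 s : simple_reflection s -> word 1 s.
Proof. by move=> ss; exists s, 1%g; rewrite mulg1. Qed.

Lemma word_inv k g : word k g -> word k g^-1%g.
Proof.
elim: k g => [|k IH] g; first by move=> /= ->; rewrite invg1.
move=> [s [h [ss wh ->]]]; rewrite invgM (reflV ss.1) -[k.+1]addn1.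
by apply: word_mul; [exact: IH|exact: word1].
Qed.

(** The point [z] lies in the closure of the chamber and of its image under [s]. If [t] did not fix
    [z], both would be on the side of [z]; so [t] fixes the simple point [z]. *)
Lemma simple_sep s t : simple_reflection s -> reflection a t ->
  sep t x0 (a s x0) -> t = s.
Proof.
move=> [rs [z [sz cz zs]]] rt st; apply: sz => //.
apply: contrapT => tz.
have h1 : sep t z x0 = false.
  by have := @closure_chamber_sep t 1%g z rt cz; rewrite !act1; exact.
have h2 : sep t z (a s x0) = false.
  by have := @closure_chamber_sep t s z rt cz; rewrite zs; exact.
by move: st; rewrite (sep_trans t _ z) sepC h1 h2.
Qed.

(** If [t] separates the chamber from its image under the first letter [s], it equals [s] and
    cancels it. Otherwise the conjugate of [t] by [s] separates the chamber from its image under the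
    remaining word, and the letter is deleted there. *)
Lemma exchange k g t : word k.+1 g -> reflection a t -> sep t x0 (a g x0) ->
  word k (t * g)%g.
Proof.
elim: k g t => [|k IH] g t [s [h [ss wh ->]]] rt st.
  move: st; rewrite /= in wh *; rewrite wh mulg1 => /(simple_sep ss rt) ->.
  exact: refl2 ss.1.
have [ts|/eqP ts] := pselect (sep t x0 (a s x0)).
  by rewrite (simple_sep ss rt ts) mulgA (refl2 ss.1) mul1g.
have {}ts : sep t x0 (a s x0) = false by apply/negbTE/negP/eqP.
have rst : reflection a (s * t * s)%g.
  by rewrite -{2}(reflV ss.1); exact: (reflection_conj hsmooth hproper).
have : sep (s * t * s)%g x0 (a h x0).
  move: st; rewrite (sep_trans t _ (a s x0)) ts /= => st.
  have E : (s * (s * t * s) * s^-1 = t)%g.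
    by rewrite !mulgA mulgK (refl2 ss.1) mul1g.
  by rewrite -(sep_conj s)// ?E -?actM//; [exact: x0F1|exact: x0F].
move=> /(IH _ _ wh rst) wk; exists s, (s * t * s * h)%g; split=> //.
by rewrite !mulgA (refl2 ss.1) mul1g.
Qed.

Lemma word_fixed k g w : word k g -> closure chamber w -> closure chamber (a g w) ->
  a g w = w.
Proof.
elim/ltn_ind: k g => -[|k] IH g.
  by move=> /= -> _ _; rewrite act1.
move=> [s [h [ss wh gE]]] cw cgw; have rs := ss.1.
have [gs|/negP/negbTE gs] := pselect (sep s x0 (a g x0)).
  have sg : a s (a g w) = a g w.
    apply: contrapT => ns.
    have h1 := closure_chamber_sep (g := g) rs cw ns.
    have h2 : sep s (a g w) x0 = false.
      by have := @closure_chamber_sep s 1%g (a g w) rs cgw; rewrite !act1; exact.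
    by move: gs; rewrite (sep_trans s _ (a g w)) sepC h1 h2.
  have hE : h = (s * g)%g by rewrite gE mulgA (refl2 rs) mul1g.
  have hw : a h w = a g w by rewrite hE actM.
  rewrite -hw; apply: (IH k) => //; by rewrite hw.
have hs : sep s x0 (a h x0).
  have E : (s * s * s^-1 = s)%g by rewrite (refl2 rs) mul1g (reflV rs).
  rewrite -(sep_conj s)// ?E -?actM//; [|exact: x0F1|exact: x0F].
  rewrite -gE (sep_trans s _ x0) gs addbF sepC.
  exact: sep_reflection (x0F1 rs).
case: k IH wh => [|k] IH wh; first by move: hs; rewrite /= in wh; rewrite wh act1 sep_refl.
have wg : word k g by rewrite gE; exact: exchange.
by apply: (IH k).
Qed.

(** At most one mirror crosses a slice chart at a simple point. A translate of the chamber meeting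
    the chart fills it or one of its halves; the other half is then filled by the reflected
    translate. *)
Lemma simple_point_tile x : simple_points a x -> exists2 U, open_nbhs x U &
  forall y, U y -> (exists2 g, exists k, word k g & closure chamber (a g^-1%g y)) ->
  forall z, U z -> exists2 g, exists k, word k g & closure chamber (a g^-1%g z).
Proof.
move=> sx; have [c [rho sc]] := slice_existsT hsmooth hproper x.
have oc := @open_dom _ _ _ c; have cx := slice_center sc.
exists (dom c) => // y cy [g [k wg] clg] z cz.
have [y1 cy1 Dy1] := near_closure_chamber oc cy clg.
have [[r [rr rx]]|no] := pselect (exists r, reflection a r /\ a r x = x); last first.
  exists g; first by exists k.
  apply: subset_closure.
  have WU : dom c `<=` ~` mirrors a.
    move=> w cw [r rr rw]; apply: no; exists r; split=> //.
    by apply: (slice_stab sc cw); rewrite rw.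
  apply: (@chamber_absorb g (dom c) y1) => //.
  have -> : dom c = param c @` (coord c @` dom c).
    apply/seteqP; split=> [w cw|_ [v Bv <-]]; last exact: (dom_param Bv).1.
    by exists (coord c w); [exact: dom_image|rewrite coordK// inE].
  apply: connected_image; last exact: param_cts.
  apply: pairwise_connected => u v Bu Bv; exists (seg u v).
  by split; [exact: seg_connected|exact: (slice_convex_on sc)|exact: seg_left|exact: seg_right].
have rk := dissecting_rank1 hM hsmooth hproper heffective hdis sc rr rx.
have mir w : dom c w -> mirrors a w -> a r w = w.
  move=> cw [t rt tw]; have tx : a t x = x by apply: (slice_stab sc cw); rewrite tw.
  by rewrite (sx r t).
have [H1 [H2 [HE _ [oH1 oH2 cH1 cH2] Hr]]] := wall_halves hproper sc rx rk.
have key (H H' : set M) : dom c `\` fixed_set a r = H `|` H' -> connected H ->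
    (forall w, (H w -> H' (a r w)) /\ (H' w -> H (a r w))) -> H y1 ->
    exists2 g, exists k, word k g & closure chamber (a g^-1%g z).
  move=> {}HE cH {}Hr Hy1.
  have HW : H `<=` ~` mirrors a.
    move=> w Hw Ww; have [cw rw] : (dom c `\` fixed_set a r) w by rewrite HE; left.
    by apply: rw; exact: mir.
  have HD w : H w -> chamber (a g^-1%g w).
    by move=> Hw; exact: (chamber_absorb cH HW Hy1 Hw Dy1).
  (* A point of the mirror is a limit of points [w] off it, and either [w] or [a r w] lies in the
     half already covered. *)
  have [rz|rz] := pselect (a r z = z).
    exists g; first by exists k.
    move=> B nB.
    have nB' : nbhs z (a g^-1%g @^-1` B) by apply: (act_continuous hsmooth).
    have nB'' : nbhs z (a r @^-1` (a g^-1%g @^-1` B)).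
      by apply: (act_continuous hsmooth); rewrite rz.
    have : nbhs z ((a g^-1%g @^-1` B `&` a r @^-1` (a g^-1%g @^-1` B)) `&` dom c).
      apply: filterI; first exact: filterI.
      by apply: open_nbhs_nbhs; split.
    rewrite nbhsE => -[V [oV Vz] VB].
    have [|w [Vw Fw]] := fixed_codense hM hsmooth hproper heffective rr _ oV; first by exists z.
    have [[Bw Brw] cw] := VB _ Vw.
    have : (H `|` H') w by rewrite -HE.
    move=> [Hw|Hw']; first by exists (a g^-1%g w); split; [exact: HD|].
    by exists (a g^-1%g (a r w)); split; [apply: HD; exact: (Hr w).2|].
  have : (H `|` H') z by rewrite -HE.
  move=> [Hz|H'z].
    by exists g; [exists k|apply: subset_closure; exact: HD].
  (* Pulled back by [g], the mirror through [x] is a wall of the chamber, so crossing it appends a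
     letter on the right of [g]. *)
  have ss : simple_reflection (g^-1 * r * g)%g.
    split; first exact: reflection_conjV.
    exists (a g^-1%g x); split.
    - exact: simple_points_actV.
    - exact: (chamber_star sc cy1 Dy1).
    - exact/fixed_conjV.
  exists (r * g)%g.
    exists (k + 1)%N; have -> : (r * g = g * (g^-1 * r * g))%g.
      by rewrite !mulgA mulgV mul1g.
    by apply: word_mul => //; exact: word1.
  apply: subset_closure; rewrite invgM actM (reflV rr); apply: HD.
  exact: (Hr z).2.
have Fy1 : ~ fixed_set a r y1.
  move=> ry1; apply: (chamber_off_mirrors Dy1).
  by apply/(mirrors_act hsmooth hproper); exists r.
have : (H1 `|` H2) y1 by rewrite -HE.
move=> [Hy1|Hy1]; first exact: (key H1 H2).
apply: (key H2 H1) => //; first by rewrite setUC.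
by move=> w; split; [exact: (Hr w).2|exact: (Hr w).1].
Qed.

Lemma simple_points_tiled x : simple_points a x ->
  exists2 g, exists k, word k g & closure chamber (a g^-1%g x).
Proof.
pose Y := [set x | exists2 g, exists k, word k g & closure chamber (a g^-1%g x)].
pose X (Z : set M) := [set p | exists2 U, open_nbhs p U & U `<=` Z].
have oX Z : open (X Z).
  rewrite openE => p [U [oU Up] UZ]; rewrite /interior nbhsE; exists U => // q Uq.
  by exists U.
have XZ Z p : X Z p -> Z p by move=> [U [_ Up]]; exact.
have Yx0 : Y x0.
  exists 1%g; first by exists 0%N.
  by rewrite invg1 act1; apply: subset_closure; exact: x0_chamber.
have sx0 : simple_points a x0.
  by move=> r r' rr rr' /x0_free r1; have := reflection_neq1 hsmooth hproper rr r1.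
have cS := simple_points_connected hM hsmooth hproper heffective hdis.
have [||SX|SX] := (connected_opens _).1 cS _ _ (oX Y) (oX (~` Y)).
- move=> p /simple_point_tile[U oU hU].
  have [[y [Uy Yy]]|nY] := pselect (exists y, U y /\ Y y); [left|right].
    by exists U => // z Uz; exact: hU Yy _ Uz.
  by exists U => // z Uz Yz; apply: nY; exists z.
- by apply/seteqP; split=> // p [[_ /XZ Yp] /XZ nYp]; exact: nYp.
- by move=> sx; exact: (XZ Y _ (SX _ sx)).
- by have /XZ := SX _ sx0.
Qed.

(** Free points are simple and dense, and [chamber_star] passes from a nearby covered point to the
    center of the chart. *)
Lemma tiled x : exists2 g, exists k, word k g & closure chamber (a g^-1%g x).
Proof.
have [c [rho sc]] := slice_existsT hsmooth hproper x.
have oc := @open_dom _ _ _ c; have cx := slice_center sc.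
have [|y [cy fy]] := free_dense hM hsmooth hproper heffective _ oc; first by exists x.
have sy : simple_points a y.
  by move=> r r' rr rr' /fy r1; have := reflection_neq1 hsmooth hproper rr r1.
have [g wg /(near_closure_chamber oc cy)[z cz Dz]] := simple_points_tiled sy.
by exists g => //; exact: (chamber_star sc cz Dz).
Qed.

Hypothesis hgen : forall H : set G, H 1%g ->
  (forall g h, H g -> H h -> H (g * h)%g) -> (forall g, H g -> H g^-1%g) ->
  (forall r, reflection a r -> H r) -> forall g, H g.

(** The mirror of a reflection has a simple point, which lies in the closure of some translate by a
    word [g]; so the reflection is conjugate under [g] to a simple one. *)
Lemma word_exists g : exists k, word k g.
Proof.
move: g; apply: (hgen (H := [set g | exists k, word k g])).
- by exists 0%N.
- by move=> g h [k wg] [l wh]; exists (k + l)%N; exact: word_mul.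
- by move=> g [k wg]; exists k; exact: word_inv.
move=> r rr; have [x sx rx] :=
  reflection_simple_point hM hsmooth hproper heffective hdis rr.
have [g [k wg] cg] := simple_points_tiled sx.
have ss : simple_reflection (g^-1 * r * g)%g.
  split; first exact: reflection_conjV.
  exists (a g^-1%g x); split=> //; first exact: simple_points_actV.
  exact/fixed_conjV.
exists (k + (1 + k))%N; have -> : r = (g * ((g^-1 * r * g) * g^-1))%g.
  by rewrite !mulgA mulgV mul1g mulgK.
apply: word_mul => //; apply: word_mul; [exact: word1|exact: word_inv].
Qed.

Lemma closure_chamber_fixed g w : closure chamber w -> closure chamber (a g w) -> a g w = w.
Proof. by have [k wg] := word_exists g; exact: word_fixed wg. Qed.

(** The section sends an orbit to its unique point in the closed chamber. For continuity, a
    translate covering a nearby [y] also covers the center [x], so uniqueness relates the two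
    translating elements by an element fixing [x]. *)
Lemma chamber_section : exists s : orbit_space a -> M, continuous_section (orbit_map a) s.
Proof.
have tile x : exists g, closure chamber (a g^-1%g x) by have [g _ h] := tiled x; exists g.
pose rep x := a (projT1 (cid (tile x)))^-1%g x.
have repC x : closure chamber (rep x) by rewrite /rep; case: cid.
have repO x : exists g, rep x = a g^-1%g x by eexists.
have repP x g : closure chamber (a g^-1%g x) -> rep x = a g^-1%g x.
  move=> cg; have [h hE] := repO x.
  have E : rep x = a (h^-1 * g)%g (a g^-1%g x) by rewrite -actM mulgK hE.
  by rewrite E; apply: closure_chamber_fixed => //; rewrite -E.
have rep_cts : continuous rep.
  move=> x B nB; have [g0 gE] := repO x.
  have nB' : nbhs x (a g0^-1%g @^-1` B).
    by apply: (act_continuous hsmooth); rewrite -gE.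
  have [c [rho sc]] := slice_chart_exists hsmooth hproper nB'.
  have : nbhs x (dom c) by apply: open_nbhs_nbhs; exact: (slice_open_nbhs sc).
  apply: filterS => y cy; have [g yE] := repO y.
  have : closure chamber (a g^-1%g y) by rewrite -yE.
  move=> /(near_closure_chamber (@open_dom _ _ _ c) cy)[z cz Dz].
  have gx : a (g0 * g^-1)%g x = x.
    by rewrite actM -(repP x g (chamber_star sc cz Dz)) gE actK.
  (* The stabilizer keeps [y] in the slice chart, which was chosen inside the preimage of [B] under
     [g0^-1]. *)
  have := slice_sub sc (slice_inv sc gx cy).
  by rewrite /= -actM mulgA mulVg mul1g -yE.
exists (rep \o repr); split.
  apply/quotient_continuous.
  have -> : (rep \o repr) \o \pi_(orbit_space a) = rep.
    apply/funext => x /=.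
    have [g gx] : exists g, a g x = repr (orbit_map a x).
      by apply/orbit_mapP; rewrite [RHS]reprK.
    rewrite -[repr _]gx; have [h hE] := repO x.
    rewrite hE (repP (a g x) (g * h)%g); rewrite invgM -!actM mulgVK//.
    by rewrite -hE.
  exact: rep_cts.
apply/funext => o /=; have [g gE] := repO (repr o).
rewrite gE -[RHS]reprK; apply/orbit_mapP; exists g; exact: actK.
Qed.

End Chamber.

(** * Monodromy of the sides of a reflection *)

Section Paths.
Variable R : realType.

(** Retracts the line onto the unit interval, so that paths and homotopies given on it become
    continuous everywhere. *)
Definition clamp (t : R) : R := Num.max 0 (Num.min 1 t).

Lemma clamp_itv t : 0 <= clamp t <= 1.
Proof. by rewrite /clamp le_max lexx /= ge_max ler01 ge_min lexx. Qed.

Lemma clamp_id t : 0 <= t <= 1 -> clamp t = t.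
Proof. by move=> /andP[t0 t1]; rewrite /clamp min_r// max_r. Qed.

Lemma clamp_continuous : continuous clamp.
Proof.
move=> t; apply: continuous_max; first exact: cst_continuous.
by apply: continuous_min; [exact: cst_continuous|exact: cvg_id].
Qed.

Lemma within_comp (X Y Z : topologicalType) (A : set Y) (f : X -> Y) (g : Y -> Z) :
  {within A, continuous g} -> continuous f -> (forall x, A (f x)) -> continuous (g \o f).
Proof.
move=> /subspace_continuousP gc fc fA x; apply: (cvg_comp f g); last exact: (gc _ (fA x)).
move=> B wB; have h : nbhs x (f @^-1` (fun y => A y -> B y)) := fc x _ wB.
rewrite -[_ B]/(nbhs x (f @^-1` B)).
by apply: filterS h => z hz; exact: (hz (fA z)).
Qed.

(** Replaces subdivision into small intervals: the endpoints reachable from [a] form an open and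
    closed part of the interval. *)
Lemma itv_gluing (P : R -> R -> Prop) :
  (forall a b c, a <= b -> b <= c -> P a b -> P b c -> P a c) ->
  (forall a a' b' b, a <= a' -> a' <= b' -> b' <= b -> P a b -> P a' b') ->
  (forall t, exists2 e, 0 < e & P (t - e) (t + e)) ->
  forall a b, a <= b -> P a b.
Proof.
move=> Pglue Pmono Ploc a b ab.
pose X (Z : set R) := [set t | exists2 U, open_nbhs t U &
  forall s, U s -> s \in `[a, b] -> Z s].
have oX Z : open (X Z).
  rewrite openE => p [U [oU Up] UZ]; rewrite /interior nbhsE; exists U => // q Uq.
  by exists U.
have loc t : exists2 U, open_nbhs t U & forall s s', U s -> U s' ->
    a <= s -> a <= s' -> P a s -> P a s'.
  have [e e0 Pe] := Ploc t; exists (ball t e).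
    by split; [exact: ball_open|exact: ballxx].
  move=> s s'; rewrite -ball_normE /= !ltr_distlC => /andP[ts se] /andP[ts' s'e] as_ as' Ps.
  have [ss'|/ltW ss'] := leP s s'; last exact: Pmono Ps.
  by apply: Pglue Ps _ => //; apply: Pmono Pe => //; exact: ltW.
have aS : a \in `[a, b] by rewrite in_itv /= lexx.
have bS : b \in `[a, b] by rewrite in_itv /= lexx ab.
have Paa : P a a.
  by have [e e0 Pe] := Ploc a; apply: Pmono Pe => //; rewrite ?lerBlDr lerDl ltW.
have cI : connected (`[a, b] : set R) by exact/connected_intervalP/interval_is_interval.
have [||SX|SX] := (connected_opens _).1 cI _ _ (oX [set t | P a t]) (oX (~` [set t | P a t])).
- move=> t tab; have [U oU hU] := loc t.
  have at_ : a <= t by move: tab; rewrite /= in_itv /= => /andP[].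
  have [Pt|nPt] := pselect (P a t); [left|right]; exists U => // s Us;
    rewrite in_itv /= => /andP[as_ _].
    by apply: (hU t) => //; case: oU.
  by move=> Ps; apply: nPt; apply: (hU s) => //; case: oU.
- apply/seteqP; split=> // t [[tab [U [_ Ut] h1]] [V [_ Vt] h2]].
  by have := h2 _ Vt tab; apply; exact: h1.
- by have [U [_ Ub] h] := SX _ bS; exact: h.
- by have [U [_ Ua] h] := SX _ aS; have := h _ Ua aS Paa.
Qed.

Lemma path_concat (T : topologicalType) (c d : R -> T) : continuous c -> continuous d ->
  c 1 = d 0 -> continuous (fun t : R => if t <= 2^-1 then c (2 * t) else d (2 * t - 1)).
Proof.
move=> cc cd cd1.
have c2 : continuous (fun t : R => c (2 * t)).
  by move=> t; apply: continuous_comp; [exact: mulrl_continuous|exact: cc].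
have d2 : continuous (fun t : R => d (2 * t - 1)).
  move=> t; apply: (@continuous_comp _ _ _ (fun t : R => 2 * t - 1) d); last exact: cd.
  by apply: cvgB; [exact: mulrl_continuous|exact: cvg_cst].
set f := fun t : R => _; move=> t B nB; rewrite -[_ B]/(nbhs t (f @^-1` B)).
have hc s : c (2 * s) = c (2 * t) -> f t = c (2 * t) -> nbhs s ((fun t => c (2 * t)) @^-1` B).
  by move=> E ft; apply: (c2 s); rewrite E -ft.
have hd : f t = d (2 * t - 1) -> nbhs t ((fun t => d (2 * t - 1)) @^-1` B).
  by move=> ft; apply: (d2 t); rewrite -ft.
have [t2|t2|t2] := ltgtP t 2^-1.
- have nt : nbhs t [set s : R | s < 2^-1] by apply: open_nbhs_nbhs; split=> //; exact: open_lt.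
  have ft : f t = c (2 * t) by rewrite /f ltW.
  by apply: filterS (filterI nt (hc t erefl ft)) => s [/= /ltW s2 Bs]; rewrite /f s2.
- have nt : nbhs t [set s : R | 2^-1 < s] by apply: open_nbhs_nbhs; split=> //; exact: open_gt.
  have ft : f t = d (2 * t - 1) by rewrite /f leNgt t2.
  by apply: filterS (filterI nt (hd ft)) => s [/= s2 Bs]; rewrite /f leNgt s2.
- have fc : f t = c (2 * t) by rewrite /f t2 lexx.
  have fd : f t = d (2 * t - 1) by rewrite fc t2 mulfV// subrr cd1.
  by apply: filterS (filterI (hc t erefl fc) (hd fd)) => s [/= Bc Bd]; rewrite /f; case: ifP.
Qed.

End Paths.

(** * Side functions, their germs and lifts *)

Section Monodromy.
Variables (R : realType) (n : nat) (M : smoothManifoldType R n).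
Variables (G : discreteGroupType) (a : group_action G M).
Hypotheses (hM : connected [set: M]).
Hypotheses (hsmooth : smooth_action a) (hproper : proper_action a).
Hypotheses (heffective : effective_action a).
Variable r : G.
Hypothesis rr : reflection a r.

Local Notation F := (fixed_set a r).

(* The two germs of side functions at a point form a double cover of [M],
   whose monodromy counts crossings of the walls of [r] modulo two. *)
Definition side_function (U : set M) (f : M -> bool) := [/\ open U,
  forall y, U y -> ~ F y -> exists2 V, open_nbhs y V & forall z, V z -> f z = f y &
  forall y, U y -> wall a r y -> exists2 V, open_nbhs y V &
    forall z, V z -> ~ F z -> f (a r z) = ~~ f z].

Definition germ (y : M) (f g : M -> bool) (b : bool) :=
  exists2 V, open_nbhs y V & forall z, V z -> ~ F z -> f z (+) g z = b.

(** Constants suffice away from walls; at a wall the indicator of one half of a slice chart is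
    used. *)
Lemma side_function_exists y : exists U f, side_function U f /\ U y.
Proof.
have [ry|ry] := pselect (F y); last first.
  exists (~` F), (fun=> true); split=> //; split.
  - exact: fixed_open_compl.
  - by move=> z Fz _; exists (~` F) => //; split=> //; exact: fixed_open_compl.
  - by move=> z Fz [/Fz].
have [c [rho sc]] := slice_existsT hsmooth hproper y.
have oc := @open_dom _ _ _ c; have cy := slice_center sc.
exists (dom c).
have [wy|nwy] := pselect (wall a r y); last first.
  exists (fun=> true); split=> //; split=> //.
    by move=> z cz _; exists (dom c).
  move=> z cz wz; exfalso; apply: nwy; apply/(wall_rank sc ry cy ry).
  exact/(wall_rank sc ry cz wz.1).
have rk := (wall_rank sc ry cy ry).1 wy.
have [H1 [H2 [HE H0 [oH1 oH2 cH1 cH2] Hr]]] := wall_halves hproper sc ry rk.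
have nH z : H2 z -> H1 z -> False.
  by move=> h2 h1; have : (H1 `&` H2) z by []; rewrite H0.
exists (fun z => `[< H1 z >]); split=> //; split=> //.
  move=> z cz Fz; have : (H1 `|` H2) z by rewrite -HE.
  move=> [h|h]; first by exists H1 => // w h'; rewrite !asboolT.
  by exists H2 => // w h'; rewrite !asboolF// => /nH; apply.
move=> z cz wz; exists (dom c) => // w cw Fw; have : (H1 `|` H2) w by rewrite -HE.
move=> [h|h].
  by rewrite (asboolF (nH _ ((Hr w).1 h))) (asboolT h).
by rewrite (asboolT ((Hr w).2 h)) (asboolF (nH _ h)).
Qed.

(** The fibre of the double cover has two elements. At a wall the sum of two side functions is
    constant on one half, and both change when the wall is crossed, so the constant is the same on
    the other half. *)
Lemma side_function_germ U V f g y : side_function U f -> side_function V g ->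
  U y -> V y -> exists b, germ y f g b.
Proof.
move=> [oU lf wf] [oV lg wg] Uy Vy.
have lfg z : U z -> V z -> ~ F z -> exists2 W, open_nbhs z W &
    forall w, W w -> f w (+) g w = f z (+) g z.
  move=> Uz Vz Fz; have [W1 [q1 m1] h1] := lf _ Uz Fz; have [W2 [q2 m2] h2] := lg _ Vz Fz.
  exists (W1 `&` W2); first by split=> //; exact: openI.
  by move=> w [/h1 -> /h2 ->].
have [ry|ry] := pselect (F y); last first.
  by exists (f y (+) g y); have [W oW hW] := lfg _ Uy Vy ry; exists W => // z /hW.
have nUV : nbhs y (U `&` V).
  by apply: filterI; apply: open_nbhs_nbhs.
have fcon C : connected C -> C `<=` (U `&` V) `\` F -> exists b, forall z, C z -> f z (+) g z = b.
  move=> cC CUV; have [[w Cw]|nC] := pselect (exists w, C w); last first.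
    by exists true => z Cz; exfalso; apply: nC; exists z.
  exists (f w (+) g w) => z Cz.
  apply: (@locally_constant_connected M (fun w => f w (+) g w) C) => // v /CUV[[Uv Vv] Fv].
  exact: lfg.
have [wy|nwy] := pselect (wall a r y); last first.
  have lc : loc_connected a r y by apply: contrapT => nlc; apply: nwy.
  have [W [oW WUV cW]] := lc _ nUV.
  have [|b hb] := fcon _ cW; first by move=> z [/WUV].
  by exists b; exists W => // z Wz Fz; exact: hb.
have [W1 oW1 h1] := wf _ Uy wy; have [W2 oW2 h2] := wg _ Vy wy.
have nW : nbhs y ((U `&` V) `&` (W1 `&` W2)).
  by apply: filterI => //; apply: filterI; exact: open_nbhs_nbhs.
have [c [rho sc]] := slice_chart_exists hsmooth hproper nW.
have cy := slice_center sc; have rk := (wall_rank sc ry cy ry).1 wy.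
have [H1 [H2 [HE H0 [oH1 oH2 cH1 cH2] Hr]]] := wall_halves hproper sc ry rk.
have HcF z : H1 z -> dom c z /\ ~ F z.
  by move=> h; have : (dom c `\` F) z by rewrite HE; left.
have [|b hb] := fcon _ cH1.
  by move=> z /HcF[/(slice_sub sc)[UVz _] Fz].
exists b; exists (dom c); first exact: (slice_open_nbhs sc).
move=> z cz Fz; have : (H1 `|` H2) z by rewrite -HE.
move=> [/hb//|h2z].
have [_ [W1z W2z]] := slice_sub sc cz.
by rewrite -(hb _ ((Hr z).2 h2z)) (h1 _ W1z Fz) (h2 _ W2z Fz); case: (f z); case: (g z).
Qed.

Lemma side_functionN U f : side_function U f -> side_function U (fun y => ~~ f y).
Proof.
move=> [oU lf wf]; split=> //.
  by move=> y Uy Fy; have [V oV hV] := lf _ Uy Fy; exists V => // z /hV ->.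
by move=> y Uy wy; have [V oV hV] := wf _ Uy wy; exists V => // z Vz Fz; rewrite hV.
Qed.

Lemma germ_unique y f g b b' : germ y f g b -> germ y f g b' -> b = b'.
Proof.
move=> [V [oV Vy] h] [W [oW Wy] h'].
have dF := fixed_codense hM hsmooth hproper heffective rr.
have [|z [[Vz Wz] Fz]] := dF (V `&` W) _ (openI oV oW); first by exists y.
by rewrite -(h _ Vz Fz) (h' _ Wz Fz).
Qed.

Lemma germ_refl y f : germ y f f false.
Proof.
by exists setT; [split=> //; exact: openT|move=> z _ _; case: (f z)].
Qed.

Lemma germ_sym y f g b : germ y f g b -> germ y g f b.
Proof. by move=> [V oV h]; exists V => // z Vz Fz; rewrite -(h _ Vz Fz); case: (f z); case: (g z). Qed.

Lemma germ_trans y f g h b b' : germ y f g b -> germ y g h b' -> germ y f h (b (+) b').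
Proof.
move=> [V [oV Vy] hV] [W [oW Wy] hW]; exists (V `&` W); first by split=> //; exact: openI.
move=> z [Vz Wz] Fz; rewrite -(hV _ Vz Fz) -(hW _ Wz Fz).
by case: (f z); case: (g z); case: (h z).
Qed.

Lemma germN y f g b : germ y f g b -> germ y (fun z => ~~ f z) g (~~ b).
Proof. by move=> [V oV h]; exists V => // z Vz Fz; rewrite -(h _ Vz Fz); case: (f z); case: (g z). Qed.

Lemma germNN y f g b : germ y f g b -> germ y (fun z => ~~ f z) (fun z => ~~ g z) b.
Proof. by move=> [V oV h]; exists V => // z Vz Fz; rewrite -(h _ Vz Fz); case: (f z); case: (g z). Qed.

Lemma germ_open f g b : open [set y | germ y f g b].
Proof.
rewrite openE => y [V [oV Vy] h]; rewrite /interior nbhsE; exists V => // z Vz.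
by exists V.
Qed.

Lemma germ_value y f g b : ~ F y -> germ y f g b -> f y (+) g y = b.
Proof. by move=> Fy [V [_ Vy] h]; exact: h. Qed.

Section Lifts.
Variables (X : topologicalType) (p : X -> M).
Hypothesis pc : continuous p.

(** A section of the double cover along [p]: [L z] represents the germ chosen at [p z], and
    representatives at nearby points agree as germs. *)
Definition lift (Z : set X) (L : X -> M -> bool) := forall z, Z z ->
  (exists2 U, side_function U (L z) & U (p z)) /\
  \forall w \near z, Z w -> germ (p w) (L w) (L z) false.

Lemma liftS Z Z' L : Z' `<=` Z -> lift Z L -> lift Z' L.
Proof.
move=> ZZ lL z /ZZ/lL[h1 h2]; split=> //.
by apply: filterS h2 => w h /ZZ.
Qed.

Lemma liftN Z L : lift Z L -> lift Z (fun z y => ~~ L z y).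
Proof.
move=> lL z /lL[[U sU Uz] h]; split.
  by exists U => //; exact: side_functionN.
by apply: filterS h => w h Zw; apply: germNN; exact: h.
Qed.

Lemma lift_local U f Z : side_function U f -> (forall z, Z z -> U (p z)) ->
  lift Z (fun=> f).
Proof.
move=> sU ZU z Zz; split; first by exists U => //; exact: ZU.
by apply: nearW => w _; exact: germ_refl.
Qed.

(** Uniqueness of lifts: the parity by which two of them differ is locally constant. *)
Lemma lift_compare Z L L' z w : connected Z -> lift Z L -> lift Z L' -> Z z -> Z w ->
  forall b, germ (p z) (L z) (L' z) b -> germ (p w) (L w) (L' w) b.
Proof.
move=> cZ lL lL' Zz Zw b hz.
pose Y b := [set v | exists2 V, open_nbhs v V &
  forall u, V u -> Z u -> germ (p u) (L u) (L' u) b].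
have oY c : open (Y c).
  rewrite openE => v [U [oU Uv] UZ]; rewrite /interior nbhsE; exists U => // q Uq.
  by exists U.
have loc v c : Z v -> germ (p v) (L v) (L' v) c -> Y c v.
  move=> Zv hv; have [_ h1] := lL _ Zv; have [_ h2] := lL' _ Zv.
  have h3 : nbhs v (p @^-1` [set y | germ y (L v) (L' v) c]).
    exact: (pc (open_nbhs_nbhs (conj (germ_open (L v) (L' v) c) hv))).
  have fv := @filterI _ _ (nbhs_filter v).
  have := fv _ _ (fv _ _ h1 h2) h3; rewrite nbhsE => -[V oV hV].
  exists V => // u /hV[[g1 g2] g3] Zu.
  by have := germ_trans (germ_trans (g1 Zu) g3) (germ_sym (g2 Zu)); case: (c).
have comp v : Z v -> exists c, germ (p v) (L v) (L' v) c.
  move=> Zv; have [[U sU Uv] _] := lL _ Zv; have [[U' sU' Uv'] _] := lL' _ Zv.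
  exact: side_function_germ sU sU' Uv Uv'.
have [||h|h] := (connected_opens _).1 cZ _ _ (oY b) (oY (~~ b)).
- move=> v Zv; have [c hc] := comp _ Zv.
  have [E|E] := eqVneq c b; first by left; rewrite -E; exact: loc.
  right; have -> : ~~ b = c by move: E; case: (c); case: (b).
  exact: loc.
- apply/seteqP; split=> // v [[Zv [V [_ Vv] h1]] [W [_ Wv] h2]].
  by have := germ_unique (h1 _ Vv Zv) (h2 _ Wv Zv); case: (b).
- by have [V [_ Vw] hw] := h _ Zw; exact: hw.
- have [V [_ Vz] hz'] := h _ Zz.
  by have := germ_unique hz (hz' _ Vz Zz); case: (b).
Qed.

(** Near a point outside one of the closed sets only one lift matters; on the overlap the two lifts
    are made to have the same germs. *)
Lemma lift_glue Z Z' L L' : closed Z -> closed Z' -> connected (Z `&` Z') ->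
  lift Z L -> lift Z' L' -> exists L'', lift (Z `|` Z') L''.
Proof.
move=> cZ cZ' cI lL lL'.
have [L1 lL1 hI] : exists2 L1, lift Z' L1 &
    forall z, (Z `&` Z') z -> germ (p z) (L1 z) (L z) false.
  have [[z [Zz Zz']]|no] := pselect (Z `&` Z' !=set0); last first.
    by exists L' => // z Iz; exfalso; apply: no; exists z.
  have lIL : lift (Z `&` Z') L by apply: liftS lL => w [].
  have lIL' : lift (Z `&` Z') L' by apply: liftS lL' => w [].
  have [[U sU Uz] _] := lL _ Zz; have [[U' sU' Uz'] _] := lL' _ Zz'.
  (* The parity at one common point decides between [L'] and its negation; connectedness carries the
     agreement over the whole overlap. *)
  have [[] hb] := side_function_germ sU' sU Uz' Uz; last first.
    exists L' => // w Iw.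
    exact: (lift_compare cI lIL' lIL (conj Zz Zz') Iw hb).
  exists (fun z y => ~~ L' z y); first exact: liftN.
  by move=> w Iw; exact: (lift_compare cI (liftN lIL') lIL (conj Zz Zz') Iw (germN hb)).
exists (fun z => if `[< Z z >] then L z else L1 z) => z ZZz.
have [Zz|nZz] := pselect (Z z).
  rewrite (asboolT Zz); have [h1 h2] := lL _ Zz; split=> //.
  have [Zz'|nZz'] := pselect (Z' z); last first.
    have : nbhs z (~` Z') by apply: open_nbhs_nbhs; split=> //; exact: closed_openC.
    by move=> h3; apply: filterS (filterI h2 h3) => w [h4 nw] [Zw|//]; rewrite asboolT//; exact: h4.
  have [_ h3] := lL1 _ Zz'.
  have h4 : nbhs z (p @^-1` [set y | germ y (L1 z) (L z) false]).
    exact: (pc (open_nbhs_nbhs (conj (germ_open (L1 z) (L z) false) (hI z (conj Zz Zz'))))).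
  apply: filterS (filterI h2 (filterI h3 h4)) => w [g2 [g3 g4]] ZZw.
  have [Zw|nZw] := pselect (Z w); first by rewrite asboolT//; exact: g2.
  have Zw' : Z' w by case: ZZw.
  rewrite asboolF//; exact: (germ_trans (g3 Zw') g4).
have Zz' : Z' z by case: ZZz.
rewrite (asboolF nZz); have [h1 h2] := lL1 _ Zz'; split=> //.
have h3 : nbhs z (~` Z) by apply: open_nbhs_nbhs; split=> //; exact: closed_openC.
by apply: filterS (filterI h2 h3) => w [h4 nw] [//|Zw]; rewrite asboolF//; exact: h4.
Qed.

(** Off the fixed set the constant function is itself a lift, and comparison with it shows that the
    values do not change. *)
Lemma lift_constant Z L z w : connected Z -> lift Z L -> (forall v, Z v -> ~ F (p v)) ->
  Z z -> Z w -> L z (p z) = L w (p w).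
Proof.
move=> cZ lL ZF Zz Zw.
have lF : lift Z (fun _ _ => true).
  apply: (@lift_local (~` F)) => //; split.
  - exact: fixed_open_compl.
  - by move=> y Fy _; exists (~` F) => //; split=> //; exact: fixed_open_compl.
  - by move=> y Fy [/Fy].
have [[U sU Uz] _] := lL _ Zz; have [[U' sU' Uz'] _] := lF _ Zz.
have [b hb] := side_function_germ sU sU' Uz Uz'.
have := germ_value (ZF _ Zz) hb.
have := germ_value (ZF _ Zw) (lift_compare cZ lL lF Zz Zw hb).
by move=> <-; case: (L z _); case: (L w _).
Qed.

End Lifts.

Definition rect (s s' t t' : R) : set (R * R) := `[s, s'] `*` `[t, t'].

Lemma rect_closed s s' t t' : closed (rect s s' t t').
Proof.
have -> : rect s s' t t' = fst @^-1` `[s, s'] `&` snd @^-1` `[t, t'] by [].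
by apply: closedI; apply: closed_comp => [z _|]; [exact: cvg_fst|exact: interval_closed|
  exact: cvg_snd|exact: interval_closed].
Qed.

Lemma rect_connected s s' t t' : connected (rect s s' t t').
Proof.
apply: pairwise_connected => -[u v] [u' v'] /=; rewrite /rect /= !in_itv /=.
move=> [/andP[? ?] /andP[? ?]] [/andP[? ?] /andP[? ?]].
pose g (x : R) := (u + x * (u' - u), v + x * (v' - v)).
have gc : continuous g.
  have h (y y' : R) : continuous (fun x : R => y + x * y').
    by move=> x; apply: cvgD; [exact: cvg_cst|exact: mulrr_continuous].
  by move=> x; exact: (cvg_pair (h _ _ x) (h _ _ x)).
exists (g @` `[0, 1]); split.
- by apply: connected_image; [exact: connected_itv01|move=> x _; exact: gc].
- move=> _ [x /= + <-]; rewrite !in_itv /= => /andP[x0 x1].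
  by split; apply/andP; split; nra.
- by exists 0; rewrite /= ?in_itv /= ?lexx ?ler01// /g !mul0r !addr0.
- by exists 1; rewrite /= ?in_itv /= ?lexx ?ler01// /g !mul1r !subrKC.
Qed.

(** Existence of lifts over a homotopy. Small squares are glued into a thin strip and strips into
    the rectangle; two pieces meet in a segment, which is connected. *)
Lemma rect_lift (p : R * R -> M) s s' t t' : continuous p -> s <= s' -> t <= t' ->
  exists L, lift p (rect s s' t t') L.
Proof.
move=> pc ss tt.
have rectE1 u1 u2 u3 v1 v2 : u1 <= u2 -> u2 <= u3 ->
    rect u1 u3 v1 v2 = rect u1 u2 v1 v2 `|` rect u2 u3 v1 v2.
  move=> u12 u23; apply/seteqP; split=> -[u v]; rewrite /rect /= !in_itv /=.
    by move=> [/andP[h1 h2] ->]; have [h|/ltW h] := leP u u2; [left|right]; rewrite ?h1 ?h2 ?h.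
  move=> [[/andP[h1 h2] ->]|[/andP[h1 h2] ->]]; split=> //.
    by rewrite h1 (le_trans h2).
  by rewrite h2 (le_trans u12).
have rectE2 u1 u2 v1 v2 v3 : v1 <= v2 -> v2 <= v3 ->
    rect u1 u2 v1 v3 = rect u1 u2 v1 v2 `|` rect u1 u2 v2 v3.
  move=> v12 v23; apply/seteqP; split=> -[u v]; rewrite /rect /= !in_itv /=.
    by move=> [-> /andP[h1 h2]]; have [h|/ltW h] := leP v v2; [left|right]; rewrite ?h1 ?h2 ?h.
  move=> [[-> /andP[h1 h2]]|[-> /andP[h1 h2]]]; split=> //.
    by rewrite h1 (le_trans h2).
  by rewrite h2 (le_trans v12).
have rectS u1 u2 u1' u2' v1 v2 v1' v2' : u1 <= u1' -> u2' <= u2 -> v1 <= v1' -> v2' <= v2 ->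
    rect u1' u2' v1' v2' `<=` rect u1 u2 v1 v2.
  move=> h1 h2 h3 h4 [u v]; rewrite /rect /= !in_itv /= => -[/andP[? ?] /andP[? ?]].
  by split; apply/andP; split; apply: le_trans; eassumption.
have rectI1 u1 u2 u3 v1 v2 : u1 <= u2 -> u2 <= u3 ->
    rect u1 u2 v1 v2 `&` rect u2 u3 v1 v2 = rect u2 u2 v1 v2.
  move=> h12 h23; apply/seteqP; split=> -[u v]; rewrite /rect /= !in_itv /=.
    by move=> [[/andP[_ ->] ->] [/andP[-> _] _]].
  by move=> [/andP[h1 h2] ->]; rewrite h1 h2 (le_trans h12) ?(le_trans h2).
have rectI2 u1 u2 v1 v2 v3 : v1 <= v2 -> v2 <= v3 ->
    rect u1 u2 v1 v2 `&` rect u1 u2 v2 v3 = rect u1 u2 v2 v2.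
  move=> h12 h23; apply/seteqP; split=> -[u v]; rewrite /rect /= !in_itv /=.
    by move=> [[-> /andP[_ ->]] [_ /andP[-> _]]].
  by move=> [-> /andP[h1 h2]]; rewrite h1 h2 (le_trans h12) ?(le_trans h2).
apply: (itv_gluing (P := fun s s' => exists L, lift p (rect s s' t t') L)) ss.
- move=> u1 u2 u3 h12 h23 [L lL] [L' lL']; rewrite (rectE1 _ u2)//.
  apply: lift_glue lL lL' => //; [exact: rect_closed|exact: rect_closed|].
  by rewrite rectI1//; exact: rect_connected.
- by move=> u1 u1' u2' u2 h1 _ h2 [L lL]; exists L; apply: liftS lL; exact: rectS.
move=> u.
(* The width of the strip is left existential, so that gluing two strips may take the smaller
   width. *)
apply: (itv_gluing (P := fun t t' => exists2 e, 0 < e &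
  exists L, lift p (rect (u - e) (u + e) t t') L)) tt.
- move=> v1 v2 v3 h12 h23 [e e0 [L lL]] [e' e'0 [L' lL']].
  pose m := Num.min e e'; have m0 : 0 < m by rewrite lt_min e0 e'0.
  have me : m <= e by rewrite ge_min lexx.
  have me' : m <= e' by rewrite ge_min lexx orbT.
  exists m => //; rewrite (rectE2 _ _ _ v2)//.
  have lmL : lift p (rect (u - m) (u + m) v1 v2) L.
    by apply: liftS lL; apply: rectS => //; rewrite ?lerD2l ?lerN2.
  have lmL' : lift p (rect (u - m) (u + m) v2 v3) L'.
    by apply: liftS lL'; apply: rectS => //; rewrite ?lerD2l ?lerN2.
  apply: lift_glue lmL lmL' => //; [exact: rect_closed|exact: rect_closed|].
  by rewrite rectI2//; exact: rect_connected.
- move=> v1 v1' v2' v2 h1 _ h2 [e e0 [L lL]]; exists e => //; exists L.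
  by apply: liftS lL; exact: rectS.
move=> v; have [U [f [sU Uy]]] := side_function_exists (p (u, v)).
have [oU _ _] := sU.
have : nbhs (u, v) (p @^-1` U) by apply: pc; exact: open_nbhs_nbhs.
move=> /nbhs_ballP[e /= e0 he].
have e20 : 0 < e / 2 by rewrite divr_gt0.
have he' : rect (u - e / 2) (u + e / 2) (v - e / 2) (v + e / 2) `<=` p @^-1` U.
  move=> [u' v']; rewrite /rect /= !in_itv /= => -[/andP[? ?] /andP[? ?]].
  apply: he; split; rewrite /= -ball_normE /= ltr_distlC; lra.
exists (e / 2) => //; exists (e / 2) => //; exists (fun=> f).
by apply: (lift_local sU) => z /he'.
Qed.

End Monodromy.

(** * Paths in connected open sets *)

Section PathConnected.
Variables (R : realType) (n : nat) (M : smoothManifoldType R n).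
Variables (G : discreteGroupType) (a : group_action G M).
Hypotheses (hsmooth : smooth_action a) (hproper : proper_action a).

Definition path_in (O : set M) (x y : M) := exists c : R -> M,
  [/\ continuous c, c 0 = x, c 1 = y & forall t, O (c t)].

Lemma path_in_trans O x y z : path_in O x y -> path_in O y z -> path_in O x z.
Proof.
move=> [c [cc <- c1 cO]] [d [cd d0 <- dO]].
exists (fun t : R => if t <= 2^-1 then c (2 * t) else d (2 * t - 1)); split.
- by apply: path_concat => //; rewrite c1.
- by rewrite ifT ?mulr0// invr_ge0.
- rewrite ifF; first by congr d; ring.
  by apply/negbTE; rewrite -ltNge invf_lt1// ltr1n.
- by move=> t; case: ifP.
Qed.

Lemma slice_path x N c rho y z : slice_chart a x N c rho -> dom c y -> dom c z ->
  path_in (dom c) y z.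
Proof.
move=> sc cy cz.
pose l (t : R) := (1 - clamp t) *: coord c y + clamp t *: coord c z.
have lB t : (coord c @` dom c) (l t).
  by apply: (slice_convex sc); [exact: clamp_itv|exists y|exists z].
have cl : continuous l.
  move=> t; apply: (@continuous_comp _ _ _ (@clamp R)
    (fun t : R => (1 - t) *: coord c y + t *: coord c z)); first exact: clamp_continuous.
  exact: line_continuous.
exists (param c \o l); split.
- move=> t; apply: continuous_comp; first exact: cl.
  by apply: (@param_cts _ _ _ c); rewrite inE.
- by rewrite /l /= clamp_id ?lexx ?ler01// subr0 scale1r scale0r addr0 coordK ?inE.
- by rewrite /l /= clamp_id ?lexx ?ler01// subrr scale1r scale0r add0r coordK ?inE.
- by move=> t; case: (dom_param (lB t)).
Qed.

(** Being joined to [x] inside [O] is locally constant, because segments join the points of a slice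
    chart. *)
Lemma open_path_connected O x y : open O -> connected O -> O x -> O y -> path_in O x y.
Proof.
move=> oO cO Ox Oy.
have pS A z w : A `<=` O -> path_in A z w -> path_in O z w.
  by move=> AO [c [cc c0 c1 cA]]; exists c; split=> // t; exact: AO.
have loc w : O w -> exists2 V, open_nbhs w V &
    forall v v', V v -> V v' -> path_in O v v'.
  move=> Ow; have nO : nbhs w O by exact: open_nbhs_nbhs.
  have [c [rho sc]] := slice_chart_exists hsmooth hproper nO.
  exists (dom c); first exact: (slice_open_nbhs sc).
  by move=> v v' cv cv'; apply: (pS _ _ _ (slice_sub sc)); exact: (slice_path sc).
apply/asboolP; have [V [_ Vx] hV] := loc _ Ox.
rewrite (@locally_constant_connected M (fun w => `[< path_in O x w >]) _ y x cO)//.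
  by apply/asboolP; exact: hV.
move=> w Ow; have [W [oW Ww] hW] := loc _ Ow; exists W => // v Wv.
by apply/idP/idP => /asboolP h; apply/asboolP; apply: (path_in_trans h); exact: hW.
Qed.

End PathConnected.

(** * Reflections of a simply connected manifold *)

Section SimplyConnected.
Variables (R : realType) (n : nat) (M : smoothManifoldType R n).
Variables (G : discreteGroupType) (a : group_action G M).
Hypotheses (hM : connected [set: M]).
Hypotheses (hsmooth : smooth_action a) (hproper : proper_action a).
Hypotheses (heffective : effective_action a).

(** The lift over the homotopy square is constant along the three sides sent to [x], so it returns
    unchanged at the end of the loop. Along the loop it changes exactly once, a contradiction. *)
Lemma simply_connected_dissecting r : simply_connected R M -> reflection a r ->
  dissecting a r.
Proof.
move=> [_ sM] rr cF.
have [p wp] := reflection_wall hsmooth hproper rr.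
have [U [f [sf Up]]] := side_function_exists hsmooth hproper r p.
have [oU _ /(_ _ Up wp)[V oV fV]] := sf.
have nUV : nbhs p (U `&` V) by apply: filterI; exact: open_nbhs_nbhs.
have [c [rho sc]] := slice_chart_exists hsmooth hproper nUV.
have dF := fixed_codense hM hsmooth hproper heffective rr.
have [|x [cx Fx]] := dF (dom c) _ (@open_dom _ _ _ c).
  by exists p; exact: (slice_center sc).
have cU y : dom c y -> U y by move=> /(slice_sub sc)[].
have frx : f (a r x) = ~~ f x by apply: fV => //; case: (slice_sub sc cx).
have Frx := fixed_reflection hM hsmooth hproper heffective rr Fx.
have oF := @fixed_open_compl _ _ _ _ a hsmooth r.
have [c1 [cc1 c10 c11 c1F]] := open_path_connected hsmooth hproper oF cF Fx Frx.
have [c2 [cc2 c20 c21 c2c]] := slice_path sc (slice_inv sc wp.1 cx) cx.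
(* A loop through [x] and [r x] crossing the fixed set of [r] only in its
   second half, inside a slice chart at a wall. *)
pose l (t : R) := if t <= 2^-1 then c1 (2 * t) else c2 (2 * t - 1).
have cl : continuous l by apply: path_concat; rewrite // c11 c20.
have half1 : (2^-1 : R) < 1 by rewrite invf_lt1// ltr1n.
have half0 : 0 < (2^-1 : R) by rewrite invr_gt0.
have [half0W half1W] := (ltW half0, ltW half1).
have l0 : l 0 = x by rewrite /l ifT ?mulr0.
have l1 : l 1 = x.
  by rewrite /l leNgt half1 /= -[RHS]c21; congr c2; ring.
have lh : l 2^-1 = a r x by rewrite /l lexx mulfV.
have lU t : 2^-1 <= t -> U (l t).
  rewrite /l; case: ltgtP => // [_ _|<- _]; first exact/cU/c2c.
  by rewrite mulfV// c11 -c20; exact/cU/c2c.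
have lF t : t <= 2^-1 -> ~ fixed_set a r (l t) by rewrite /l => ->; exact: c1F.
have [|H [cH H0 H1 Hx]] := sM x l _ l0 l1; first exact: continuous_subspaceT.
pose h (z : R * R) := H (clamp z.1, clamp z.2).
have itvc t : 0 <= t <= 1 -> t \in `[0, 1]%R by rewrite in_itv.
have ch : continuous h.
  apply: (within_comp (f := fun z : R * R => (clamp z.1, clamp z.2)) cH).
    have k1 : continuous (fun z : R * R => clamp z.1).
      by move=> z; apply: (@continuous_comp _ _ _ fst (@clamp R));
        [exact: cvg_fst|exact: clamp_continuous].
    have k2 : continuous (fun z : R * R => clamp z.2).
      by move=> z; apply: (@continuous_comp _ _ _ snd (@clamp R));
        [exact: cvg_snd|exact: clamp_continuous].
    by move=> z; exact: (cvg_pair (k1 z) (k2 z)).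
  by move=> z; split; apply: itvc; exact: clamp_itv.
have [L lL] := rect_lift hM hsmooth hproper heffective rr ch (@ler01 R) (@ler01 R).
have h0 t : 0 <= t <= 1 -> h (0, t) = l t.
  by move=> t01; rewrite /h /= !clamp_id ?lexx ?ler01// H0//; exact: itvc.
have h1 t : h (1, t) = x.
  by rewrite /h /= clamp_id ?ler01 ?lexx// H1//; apply: itvc; exact: clamp_itv.
have hx0 s : h (s, 0) = x.
  by rewrite /h /= (clamp_id (t := 0)) ?lexx ?ler01//; apply: (Hx _ _).1; apply: itvc; exact: clamp_itv.
have hx1 s : h (s, 1) = x.
  by rewrite /h /= (clamp_id (t := 1)) ?lexx ?ler01//; apply: (Hx _ _).2; apply: itvc; exact: clamp_itv.
have rectE s s' t t' u v : rect s s' t t' (u, v) <-> s <= u <= s' /\ t <= v <= t'.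
  by rewrite /rect /= !in_itv.
have sub s s' t t' : 0 <= s -> s' <= 1 -> 0 <= t -> t' <= 1 ->
    lift a r h (rect s s' t t') L.
  move=> ? ? ? ?; apply: liftS lL => -[u v] /rectE[/andP[? ?] /andP[? ?]].
  by apply/rectE; split; apply/andP; split; lra.
have const s s' t t' : 0 <= s -> s <= s' -> s' <= 1 -> 0 <= t -> t <= t' -> t' <= 1 ->
    (forall u v, s <= u <= s' -> t <= v <= t' -> ~ fixed_set a r (h (u, v))) ->
    L (s, t) (h (s, t)) = L (s', t') (h (s', t')).
  move=> ? ss' ? ? tt' ? nF; apply: (lift_constant hM hsmooth hproper heffective rr ch
    (@rect_connected R s s' t t')).
  - exact: sub.
  - by move=> [u v] /rectE[]; exact: nF.
  - by apply/rectE; rewrite !lexx ss' tt'.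
  - by apply/rectE; rewrite !lexx ss' tt'.
have e1 : L (0, 0) x = L (1, 0) x.
  by rewrite -{1}(hx0 0) -(hx0 1); apply: const => // u v _; rewrite -eq_le => /eqP <-; rewrite hx0.
have e2 : L (1, 0) x = L (1, 1) x.
  by rewrite -{1}(h1 0) -(h1 1); apply: const => // u v; rewrite -eq_le => /eqP <- _; rewrite h1.
have e3 : L (0, 1) x = L (1, 1) x.
  by rewrite -{1}(hx1 0) -(hx1 1); apply: const => // u v _; rewrite -eq_le => /eqP <-; rewrite hx1.
have hh : h (0, 2^-1) = a r x by rewrite h0// half0W.
(* The first half of the loop avoids the fixed set, so the lift keeps its value up to [a r x]. *)
have e4 : L (0, 0) x = L (0, 2^-1) (a r x).
  rewrite -{1}(hx0 0) -hh; apply: const => // u v.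
  rewrite -eq_le => /eqP <- /andP[v0 vh]; rewrite h0; first exact: lF.
  by rewrite v0 (le_trans vh).
have sh : rect 0 0 2^-1 1 (0, 2^-1 : R) by apply/rectE; rewrite !lexx ?half0W half1W.
have s1 : rect 0 0 2^-1 1 (0, 1 : R) by apply/rectE; rewrite !lexx ?half0W half1W.
have lL2 : lift a r h (rect 0 0 2^-1 1) L by apply: sub.
(* Over the second half the single side function [f] is a lift; it takes opposite values at [a r x]
   and [x], and comparison forces the same on [L]. *)
have lf : lift a r h (rect 0 0 2^-1 1) (fun=> f).
  apply: lift_local sf _ => -[u v] /rectE[]; rewrite -eq_le => /eqP <- /andP[hv v1].
  by rewrite h0; [exact: lU|rewrite v1 (le_trans _ hv)].
have [[W sW Wx] _] := lL2 _ sh; have [[W' sW' Wx'] _] := lf _ sh.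
have [b hb] := side_function_germ hsmooth hproper sW sW' Wx Wx'.
have hb' := lift_compare hM hsmooth hproper heffective rr ch (@rect_connected R _ _ _ _) lL2 lf sh s1 hb.
move: hb hb'; rewrite hh hx1 => /(germ_value Frx) + /(germ_value Fx).
rewrite frx -e4 e1 e2 -e3.
by move=> <-; case: (L _ _); case: (f x).
Qed.

End SimplyConnected.

Lemma generated_byP (G : groupType) (S : set G) : generated_by S <->
  forall H : set G, H 1%g -> (forall g h, H g -> H h -> H (g * h)%g) ->
    (forall g, H g -> H g^-1%g) -> S `<=` H -> forall g, H g.
Proof.
split=> [gS H H1 HM HV SH g|gS].
  have : [set: G] g by [].
  rewrite -gS; apply; split=> //; split; first by rewrite unfold_in; exact: mem_set.
  by move=> u v /set_mem Hu /set_mem Hv; apply/mem_set/HM => //; exact: HV.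
apply/seteqP; split=> // g _ H [gH SH]; apply: gS => //.
- by apply: set_mem; case: gH.
- by move=> u v Hu Hv; apply/set_mem/(group_closedM gH); exact: mem_set.
- by move=> u Hu; apply/set_mem/(group_closedV gH); exact: mem_set.
Qed.

Theorem corollary7 (R : realType) (n : nat) (M : smoothManifoldType R n)
    (G : discreteGroupType) (a : group_action G M)
    (hM : connected [set: M])
    (hsmooth : smooth_action a) (hproper : proper_action a)
    (heffective : effective_action a)
    (hcase : (forall r : G, reflection a r -> dissecting a r) \/
             simply_connected R M) :
  (exists s : orbit_space a -> M, continuous_section (orbit_map a) s) <->
  generated_by [set r : G | reflection a r].
Proof.
split=> [[s hs]|/generated_byP gen].
  by apply/generated_byP => H H1 HM HV; exact: (section_generates hM hsmooth hproper heffective hs).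
have hdis r : reflection a r -> dissecting a r.
  by case: hcase => [|sM] h; [exact: h|exact: (simply_connected_dissecting hM hsmooth hproper heffective sM)].
(* The empty manifold counts as connected; its orbit space is empty, and any map is a section. *)
have [M0|noM] := pselect ([set: M] !=set0); last first.
  have M0 (x : M) : False by apply: noM; exists x.
  exists (fun y => repr y); split; first by move=> y; case: (M0 (repr y)).
  by apply/funext => y; case: (M0 (repr y)).
have [x0 [_ x0_free]] := free_dense hM hsmooth hproper heffective M0 openT.
have /choice[side sideP] (r : G) : exists A : set M, reflection a r ->
    open A /\ forall y, ~ fixed_set a r y -> A y <-> ~ A (a r y).
  have [rr|nr] := pselect (reflection a r); last by exists setT.
  by have [A oA hA] := dissecting_sides hM hsmooth hproper heffective rr (hdis r rr); exists A.
apply: (chamber_section hM hsmooth hproper heffective hdis (side := side) _ _ x0_free) => //.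
- by move=> r /sideP[].
- by move=> r /sideP[].
Qed.
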